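(* Let $(w_n)_{n\in\mathbb Z}\subset\mathbb C\setminus\{0\}$ and $(v_n)_{n\in\mathbb Z}\subset\mathbb R$ be bounded sequences, let $H$ be the Jacobi operator on $\ell^2(\mathbb Z)$ given by $(Hu)_n=w_nu_{n+1}+\overline{w}_{n-1}u_{n-1}+v_nu_n$, and let $\mu$ be the spectral measure of $H$. Assume that there are positive constants $\Lambda,\beta,\delta$ and a sequence of positive integers $q_n\to\infty$ such that, for every $q\in\{q_n\}$, $$\max_{|m|\le e^{\delta\beta q}}|w_m-w_{m\pm q}|\le e^{-\beta q},\qquad \max_{|m|\le e^{\delta\beta q}}|v_m-v_{m\pm q}|\le e^{-\beta q},\qquad \min_{|m|\le e^{\delta\beta q}}\prod_{j=m}^{m+q-1}|w_j|>e^{-\Lambda q}.$$ Then there exists an explicit constant $C=C(\delta,\Lambda,\|w\|_\infty,\|v\|_\infty)>0$ (depending only on the listed quantities) such that if $\beta>C$ and $\gamma<1-\frac{C}{\beta}$ (with $\gamma\in(0,1)$), then $\mu$ is $\gamma$-spectral continuous. Consequently, $$\dim_{\rm spe}(\mu)\ge 1-\frac{C}{\beta}.$$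
   Context: The spectral measure of the whole-line operator $H$ is $\mu=\mu_{\delta_0}+\mu_{\delta_1}$, where $\mu_{\delta_j}(B)=\langle\delta_j,\mathbf 1_B(H)\delta_j\rangle$. Let $M(E+i\varepsilon)=\int\frac{d\mu(E')}{E'-(E+i\varepsilon)}$ be its Borel transform. For $\gamma\in(0,1)$, $\mu$ is called (upper) $\gamma$-spectral continuous if for $\mu$-a.e. $E$, $\liminf_{\varepsilon\downarrow0}\varepsilon^{1-\gamma}|M(E+i\varepsilon)|<\infty$. The (upper) spectral dimension is $\dim_{\rm spe}(\mu)=\sup\{\gamma\in(0,1):\mu\text{ is }\gamma\text{-spectral continuous}\}$. Here $\|w\|_\infty=\sup_n|w_n|$, $\|v\|_\infty=\sup_n|v_n|$. *)

(* Defs.v *)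
From mathcomp Require Export all_boot all_order all_algebra.
From mathcomp Require Export all_classical all_reals all_analysis.
From mathcomp Require Export complex.
Set Implicit Arguments.
Unset Strict Implicit.
Unset Printing Implicit Defensive.
Import Order.TTheory GRing.Theory Num.Theory.
Import numFieldNormedType.Exports.
Local Open Scope classical_set_scope.
Local Open Scope ring_scope.
Local Open Scope complex_scope.

Notation normc := ComplexField.Normc.normc.

Section Ell2.
Context {R : realType}.
Implicit Types (u v : int -> R[i]) (n : int).

(* Unconditional summation over int; the intended value only for absolutely
   summable families. *)
Definition zsum (f : int -> R) : R :=
  fine (\esum_(n in [set: int]) (Num.max (f n) 0)%:E)
  - fine (\esum_(n in [set: int]) (Num.max (- f n) 0)%:E).

Definition zsumC (f : int -> R[i]) : R[i] :=
  zsum (fun n => complex.Re (f n)) +i* zsum (fun n => complex.Im (f n)).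

Definition sqnorm2 u : \bar R :=
  \esum_(n in [set: int]) ((normc (u n)) ^+ 2)%:E.

Definition ell2 : set (int -> R[i]) := [set u | (sqnorm2 u < +oo)%E].

Definition inner2 u v : R[i] := zsumC (fun n => (u n)^* * v n).

Definition kron (j : int) : int -> R[i] := fun n => (n == j)%:R.

Definition orth_projection (P : (int -> R[i]) -> int -> R[i]) : Prop :=
  [/\ forall u, ell2 u -> ell2 (P u),
      forall (a : R[i]) u v, ell2 u -> ell2 v ->
        P (fun n => a * u n + v n) = (fun n => a * P u n + P v n),
      forall u, ell2 u -> P (P u) = P u
    & forall u v, ell2 u -> ell2 v -> inner2 u (P v) = inner2 (P u) v].

(* Bounded projection-valued measures on the Borel sets of R (Reed-Simon,
   Methods of Modern Mathematical Physics I, section VII.3).  Only the values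
   on Borel sets and on square-summable sequences are meaningful. *)
Record bounded_pvm
    (P : set (measurableTypeR R) -> (int -> R[i]) -> int -> R[i]) : Prop :=
  BoundedPVM {
    pvm_proj : forall B, measurable B -> orth_projection (P B);
    pvm_set0 : forall u, ell2 u -> P set0 u = (fun=> 0);
    pvm_bounded : exists a : R,
      forall u, ell2 u -> P [set` `]- a, a[] u = u;
    pvm_setI : forall A B, measurable A -> measurable B ->
      forall u, ell2 u -> P A (P B u) = P (A `&` B) u;
    pvm_sigma_additive : forall F : (set (measurableTypeR R))^nat,
      (forall k, measurable (F k)) -> trivIset setT F ->
      forall u, ell2 u ->
        sqnorm2 (fun n => P (\bigcup_k F k) u n - \sum_(k < N) P (F k) u n)
          @[N --> \oo] --> 0%E
  }.

(* H = \int lambda dP(lambda), i.e. <u, H u> = \int lambda d<u, P(lambda) u>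
   for all u in ell2.  For a bounded self-adjoint H exactly one bounded P has
   this property, by the spectral theorem, and then P B is 1_B(H). *)
Definition spectral_resolution (H : (int -> R[i]) -> int -> R[i])
    (P : set (measurableTypeR R) -> (int -> R[i]) -> int -> R[i]) : Prop :=
  bounded_pvm P /\
  forall u, ell2 u ->
    exists nu : {measure set (measurableTypeR R) -> \bar R},
      [/\ forall B, measurable B -> nu B = (complex.Re (inner2 u (P B u)))%:E,
          nu.-integrable setT (fun x : measurableTypeR R => x%:E)
        & inner2 u (H u) = (\int[nu]_x x)%:C].

(* mu = mu_{delta_0} + mu_{delta_1}, where
   mu_{delta_j}(B) = <delta_j, 1_B(H) delta_j>. *)
Definition is_spectral_measure (H : (int -> R[i]) -> int -> R[i])
    (mu : {measure set (measurableTypeR R) -> \bar R}) : Prop :=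
  exists2 P, spectral_resolution H P &
    forall B, measurable B ->
      mu B = (complex.Re (inner2 (kron 0) (P B (kron 0)))
              + complex.Re (inner2 (kron 1) (P B (kron 1))))%:E.

Definition jacobi (w : int -> R[i]) (v : int -> R) (u : int -> R[i]) :
    int -> R[i] :=
  fun n => w n * u (n + 1) + (w (n - 1))^* * u (n - 1) + (v n)%:C * u n.

End Ell2.

Section SpectralDimension.
Context {R : realType}.
Variable mu : {measure set (measurableTypeR R) -> \bar R}.

Definition borel_transform (z : R[i]) : R[i] :=
  (\int[mu]_x complex.Re ((x%:C - z)^-1)) +i* (\int[mu]_x complex.Im ((x%:C - z)^-1)).

Definition spectral_continuous (gamma : R) : Prop :=
  {ae mu, forall E : measurableTypeR R,
    (limf_einf
       (fun e : R =>
          (e `^ (1 - gamma) * normc (borel_transform ((E : R) +i* e)))%:E)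
       (0 : R)^'+ < +oo)%E}.

(* sup set0 = 0 here, the usual convention for a dimension in [0, 1]. *)
Definition dim_spe : R :=
  sup [set gamma : R | 0 < gamma < 1 /\ spectral_continuous gamma].

End SpectralDimension.

(* Main.v *)
(** Up to a diagonal gauge the weights are positive. Let D(E) be the trace of the
    transfer matrix over one approximate period q. By Cayley-Hamilton, applied to the
    basis vectors projected to a tiny spectral interval around E,
    e_{n+q} + e_{n-q} = D(E) e_n up to exponentially small errors. Evaluating Chebyshev
    polynomials of D on e_0 and e_1 therefore gives nearly orthogonal sums of translates,
    so the distribution of D under mu is nearly the arcsine law and the set where |D| >= 2 - eta
    has mu-measure O(1/k), where eta depends on k only.

    Off this set the recurrence x_{j+1} = D x_j - x_{j-1} conserves a definite quadratic
    form, which stays under control in the approximately periodic case, so the solutions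
    are bounded by e^{C1 q} up to length L_q = e^{c beta q}. Averaging the Wronskian of
    such a solution and the spectrally projected basis bounds mu(E - 1/L, E + 1/L) by
    e^{C2 q}/L for every L <= L_q. Summing over dyadic L gives
    |M(E + i/L_q)| <= e^{C3 q}, that is e^{1-gamma} |M| <= 1 at e = 1/L_q once
    (1 - gamma) beta exceeds a constant. The exceptional sets have measure tending to 0,
    so mu-almost every E avoids infinitely many of them. *)

From HB Require Import structures.
From mathcomp Require Import ring lra zify measurable_realfun.
Require Import Defs.
Set Implicit Arguments.
Unset Strict Implicit.
Unset Printing Implicit Defensive.
Import Order.TTheory GRing.Theory Num.Theory.
Import numFieldNormedType.Exports.
Local Open Scope classical_set_scope.
Local Open Scope ring_scope.
Local Open Scope complex_scope.

(** * Seminorms and inner products *)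

(** The operator enters only through its projections [P B]; no function of H such as D(H) is ever
    formed. On a short interval around c the vector [P B (H u - c *: u)] is small
    ([proj_almost_eigen]), so the sequence [P B (e n)] is a vector-valued approximate solution of
    the Jacobi recurrence. The transfer estimates are therefore stated for an arbitrary seminorm and
    serve both this sequence and scalar solutions. The trace D varies with the energy, so the
    spectrum is cut into cells of width d and D is frozen at one energy per cell. The cells are very
    numerous; Bessel's inequality makes the estimates independent of their number. Single weights
    may be tiny. All bounds are expressed by one number X = exp([growth_rate] q), which controls the
    transfer over a period and also the inverse of each weight in a window ([window_inv]). The
    integer k, and with it eta, is fixed before q is taken large. The threshold on beta mainly
    collects the factor X^8 in the bound on |M|; losses that are polynomial in q or depend on k are
    paid by spare factors exp(-q). *)

Lemma ler_expr_base (R : realType) (x y : R) n : 0 <= x -> x <= y -> x ^+ n <= y ^+ n.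
Proof. by move=> x0 xy; apply: lerXn2r => //; rewrite nnegrE// (le_trans x0). Qed.

Record inner_product (R : realType) (V : lmodType R) (ip : V -> V -> R) : Prop :=
  InnerProduct {
    ipC : forall u v, ip u v = ip v u;
    ipDl : forall u v w, ip (u + v) w = ip u w + ip v w;
    ipZl : forall a u v, ip (a *: u) v = a * ip u v;
    ip_ge0 : forall u, 0 <= ip u u }.

Record seminorm (R : realType) (V : lmodType R) (N : V -> R) : Prop :=
  Seminorm {
    snD : forall u v, N (u + v) <= N u + N v;
    snZ : forall a u, N (a *: u) = `|a| * N u }.

Section Seminorm.
Context {R : realType} {V : lmodType R} (N : V -> R) (HN : seminorm N).

Lemma sn0 : N 0 = 0.
Proof. by rewrite -(scale0r (0 : V)) (snZ HN) normr0 mul0r. Qed.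

Lemma snN u : N (- u) = N u.
Proof. by rewrite -scaleN1r (snZ HN) normrN1 mul1r. Qed.

Lemma sn_ge0 u : 0 <= N u.
Proof. by have := snD HN u (- u); rewrite snN subrr sn0; lra. Qed.

Lemma snB u v : N (u - v) <= N u + N v.
Proof. by rewrite -(snN v) (snD HN). Qed.

Lemma sn_sum (I : Type) (r : seq I) (P : pred I) (F : I -> V) :
  N (\sum_(i <- r | P i) F i) <= \sum_(i <- r | P i) N (F i).
Proof.
elim/big_ind2: _ => [|x a y b xa yb|//]; first by rewrite sn0.
by apply: le_trans (snD HN _ _) _; exact: lerD.
Qed.

End Seminorm.

Lemma absr_seminorm (R : realType) : seminorm (fun x : R^o => `|x| : R).
Proof. by split=> [u v|a u]; [exact: ler_normD|rewrite normrM]. Qed.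

Section InnerProduct.
Context {R : realType} {V : lmodType R} (ip : V -> V -> R).
Hypothesis Hip : inner_product ip.

Definition ipn (u : V) : R := Num.sqrt (ip u u).

Lemma ipDr u v w : ip u (v + w) = ip u v + ip u w.
Proof. by rewrite !(ipC Hip u) (ipDl Hip). Qed.

Lemma ipZr a u v : ip u (a *: v) = a * ip u v.
Proof. by rewrite !(ipC Hip u) (ipZl Hip). Qed.

Lemma ip0l u : ip 0 u = 0.
Proof. by rewrite -(scale0r (0 : V)) (ipZl Hip) mul0r. Qed.

Lemma ip0r u : ip u 0 = 0.
Proof. by rewrite (ipC Hip) ip0l. Qed.

Lemma ipNl u v : ip (- u) v = - ip u v.
Proof. by rewrite -scaleN1r (ipZl Hip) mulN1r. Qed.

Lemma ipNr u v : ip u (- v) = - ip u v.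
Proof. by rewrite (ipC Hip) ipNl (ipC Hip). Qed.

Lemma ipBl u v w : ip (u - v) w = ip u w - ip v w.
Proof. by rewrite (ipDl Hip) ipNl. Qed.

Lemma ipBr u v w : ip w (u - v) = ip w u - ip w v.
Proof. by rewrite ipDr ipNr. Qed.

Lemma ip_sumr (I : Type) (r : seq I) (P : pred I) (F : I -> V) u :
  ip u (\sum_(i <- r | P i) F i) = \sum_(i <- r | P i) ip u (F i).
Proof.
by elim/big_rec2: _ => [|i y x _ <-]; [rewrite ip0r|rewrite ipDr].
Qed.

Lemma ipn_sq u : ipn u ^+ 2 = ip u u.
Proof. by rewrite sqr_sqrtr ?(ip_ge0 Hip). Qed.

Lemma ipn_ge0 u : 0 <= ipn u.
Proof. exact: sqrtr_ge0. Qed.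

Lemma ip_quad t u v : ip (u + t *: v) (u + t *: v) =
  ip u u + 2 * t * ip u v + t ^+ 2 * ip v v.
Proof.
rewrite !(ipDr, ipDl Hip) !(ipZr, ipZl Hip) (ipC Hip v u).
by ring.
Qed.

(** The form is only semidefinite, so the usual minimising multiple [ipn u / ipn v] settles the case
    of two nonzero norms, and null vectors are treated apart. *)
Lemma ip_cauchy_schwarz u v : ip u v <= ipn u * ipn v.
Proof.
have [/eqP v0|v0] := boolP (ipn v == 0).
  have vv : ip v v = 0 by rewrite -ipn_sq v0 expr0n.
  rewrite v0 mulr0 leNgt; apply/negP => uv.
  (* If the null vector [v] paired positively with [u], this multiple of it would bring the squared
     norm down to [- ip u u - 2]. *)
  have := ip_ge0 Hip (u + (- (ip u u + 1) / ip u v) *: v).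
  rewrite ip_quad vv mulr0 addr0 -mulrA divfK ?gt_eqF//.
  by have := ip_ge0 Hip u; lra.
have v1 : 0 < ipn v by rewrite lt_neqAle eq_sym v0 ipn_ge0.
have := ip_ge0 Hip (u + (- ipn u / ipn v) *: v).
rewrite ip_quad -!ipn_sq.
have -> : ipn u ^+ 2 + 2 * (- ipn u / ipn v) * ip u v +
    (- ipn u / ipn v) ^+ 2 * ipn v ^+ 2 =
    2 * (ipn u / ipn v) * (ipn u * ipn v - ip u v) by field.
have [/eqP u0 _|u0] := boolP (ipn u == 0).
  have uu : ip u u = 0 by rewrite -ipn_sq u0 expr0n.
  rewrite u0 mul0r leNgt; apply/negP => uv.
  have := ip_ge0 Hip (v + (- (ip v v + 1) / ip u v) *: u).
  rewrite ip_quad uu mulr0 addr0 (ipC Hip v u) -mulrA divfK ?gt_eqF//.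
  by have := ip_ge0 Hip v; lra.
have u1 : 0 < ipn u by rewrite lt_neqAle eq_sym u0 ipn_ge0.
by rewrite pmulr_rge0 ?subr_ge0// mulr_gt0// divr_gt0.
Qed.

Lemma ipn_seminorm : seminorm ipn.
Proof.
split=> [u v|a u]; last first.
  by rewrite /ipn (ipZl Hip) ipZr mulrA -expr2 sqrtrM ?sqr_ge0// sqrtr_sqr.
rewrite -(@ler_pXn2r _ 2) ?nnegrE ?addr_ge0 ?ipn_ge0//.
have e : u + v = u + 1 *: v by rewrite scale1r.
rewrite ipn_sq e ip_quad sqrrD !ipn_sq.
by have := ip_cauchy_schwarz u v; lra.
Qed.

(* Polarization bounds the symmetric operator A by its numerical radius. *)
Lemma numerical_radius_bound (A : V -> V) (h : R) : 0 < h ->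
  (forall u v, A (u + v) = A u + A v) ->
  (forall a u, A (a *: u) = a *: A u) ->
  (forall u v, ip u (A v) = ip (A u) v) ->
  (forall u, `|ip u (A u)| <= h * ip u u) ->
  forall u, ipn (A u) <= h * ipn u.
Proof.
move=> h0 AD AZ As Ah u.
have key t : ip (u + t *: A u) (A (u + t *: A u)) =
   ip u (A u) + 2 * t * ip (A u) (A u) + t ^+ 2 * ip (A u) (A (A u)).
  by rewrite AD AZ !(ipDl Hip) !ipDr !(ipZl Hip, ipZr) (As (u) (A u)); ring.
(* Subtracting the bounds at t = 1/h and t = -1/h removes the terms even in t on the left. With this
   t the right side contains exactly half of the left side, which is then absorbed. *)
have h1 := Ah (u + h^-1 *: A u).
have h2 := Ah (u + (- h^-1) *: A u).
rewrite !key !ip_quad in h1 h2.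
rewrite -(@ler_pXn2r _ 2) ?nnegrE ?mulr_ge0 ?ipn_ge0//; last exact: ltW.
rewrite exprMn !ipn_sq.
set x := ip (A u) (A u) in h1 h2 *; set y := ip u u in h1 h2 *.
set z := ip u (A u) in h1 h2 *.
set w := ip (A u) (A (A u)) in h1 h2 *.
move: h1 h2; rewrite !ler_norml => /andP[_ h1] /andP[h2 _].
have : 4 * h^-1 * x <= 2 * h * y + 2 * h^-1 * x.
  suff e : 2 * h * h^-1 ^+2 * x = 2 * h^-1 * x.
    by move: h1 h2; rewrite -e sqrrN; lra.
  by field; lra.
move=> h3.
have : h * (4 * h^-1 * x) <= h * (2 * h * y + 2 * h^-1 * x) by rewrite ler_pM2l.
have -> : h * (4 * h^-1 * x) = 4 * x by field; lra.
have -> : h * (2 * h * y + 2 * h^-1 * x) = 2 * h ^+ 2 * y + 2 * x by field; lra.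
by lra.
Qed.

Lemma orthonormal_sum (J : finType) (K : eqType) (e : K -> V) (f : J -> K)
    (c : J -> R) :
  (forall m n, ip (e m) (e n) = (m == n)%:R) -> injective f ->
  ip (\sum_j c j *: e (f j)) (\sum_j c j *: e (f j)) = \sum_j c j ^+ 2.
Proof.
move=> he inj; rewrite ip_sumr; apply: eq_bigr => j _.
rewrite ipZr (ipC Hip) ip_sumr (bigD1 j)//= ipZr he eqxx mulr1.
rewrite big1 ?addr0// => i /negbTE ij.
by rewrite ipZr he (inj_eq inj) eq_sym ij mulr0.
Qed.

End InnerProduct.

(** * Spectral projections *)

Section MeasureOnReals.
Context {R : realType}.

Lemma Rintegral_concentrated
    (nu : {measure set (measurableTypeR R) -> \bar R}) (B : set (measurableTypeR R))
    (c h r : R) :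
  measurable B -> B `<=` [set x : R | c - h <= x <= c + h] ->
  nu B = r%:E -> nu (~` B) = 0%E ->
  nu.-integrable setT (fun x : measurableTypeR R => x%:E) ->
  `|\int[nu]_x x - c * r| <= h * r.
Proof.
move=> mB sB nuB nuC int.
have mC : measurable (~` B) by exact: measurableC.
have intB : nu.-integrable B (fun x : measurableTypeR R => x%:E).
  exact: integrableS int.
have -> : (\int[nu]_x (x : R))%R = (\int[nu]_(x in B) (x : R))%R.
  rewrite -(setUv B) Rintegral_setU ?setUv//; last first.
    by apply/disj_setPS; rewrite setICr.
  rewrite [X in _ + X]/Rintegral null_set_integral ?addr0//.
have intc k : nu.-integrable B (EFin \o cst k).
  apply/integrableP; split; first exact/measurable_realfun.measurable_EFinP.
  under eq_integral do rewrite /=.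
  by rewrite integral_cst// nuB -EFinM ltry.
have cB k : (\int[nu]_(x in B) (cst k x : R))%R = k * r.
  by rewrite Rintegral_cst// nuB.
rewrite ler_norml; apply/andP; split.
- rewrite -subr_ge0.
  have : (\int[nu]_(x in B) (cst (c - h) x : R) <= \int[nu]_(x in B) (x : R))%R.
    by apply: le_Rintegral => // x /sB /= /andP[].
  by rewrite cB; lra.
- have : (\int[nu]_(x in B) (x : R) <= \int[nu]_(x in B) (cst (c + h) x : R))%R.
    by apply: le_Rintegral => // x /sB /= /andP[].
  by rewrite cB; lra.
Qed.

Lemma Rintegral_eq_measure
    (nu1 nu2 : {measure set (measurableTypeR R) -> \bar R}) :
  (forall B, measurable B -> nu1 B = nu2 B) ->
  (\int[nu1]_x (x : measurableTypeR R) = \int[nu2]_x (x : measurableTypeR R))%R.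
Proof.
by move=> e; congr fine; apply: eq_measure_integral => A mA _; exact: e.
Qed.

End MeasureOnReals.

Section Resolution.
Context {R : realType} {V : lmodType R} (ip : V -> V -> R).
Let T := measurableTypeR R.

(** A real-linear interface between the analysis and the concrete operator: the estimates are proved
    from these clauses, which [l2_resolution] later supplies. The scalar measures of [rs_measure]
    are the link between the projections and the energy form of [H]. *)
Record resolution (H : V -> V) (P : set T -> V -> V) : Prop := Resolution {
  rs_ip : inner_product ip;
  rs_HD : forall u v, H (u + v) = H u + H v;
  rs_HZ : forall a u, H (a *: u) = a *: H u;
  rs_Hsym : forall u v, ip u (H v) = ip (H u) v;
  rs_PD : forall B u v, measurable B -> P B (u + v) = P B u + P B v;
  rs_PZ : forall B a u, measurable B -> P B (a *: u) = a *: P B u;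
  rs_Psym : forall B u v, measurable B -> ip u (P B v) = ip (P B u) v;
  rs_P0 : forall u, P set0 u = 0;
  rs_PI : forall A B u, measurable A -> measurable B ->
    P A (P B u) = P (A `&` B) u;
  rs_window : exists a : R, forall u, P [set` `]- a, a[] u = u;
  rs_measure : forall u, exists nu : {measure set T -> \bar R},
    [/\ forall B, measurable B -> nu B = (ip u (P B u))%:E,
        nu.-integrable setT (fun x : T => x%:E)
      & ip u (H u) = \int[nu]_x x] }.

Context (H : V -> V) (P : set T -> V -> V) (HP : resolution H P).
Let Hip := rs_ip HP.
Notation N := (ipn ip).
Let HN := ipn_seminorm Hip.

Lemma proj_id B u : measurable B -> P B (P B u) = P B u.
Proof. by move=> mB; rewrite (rs_PI HP)// setIid. Qed.

Lemma ip_proj B u v : measurable B -> ip u (P B v) = ip (P B u) (P B v).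
Proof. by move=> mB; rewrite -(rs_Psym HP)// proj_id. Qed.

Lemma ipn_proj B u : measurable B -> N (P B u) ^+ 2 = ip u (P B u).
Proof. by move=> mB; rewrite (ipn_sq Hip) [RHS]ip_proj. Qed.

Lemma projN B u : measurable B -> P B (- u) = - P B u.
Proof. by move=> mB; rewrite -scaleN1r (rs_PZ HP)// scaleN1r. Qed.

Lemma proj0 B : measurable B -> P B 0 = 0.
Proof. by move=> mB; have := rs_PZ HP 0 0 mB; rewrite !scale0r. Qed.

Lemma projB B u v : measurable B -> P B (u - v) = P B u - P B v.
Proof. by move=> mB; rewrite (rs_PD HP)// projN. Qed.

Lemma proj_sum B (I : Type) (r : seq I) (F : I -> V) : measurable B ->
  P B (\sum_(i <- r) F i) = \sum_(i <- r) P B (F i).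
Proof.
move=> mB; elim/big_rec2 : _ => [|i y x _ <-]; last by rewrite (rs_PD HP)//.
exact: proj0.
Qed.

Lemma proj_le B u : measurable B -> N (P B u) <= N u.
Proof.
move=> mB; rewrite -(@ler_pXn2r _ 2) ?nnegrE ?ipn_ge0//.
have := ip_ge0 Hip (u - P B u).
rewrite (ipBl Hip) !(ipBr Hip) (ipC Hip (P B u) u) (ipn_proj _ mB) (ipn_sq Hip).
by rewrite -(ip_proj u u mB); lra.
Qed.

(* The vectors P_B f + (1 - P_B) g and P_B f - (1 - P_B) g have the same
   spectral measure, hence the same energy. *)
Lemma proj_commute B f g : measurable B -> ip (P B f) (H (g - P B g)) = 0.
Proof.
move=> mB; set w1 := P B f; set w2 := g - P B g.
have Pw2 : P B w2 = 0 by rewrite projB// proj_id// subrr.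
have cross A : measurable A -> ip w1 (P A w2) = 0.
  move=> mA; rewrite -(rs_Psym HP)// (rs_PI HP)// setIC -(rs_PI HP)// Pw2.
  by rewrite proj0// (ip0r Hip).
have [n1 [e1 _ i1]] := rs_measure HP (w1 + w2).
have [n2 [e2 _ i2]] := rs_measure HP (w1 - w2).
have : ip (w1 + w2) (H (w1 + w2)) = ip (w1 - w2) (H (w1 - w2)).
  rewrite i1 i2; apply: Rintegral_eq_measure => A mA; rewrite e1// e2//.
  rewrite projB// (rs_PD HP)// (ipBl Hip) (ipDl Hip) !(ipBr Hip) !(ipDr Hip).
  rewrite cross// (ipC Hip w2 (P A w1)) -(rs_Psym HP)// cross//.
  by congr (_%:E); ring.
have -> : H (w1 - w2) = H w1 - H w2.
  by rewrite (rs_HD HP) -scaleN1r (rs_HZ HP) scaleN1r.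
rewrite (rs_HD HP) (ipBl Hip) (ipDl Hip) !(ipBr Hip) !(ipDr Hip).
by rewrite (ipC Hip w2) -(rs_Hsym HP); lra.
Qed.

(** The scalar spectral measure of [P B u] gives no mass to the complement of [B], and [B] lies
    within h of c. *)
Lemma energy_concentrated B c h u : measurable B ->
  B `<=` [set x : R | c - h <= x <= c + h] ->
  `|ip (P B u) (H (P B u)) - c * ip (P B u) (P B u)| <= h * ip (P B u) (P B u).
Proof.
move=> mB sB; have [nu [e int ->]] := rs_measure HP (P B u).
apply: Rintegral_concentrated sB _ _ int => //; first by rewrite e// proj_id.
rewrite e; last exact: measurableC.
rewrite (rs_PI HP)//; last exact: measurableC.
by rewrite setICl (rs_P0 HP) (ip0r Hip).
Qed.

(** This replaces the functional calculus. Write u as [P B u] plus the rest: [P B H] annihilates the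
    rest by [proj_commute], and the compression of H - c to the range of [P B] has numerical radius
    at most h by [energy_concentrated], hence norm at most h. *)
Lemma proj_almost_eigen B c h u : measurable B -> 0 < h ->
  B `<=` [set x : R | c - h <= x <= c + h] ->
  N (P B (H u - c *: u)) <= h * N (P B u).
Proof.
move=> mB h0 sB.
pose A w := P B (H (P B w) - c *: P B w).
have HB v w : H (v - w) = H v - H w.
  by rewrite (rs_HD HP) -scaleN1r (rs_HZ HP) scaleN1r.
have e : P B (H u - c *: u) = P B (H (u - P B u)) + A (P B u).
  rewrite /A proj_id// -(rs_PD HP)// HB addrA subrK.
  by rewrite !projB// !(rs_PZ HP)// proj_id.
rewrite e; apply: le_trans (snD HN _ _) _.
have -> : N (P B (H (u - P B u))) = 0.
  apply/eqP; rewrite -sqrf_eq0 ipn_proj// (rs_Psym HP)//.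
  by rewrite proj_commute.
rewrite add0r.
apply: (numerical_radius_bound Hip) => //.
- move=> v w; rewrite /A (rs_PD HP v w mB) (rs_HD HP) scalerDr opprD addrACA
    [LHS](rs_PD HP)//.
- move=> a v; rewrite /A (rs_PZ HP a v mB) (rs_HZ HP) -[RHS](rs_PZ HP)//.
  by rewrite scalerBr !scalerA [c * a]mulrC.
- move=> v w; rewrite /A [LHS](rs_Psym HP)// -[RHS](rs_Psym HP)//.
  by rewrite (ipBl Hip) (ipBr Hip) (rs_Hsym HP) (ipZl Hip) (ipZr Hip).
- move=> v; rewrite /A (rs_Psym HP)// (ipBr Hip) (ipZr Hip).
  apply: le_trans (energy_concentrated _ mB sB) _.
  rewrite ler_pM2l// -!(ipn_sq Hip) ler_pXn2r ?nnegrE ?ipn_ge0//.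
  exact: proj_le.
Qed.

End Resolution.

(** * Transfer estimates and discriminants *)

Section Recurrence.
Context {R : realType}.

(** The equation at site n + 1, so that a block begins with its two free values [phi 0] and [phi 1].
    [V] is the scalar line for solutions and the Hilbert space for the projected basis. *)
Definition residual (V : lmodType R) (a v : nat -> R) (E : R) (phi : nat -> V) n : V :=
  a n.+1 *: phi n.+2 + a n *: phi n + (v n.+1 - E) *: phi n.+1.

Fixpoint solution_pair (a v : nat -> R) (E x y : R) n : R * R :=
  if n is n'.+1 then
    let: (s, t) := solution_pair a v E x y n' in
    (t, - (a n' * s + (v n'.+1 - E) * t) / a n'.+1)
  else (x, y).

Definition solution a v E x y n := (solution_pair a v E x y n).1.

Lemma solution_pairE a v E x y n :
  solution_pair a v E x y n = (solution a v E x y n, solution a v E x y n.+1).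
Proof.
by rewrite /solution /=; case: (solution_pair a v E x y n).
Qed.

Lemma solutionSS a v E x y n : a n.+1 != 0 ->
  a n.+1 * solution a v E x y n.+2 + a n * solution a v E x y n
    + (v n.+1 - E) * solution a v E x y n.+1 = 0.
Proof.
move=> an.
have -> : solution a v E x y n.+2 =
    - (a n * solution a v E x y n + (v n.+1 - E) * solution a v E x y n.+1)
      / a n.+1.
  by rewrite {1}/solution /= -/(solution_pair a v E x y n) solution_pairE.
by field.
Qed.

Section Window.
Context {V : lmodType R} (N : V -> R) (HN : seminorm N).
Variables (q : nat) (K X E : R).

(* X bounds the transfer matrices over the window: only the product of the a_i, not
   each a_i separately, is bounded below, at the exponential rate of the hypothesis. *)
Definition window_ok (a v : nat -> R) :=
  [/\ 1 <= K, forall n, (n <= q)%N -> 0 < a n <= K,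
      forall n, (n < q)%N -> `|v n.+1 - E| <= K
    & (2 * K ^+ 2) ^+ q <= X * \prod_(i < q) a i.+1].

(** Dividing by one [a n] at a time would need a lower bound on each. Instead the partial product of
    the weights is carried along with the norms, and the division takes place once, by the full
    product over the window. *)
Lemma gronwall a v (phi : nat -> V) (rho : R) : window_ok a v -> 0 <= rho ->
  (forall n, (n < q)%N -> N (residual a v E phi n) <= rho) ->
  forall n, (n <= q)%N ->
    N (phi n) + N (phi n.+1) <= X * (N (phi 0%N) + N (phi 1%N) + q%:R * rho).
Proof.
move=> [K1 ha hv hX] rho0 hres.
pose Y n := N (phi n) + N (phi n.+1).
have Y0 n : 0 <= Y n by rewrite addr_ge0 ?(sn_ge0 HN).
have step n : (n < q)%N -> a n.+1 * Y n.+1 <= 2 * K * Y n + rho.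
  move=> nq; have /andP[a0 aK] := ha n (ltnW nq).
  have /andP[b0 bK] := ha n.+1 nq.
  have -> : a n.+1 * Y n.+1 = a n.+1 * N (phi n.+1) + N (a n.+1 *: phi n.+2).
    by rewrite (snZ HN) gtr0_norm// mulrDr.
  have -> : a n.+1 *: phi n.+2 = residual a v E phi n
      - (a n *: phi n + (v n.+1 - E) *: phi n.+1).
    by rewrite /residual -[a n.+1 *: _ + _ + _]addrA addrK.
  have h1 := snB HN (residual a v E phi n)
     (a n *: phi n + (v n.+1 - E) *: phi n.+1).
  have h2 := snD HN (a n *: phi n) ((v n.+1 - E) *: phi n.+1).
  rewrite !(snZ HN) (gtr0_norm a0) in h2.
  have h3 : a n * N (phi n) <= K * N (phi n) by rewrite ler_wpM2r ?(sn_ge0 HN).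
  have h4 : a n.+1 * N (phi n.+1) <= K * N (phi n.+1).
    by rewrite ler_wpM2r ?(sn_ge0 HN).
  have h5 : `|v n.+1 - E| * N (phi n.+1) <= K * N (phi n.+1).
    by rewrite ler_wpM2r ?(sn_ge0 HN)// hv.
  have h6 := hres n nq.
  have h7 : 0 <= K * N (phi n) by rewrite mulr_ge0 ?(sn_ge0 HN)//; lra.
  by rewrite /Y mulrDr; lra.
have K2 : 1 <= 2 * K by lra.
have K2n n : 1 <= (2 * K) ^+ n by rewrite exprn_ege1.
have acc n : (n <= q)%N ->
    (\prod_(i < n) a i.+1) * Y n <= (2 * K) ^+ n * (Y 0%N + n%:R * rho).
  elim: n => [|n IH] nq; first by rewrite big_ord0 mul1r expr0 mul0r addr0 mul1r.
  rewrite big_ord_recr/= -mulrA.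
  have P0 : 0 <= \prod_(i < n) a i.+1.
    by apply: prodr_ge0 => i _; have /andP[/ltW] := ha i.+1 (leq_trans (ltn_ord i) (ltnW nq)).
  apply: le_trans (ler_wpM2l P0 (step n nq)) _.
  rewrite mulrDr mulrCA.
  have h1 : 2 * K * (\prod_(i < n) a i.+1 * Y n) <=
      2 * K * ((2 * K) ^+ n * (Y 0%N + n%:R * rho)).
    by rewrite ler_wpM2l ?IH ?(ltnW nq)//; lra.
  have h2 : \prod_(i < n) a i.+1 <= K ^+ n.
    rewrite -[X in _ <= _ ^+ X]card_ord -prodr_const; apply: ler_prod => i _.
    by have /andP[/ltW-> ->] := ha i.+1 (leq_trans (ltn_ord i) (ltnW nq)).
  have h3 : \prod_(i < n) a i.+1 * rho <= (2 * K) ^+ n.+1 * rho.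
    rewrite ler_wpM2r// (le_trans h2)// exprS.
    have : K ^+ n <= (2 * K) ^+ n by apply: ler_expr_base; lra.
    by have : (2 * K) ^+ n <= 2 * K * (2 * K) ^+ n; [by apply: ler_peMl; have := K2n n; lra|lra].
  apply: (@le_trans _ _ (2 * K * ((2 * K) ^+ n * (Y 0%N + n%:R * rho)) +
      (2 * K) ^+ n.+1 * rho)); first by apply: lerD.
  by rewrite le_eqVlt -natr1 exprS; apply/orP; left; apply/eqP; ring.
move=> n nq; rewrite -/(Y n) -/(Y 0%N).
have Pq0 : 0 < \prod_(i < q) a i.+1.
  by apply: prodr_gt0 => i _; have /andP[] := ha i.+1 (ltn_ord i).
rewrite -(ler_pM2l Pq0).
have S0 : 0 <= Y 0%N + q%:R * rho by rewrite addr_ge0// mulr_ge0.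
apply: (@le_trans _ _ ((2 * K ^+ 2) ^+ q * (Y 0%N + q%:R * rho))); last first.
  by have := ler_wpM2r S0 hX; lra.
(* The missing factors of the product are each at most K. This completion is why [window_ok]
   compares the product with powers of 2 K^2 and not of 2 K. *)
have -> : \prod_(i < q) a i.+1 =
    (\prod_(i < n) a i.+1) * \prod_(n <= i < q) a i.+1.
  by rewrite -!(big_mkord xpredT (fun i => a i.+1)) -big_cat_nat.
have Q0 : 0 <= \prod_(n <= i < q) a i.+1.
  rewrite big_seq; apply: prodr_ge0 => i; rewrite mem_index_iota => /andP[_ iq].
  by have /andP[/ltW] := ha i.+1 iq.
have QK : \prod_(n <= i < q) a i.+1 <= K ^+ (q - n).
  rewrite -prodr_const_nat big_seq [X in _ <= X]big_seq; apply: ler_prod => i.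
  rewrite mem_index_iota => /andP[_ iq].
  by have /andP[/ltW-> ->] := ha i.+1 iq.
rewrite mulrAC; apply: le_trans (ler_wpM2r Q0 (acc n nq)) _.
have A0 : 0 <= (2 * K) ^+ n * (Y 0%N + n%:R * rho).
  apply: mulr_ge0; first by apply: exprn_ge0; lra.
  by rewrite addr_ge0// mulr_ge0.
apply: le_trans (ler_wpM2l A0 QK) _.
rewrite mulrAC; apply: ler_pM.
- by apply: mulr_ge0; apply: exprn_ge0; lra.
- by rewrite addr_ge0// mulr_ge0.
- have -> : (2 * K ^+ 2) ^+ q = (2 * K) ^+ n * (2 * K) ^+ (q - n) * K ^+ q.
    by rewrite -exprD subnKC// -exprMn; congr (_ ^+ _); ring.
  rewrite -mulrA ler_wpM2l//; first by have := K2n n; lra.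
  have h1 : K ^+ (q - n) <= (2 * K) ^+ (q - n) by apply: ler_expr_base; lra.
  have h2 : 1 <= K ^+ q by rewrite exprn_ege1.
  have h3 : (2 * K) ^+ (q - n) <= (2 * K) ^+ (q - n) * K ^+ q.
    by rewrite ler_peMr//; have := K2n (q - n)%N; lra.
  by lra.
- by rewrite lerD2l ler_wpM2r// ler_nat.
Qed.

Lemma window_X1 a v : window_ok a v -> 1 <= X.
Proof.
move=> [K1 ha hv hX].
have Pq0 : 0 < \prod_(i < q) a i.+1.
  by apply: prodr_gt0 => i _; have /andP[] := ha i.+1 (ltn_ord i).
have : \prod_(i < q) a i.+1 <= (2 * K ^+ 2) ^+ q.
  rewrite -[X in _ <= _ ^+ X]card_ord -prodr_const; apply: ler_prod => i _.
  have /andP[/ltW-> h] := ha i.+1 (ltn_ord i); apply: le_trans h _.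
  have : K <= K ^+ 2 by rewrite expr2 ler_peMl//; lra.
  by lra.
move=> h; rewrite -(ler_pM2r Pq0) mul1r; exact: le_trans h hX.
Qed.

(** The other factors of the product are at most (2 K^2)^q together, so a single weight cannot fall
    below 1/X without violating the product bound. *)
Lemma window_inv a v n : (n < q)%N -> window_ok a v -> (a n.+1)^-1 <= X.
Proof.
move=> nq [K1 ha hv hX].
have an0 : 0 < a n.+1 by have /andP[] := ha n.+1 nq.
rewrite -(ler_pM2r an0) mulVf ?gt_eqF//.
rewrite (bigD1 (Ordinal nq))//= in hX.
set p := \prod_(i < q | _) _ in hX.
have p0 : 0 < p.
  by apply: prodr_gt0 => i _; have /andP[] := ha i.+1 (ltn_ord i).
have KK : K <= K ^+ 2 by rewrite expr2 ler_peMl//; lra.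
have : p <= (2 * K ^+ 2) ^+ q.
  rewrite -[X in _ <= _ ^+ X]card_ord -prodr_const (bigD1 (Ordinal nq))//=.
  apply: (@le_trans _ _ (\prod_(i < q | i != Ordinal nq) (2 * K ^+ 2))).
    apply: ler_prod => i _.
    have /andP[/ltW-> h] := ha i.+1 (ltn_ord i); apply: le_trans h _; lra.
  by apply: ler_peMl; [apply: prodr_ge0 => i _; lra|lra].
by move=> h; rewrite -(ler_pM2r p0); lra.
Qed.

End Window.
End Recurrence.

Section Combination.
Context {R : realType} {V : lmodType R}.
Variables (u f0 f1 c0 c1 : V).

(** Coordinates over the five vectors: an identity in the module becomes five scalar identities,
    each closed by [ring]. *)
Let L a b c d e : V := a *: u + b *: f0 + c *: f1 + d *: c0 + e *: c1.

Let LD a b c d e a' b' c' d' e' :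
  L a b c d e + L a' b' c' d' e' = L (a + a') (b + b') (c + c') (d + d') (e + e').
Proof.
by rewrite /L !scalerDl; do 3![rewrite addrACA; congr (_ + _)]; rewrite addrACA.
Qed.

Let LZ k a b c d e : k *: L a b c d e = L (k * a) (k * b) (k * c) (k * d) (k * e).
Proof. by rewrite /L !scalerDr !scalerA. Qed.

Let LN a b c d e : - L a b c d e = L (- a) (- b) (- c) (- d) (- e).
Proof. by rewrite -scaleN1r LZ !mulN1r. Qed.

Let L1 : u = L 1 0 0 0 0.
Proof. by rewrite /L scale1r !scale0r !addr0. Qed.
Let L2 : f0 = L 0 1 0 0 0.
Proof. by rewrite /L scale1r !scale0r !addr0 add0r. Qed.
Let L3 : f1 = L 0 0 1 0 0.
Proof. by rewrite /L scale1r !scale0r !addr0 add0r. Qed.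
Let L4 : c0 = L 0 0 0 1 0.
Proof. by rewrite /L scale1r !scale0r !addr0 add0r. Qed.
Let L5 : c1 = L 0 0 0 0 1.
Proof. by rewrite /L scale1r !scale0r !addr0 add0r. Qed.

(** With M the matrix of rows (p, s) and (p', s'), this is the first row of M f + c - tr(M) f = -
    adj(M) (f - M c) + (1 - det M) c, which is Cayley-Hamilton in the form adj(M) = tr(M) - M. The
    term u - M f is the error of replacing M f by u. *)
Lemma combination_fst (p s p' s' : R) :
  u + c0 - (p + s') *: f0 =
    u - (p *: f0 + s *: f1) + ((- s') *: (f0 - (p *: c0 + s *: c1))
      + s *: (f1 - (p' *: c0 + s' *: c1))) + (1 - (p * s' - p' * s)) *: c0.
Proof.
rewrite L1 L2 L3 L4 L5 !(LZ, LD, LN).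
by congr L; ring.
Qed.

Lemma combination_snd (p s p' s' : R) :
  u + c1 - (p + s') *: f1 =
    u - (p' *: f0 + s' *: f1) + (p' *: (f0 - (p *: c0 + s *: c1))
      + (- p) *: (f1 - (p' *: c0 + s' *: c1))) + (1 - (p * s' - p' * s)) *: c1.
Proof.
rewrite L1 L2 L3 L4 L5 !(LZ, LD, LN).
by congr L; ring.
Qed.

End Combination.

Section Fundamental.
Context {R : realType} {V : lmodType R} (N : V -> R) (HN : seminorm N).
Variables (q : nat) (K X E : R) (a v : nat -> R).
Hypothesis win : window_ok q K X E a v.

Let p := solution a v E 1 0.
Let s := solution a v E 0 1.

Definition discriminant := solution a v E 1 0 q + solution a v E 0 1 q.+1.

Lemma window_neq0 n : (n <= q)%N -> a n != 0.
Proof. by move=> nq; have [_ ha _ _] := win; have /andP[] := ha n nq; lra. Qed.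

Lemma solution_bound x y n : (n <= q)%N ->
  `|solution a v E x y n| + `|solution a v E x y n.+1| <= X * (`|x| + `|y|).
Proof.
move=> nq.
have := @gronwall R R^o _ (absr_seminorm R) q K X E a v (solution a v E x y) 0 win.
move=> /(_ (lexx _)) h; have := h _ n nq; rewrite mulr0 addr0; apply => k kq.
rewrite /residual /GRing.scale/=.
by rewrite (@solutionSS _ a v E x y k (window_neq0 kq)) normr0.
Qed.

(** By the recurrence, [a n] times the left side is constant in n. At n = q the left side is the
    determinant of the monodromy matrix, which differs from 1 as far as [a q] differs from [a 0]. *)
Lemma wronskian n : (n <= q)%N -> p n * s n.+1 - p n.+1 * s n = a 0%N / a n.
Proof.
elim: n => [|n IH] nq.
  by rewrite /p /s /solution/= mulr1 mul0r subr0 divff// window_neq0.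
have h1 := @solutionSS _ a v E 1 0 n (window_neq0 nq).
have h2 := @solutionSS _ a v E 0 1 n (window_neq0 nq).
have an := window_neq0 nq; have an' := window_neq0 (ltnW nq).
apply: (mulfI an); rewrite [RHS]mulrCA divff// mulr1.
have <- : a n * (p n * s n.+1 - p n.+1 * s n) = a 0%N.
  by rewrite IH ?(ltnW nq)// mulrCA divff// mulr1.
rewrite -/p -/s in h1 h2.
have -> : a n.+1 * (p n.+1 * s n.+2 - p n.+2 * s n.+1) =
    p n.+1 * (a n.+1 * s n.+2) - (a n.+1 * p n.+2) * s n.+1 by ring.
have -> : a n.+1 * s n.+2 = - (a n * s n + (v n.+1 - E) * s n.+1) by lra.
have -> : a n.+1 * p n.+2 = - (a n * p n + (v n.+1 - E) * p n.+1) by lra.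
by ring.
Qed.

(** The difference from the combination of fundamental solutions has the same residual as [phi] and
    zero initial data, so [gronwall] leaves only the source term. *)
Lemma fundamental_expansion (phi : nat -> V) rho n : 0 <= rho ->
  (forall k, (k < q)%N -> N (residual a v E phi k) <= rho) -> (n <= q)%N ->
  N (phi n - (p n *: phi 0%N + s n *: phi 1%N)) +
    N (phi n.+1 - (p n.+1 *: phi 0%N + s n.+1 *: phi 1%N)) <= X * q%:R * rho.
Proof.
move=> rho0 hres nq.
pose err k := phi k - (p k *: phi 0%N + s k *: phi 1%N).
rewrite -/(err n) -/(err n.+1).
have e0 : err 0%N = 0 by rewrite /err /p /s /solution/= scale1r scale0r addr0 subrr.
have e1 : err 1%N = 0 by rewrite /err /p /s /solution/= scale1r scale0r add0r subrr.
have := gronwall HN (phi := err) win rho0.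
rewrite e0 e1 !(sn0 HN) !add0r mulrA => h; apply: h => // k kq.
suff -> : residual a v E err k = residual a v E phi k by exact: hres.
have h1 := @solutionSS _ a v E 1 0 k (window_neq0 kq).
have h2 := @solutionSS _ a v E 0 1 k (window_neq0 kq).
rewrite -/p -/s in h1 h2.
have addB3 (x1 x2 x3 y1 y2 y3 : V) :
    (x1 - y1) + (x2 - y2) + (x3 - y3) = (x1 + x2 + x3) - (y1 + y2 + y3).
  by rewrite (addrACA x1) (addrACA (x1 + x2)) -!opprD.
rewrite /residual /err !scalerBr addB3 -[RHS]subr0; congr (_ - _).
rewrite !scalerDr !scalerA (addrACA (_ *: phi 0%N)) (addrACA (_ *: phi 0%N + _)) -!scalerDl.
by rewrite h1 h2 !scale0r addr0.
Qed.

(* Cayley-Hamilton for the monodromy matrix, whose determinant is a_0 / a_q. *)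
Lemma discriminant_relation (phi psi : nat -> V) rho d : (0 < q)%N ->
  0 <= rho -> `|a 0%N - a q| <= d ->
  (forall k, (k < q)%N -> N (residual a v E phi k) <= rho) ->
  (forall k, (k < q)%N -> N (residual a v E psi k) <= rho) ->
  psi q = phi 0%N -> psi q.+1 = phi 1%N ->
  N (phi q + psi 0%N - discriminant *: phi 0%N)
      <= 2 * X ^+ 2 * q%:R * rho + d * X * N (psi 0%N) /\
  N (phi q.+1 + psi 1%N - discriminant *: phi 1%N)
      <= 2 * X ^+ 2 * q%:R * rho + d * X * N (psi 1%N).
Proof.
move=> q0 rho0 hd hphi hpsi e0 e1.
have X1 := window_X1 win.
have aqX : (a q)^-1 <= X by rewrite -(prednK q0); apply: window_inv win; rewrite prednK.
have [_ ha _ _] := win; have /andP[aq0 _] := ha q (leqnn q).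
set err1 := fun k => phi k - (p k *: phi 0%N + s k *: phi 1%N).
set err2 := fun k => psi k - (p k *: psi 0%N + s k *: psi 1%N).
have h1 : N (err1 q) + N (err1 q.+1) <= X * q%:R * rho.
  exact: (fundamental_expansion rho0 hphi (leqnn q)).
have h2 : N (err2 q) + N (err2 q.+1) <= X * q%:R * rho.
  exact: (fundamental_expansion rho0 hpsi (leqnn q)).
have hp := solution_bound 1 0 (leqnn q).
have hs := solution_bound 0 1 (leqnn q).
rewrite normr0 normr1 ?addr0 ?add0r mulr1 -/p -/s in hp hs.
have hw := wronskian (leqnn q); set w := a 0%N / a q in hw.
have hw1 : `|w - 1| <= d * X.
  have -> : w - 1 = (a 0%N - a q) * (a q)^-1 by rewrite /w; field; rewrite gt_eqF.
  rewrite normrM; apply: ler_pM => //.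
  by rewrite ger0_norm// invr_ge0 ltW.
have qr0 : 0 <= X * q%:R * rho by rewrite !mulr_ge0//; lra.
(* The two entries in a row of the adjugate are consecutive values of one fundamental solution, so
   one use of [solution_bound] controls both. *)
have bnd (x y : R) u1 u2 u3 u4 : `|x| + `|y| <= X ->
    N u1 <= X * q%:R * rho -> N u2 + N u3 <= X * q%:R * rho ->
    N (u1 + (y *: u2 + x *: u3) + (1 - w) *: u4) <=
      2 * X ^+ 2 * q%:R * rho + d * X * N u4.
  move=> xy b1 b23.
  apply: le_trans (snD HN _ _) _; apply: lerD; last first.
    by rewrite (snZ HN) distrC ler_wpM2r// (sn_ge0 HN).
  apply: le_trans (snD HN _ _) _.
  have b2 := snD HN (y *: u2) (x *: u3); rewrite !(snZ HN) in b2.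
  have b3 : `|y| * N u2 <= X * N u2.
    by rewrite ler_wpM2r ?(sn_ge0 HN)//; have := normr_ge0 x; lra.
  have b4 : `|x| * N u3 <= X * N u3.
    by rewrite ler_wpM2r ?(sn_ge0 HN)//; have := normr_ge0 y; lra.
  have b5 : X * (N u2 + N u3) <= X * (X * q%:R * rho) by rewrite ler_wpM2l//; lra.
  have b6 : X * q%:R * rho <= X * (X * q%:R * rho) by rewrite ler_peMl.
  by lra.
have ge0 k1 : 0 <= N k1 by exact: sn_ge0.
split.
- have -> : phi q + psi 0%N - discriminant *: phi 0%N =
    err1 q + ((- s q.+1) *: err2 q + s q *: err2 q.+1) + (1 - w) *: psi 0%N.
    by rewrite -hw /err1 /err2 e0 e1; exact: combination_fst.
  apply: bnd; rewrite ?normrN//; have := ge0 (err1 q.+1); lra.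
- have -> : phi q.+1 + psi 1%N - discriminant *: phi 1%N =
    err1 q.+1 + (p q.+1 *: err2 q + (- p q) *: err2 q.+1) + (1 - w) *: psi 1%N.
    by rewrite -hw /err1 /err2 e0 e1; exact: combination_snd.
  apply: bnd; rewrite ?normrN//; have := ge0 (err1 q); lra.
Qed.

End Fundamental.

Section IntegerIndices.
Variables (b : int) (q : nat).

Lemma addzS : b + q.+1%:Z = b + q%:Z + 1.
Proof. by lia. Qed.

Lemma subz_addS : b - q%:Z + q.+1%:Z = b + 1.
Proof. by lia. Qed.

Lemma ltz_block j : (j < q)%N -> b - q%:Z < b + j.+1%:Z <= b + q%:Z.
Proof. by lia. Qed.

Lemma ltz_block_prev j : (j < q)%N -> b - q%:Z < b - q%:Z + j.+1%:Z <= b + q%:Z.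
Proof. by lia. Qed.

End IntegerIndices.

Section Blocks.
Context {R : realType} {V : lmodType R} (N : V -> R) (HN : seminorm N).
Variables (q : nat) (K X E d : R).

(** [gronwall] for the block's own coefficients bounds [phi] on the whole block by its initial
    values; exchanging the coefficients then costs d times that bound. *)
Lemma perturbed_residual (a v a' v' : nat -> R) (phi : nat -> V) rho n :
  window_ok q K X E a' v' -> 0 <= rho -> (n < q)%N ->
  (forall k, (k <= q)%N -> `|a k - a' k| <= d) ->
  (forall k, (k <= q)%N -> `|v k - v' k| <= d) ->
  (forall k, (k < q)%N -> N (residual a' v' E phi k) <= rho) ->
  N (residual a v E phi n) <=
    rho + 2 * d * X * (N (phi 0%N) + N (phi 1%N) + q%:R * rho).
Proof.
move=> win rho0 nq da dv hres.
have -> : residual a v E phi n = residual a' v' E phi n +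
    ((a n.+1 - a' n.+1) *: phi n.+2 + (a n - a' n) *: phi n
      + (v n.+1 - v' n.+1) *: phi n.+1).
  rewrite /residual (addrACA (_ *: phi n.+2 + _)) (addrACA (_ *: phi n.+2)).
  by rewrite -!scalerDl; congr (_ *: _ + _ *: _ + _ *: _); ring.
apply: le_trans (snD HN _ _) _; apply: lerD; first exact: hres.
set Y := _ + _ + _ * rho.
have g1 := gronwall HN win rho0 hres (ltnW nq).
have g2 := gronwall HN win rho0 hres nq.
rewrite -/Y in g1 g2.
have d0 : 0 <= d by exact: le_trans (normr_ge0 _) (da 0%N (leq0n q)).
have h1 := snD HN ((a n.+1 - a' n.+1) *: phi n.+2) ((a n - a' n) *: phi n).
have h2 := snD HN ((a n.+1 - a' n.+1) *: phi n.+2 + (a n - a' n) *: phi n)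
  ((v n.+1 - v' n.+1) *: phi n.+1).
rewrite !(snZ HN) in h1 h2.
have k1 : `|a n.+1 - a' n.+1| * N (phi n.+2) <= d * N (phi n.+2).
  by rewrite ler_wpM2r ?(sn_ge0 HN)// da.
have k2 : `|a n - a' n| * N (phi n) <= d * N (phi n).
  by rewrite ler_wpM2r ?(sn_ge0 HN)// da// ltnW.
have k3 : `|v n.+1 - v' n.+1| * N (phi n.+1) <= d * N (phi n.+1).
  by rewrite ler_wpM2r ?(sn_ge0 HN)// dv.
have k4 : d * (N (phi n) + N (phi n.+1)) <= d * (X * Y) by rewrite ler_wpM2l.
have k5 : d * (N (phi n.+1) + N (phi n.+2)) <= d * (X * Y) by rewrite ler_wpM2l.
have k6 : 0 <= d * N (phi n.+1) by rewrite mulr_ge0 ?(sn_ge0 HN).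
by lra.
Qed.

Variables (a v : int -> R).

Definition shifted (T : Type) (f : int -> T) (b : int) : nat -> T :=
  fun n => f (b + n%:Z).

Definition residualz (phi : int -> V) (m : int) : V :=
  a m *: phi (m + 1) + a (m - 1) *: phi (m - 1) + (v m - E) *: phi m.

Lemma residual_shifted phi b n :
  residual (shifted a b) (shifted v b) E (shifted phi b) n =
  residualz phi (b + n.+1%:Z).
Proof.
rewrite /residual /residualz /shifted.
by rewrite -addzS (addzS b n) addrK.
Qed.

Let D := discriminant q E (shifted a 0) (shifted v 0).

Definition block_ok (b : int) := [/\ window_ok q K X E (shifted a b) (shifted v b),
  forall k, (k <= q)%N -> `|a k%:Z - a (b + k%:Z)| <= d &
  forall k, (k <= q)%N -> `|v k%:Z - v (b + k%:Z)| <= d].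

(** Both the block after b and the block before it nearly solve the recurrence with the coefficients
    of the block at 0. Hence one and the same trace D governs every b, and [discriminant_relation]
    applies to the two blocks. The block at [q] enters only to compare [a 0] with [a q]. *)
Lemma block_relation (phi : int -> V) (b : int) (rho : R) :
  (0 < q)%N -> 0 <= rho -> 2 * d * X * q%:R <= 1 ->
  block_ok 0 -> block_ok b -> block_ok (b - q%:Z) -> block_ok q%:Z ->
  (forall m, b - q%:Z < m <= b + q%:Z -> N (residualz phi m) <= rho) ->
  let bound := 4 * X ^+ 2 * q%:R * rho + 5 * X ^+ 3 * q%:R * d *
      (N (phi b) + N (phi (b + 1)) + (N (phi (b - q%:Z)) + N (phi (b - q%:Z + 1)))) in
  N (phi (b + q%:Z) + phi (b - q%:Z) - D *: phi b) <= bound /\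
  N (phi (b + q%:Z + 1) + phi (b - q%:Z + 1) - D *: phi (b + 1)) <= bound.
Proof.
move=> q0 rho0 dXq [w0 _ _] [wb dab dvb] [wc dac dvc] [_ daq _] hres bound.
have d0 : 0 <= d by exact: le_trans (normr_ge0 _) (dab 0%N (leq0n q)).
have X1 := window_X1 w0.
set Y := N (phi b) + N (phi (b + 1)) in bound *.
set Z := N (phi (b - q%:Z)) + N (phi (b - q%:Z + 1)) in bound *.
have Y0 : 0 <= Y by rewrite addr_ge0 ?(sn_ge0 HN).
have Z0 : 0 <= Z by rewrite addr_ge0 ?(sn_ge0 HN).
(* The second [rho] absorbs the term 2 d X q rho of [perturbed_residual], which is at most rho by
   hypothesis. *)
pose rho' := 2 * rho + 2 * d * X * (Y + Z).
have dX0 : 0 <= d * X by rewrite mulr_ge0//; lra.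
have h1 : 2 * d * X * (q%:R * rho) <= rho.
  by rewrite mulrA -[leRHS]mul1r ler_wpM2r.
have h2 : 0 <= d * X * Y by rewrite mulr_ge0.
have h3 : 0 <= d * X * Z by rewrite mulr_ge0.
have rho'0 : 0 <= rho' by rewrite /rho'; lra.
have sh0 T (f : int -> T) k : shifted f 0 k = f k%:Z by rewrite /shifted add0r.
have rb k : (k < q)%N ->
    N (residual (shifted a 0) (shifted v 0) E (shifted phi b) k) <= rho'.
  move=> kq; apply: le_trans (perturbed_residual wb rho0 kq _ _ _) _.
  - by move=> j jq; rewrite sh0 dab.
  - by move=> j jq; rewrite sh0 dvb.
  - by move=> j jq; rewrite residual_shifted hres// ltz_block.
  - by rewrite /rho' /shifted addr0 -/Y; lra.
have rc k : (k < q)%N ->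
    N (residual (shifted a 0) (shifted v 0) E (shifted phi (b - q%:Z)) k) <= rho'.
  move=> kq; apply: le_trans (perturbed_residual wc rho0 kq _ _ _) _.
  - by move=> j jq; rewrite sh0 dac.
  - by move=> j jq; rewrite sh0 dvc.
  - by move=> j jq; rewrite residual_shifted hres// ltz_block_prev.
  - by rewrite /rho' /shifted addr0 -/Z; lra.
have e0 : shifted phi (b - q%:Z) q = shifted phi b 0 by rewrite /shifted subrK addr0.
have e1 : shifted phi (b - q%:Z) q.+1 = shifted phi b 1 by rewrite /shifted subz_addS.
have daq' : `|shifted a 0 0%N - shifted a 0 q| <= d.
  by rewrite !sh0; have := daq 0%N (leq0n q); rewrite addr0.
have [] := discriminant_relation HN w0 q0 rho'0 daq' rb rc e0 e1.
rewrite -/D /shifted !addr0.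
rewrite addzS.
have X2 : 1 <= X ^+ 2 by rewrite exprn_ege1.
have q1 : 1 <= q%:R :> R by rewrite ler1n.
(* The constant 5 is 4, from 2 X^2 q times the part 2 d X (Y + Z) of [rho'], plus 1 for the
   determinant defect d X. *)
have fin n : N n <= Z -> forall z, z <= 2 * X ^+ 2 * q%:R * rho' + d * X * N n -> z <= bound.
  move=> hn z; move/le_trans; apply; rewrite /bound /rho' -/Y -/Z.
  have k1 : d * X * N n <= d * X * Z by rewrite ler_wpM2l.
  have k2 : d * X * Z <= X ^+ 2 * q%:R * (d * X * (Y + Z)).
    apply: (@le_trans _ _ (1 * (d * X * (Y + Z)))); first by rewrite mul1r ler_wpM2l ?lerDr.
    apply: ler_wpM2r; first by rewrite mulrDr addr_ge0.
    by rewrite mulr_ege1.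
  have -> : X ^+ 3 = X ^+ 2 * X by rewrite exprSr.
  by lra.
move=> r1 r2; split; [apply: fin r1|apply: fin r2];
 rewrite /Z ?lerDl ?lerDr ?(sn_ge0 HN)//.
Qed.

End Blocks.

(** * Chebyshev sums *)

Section Chebyshev.
Context {R : realType}.

(* cheb k (2 cos t) = sin ((k + 1) t) / sin t. *)
Fixpoint cheb (k : nat) (y : R) : R :=
  match k with
  | 0%N => 1
  | m.+1 => match m with 0%N => y | p.+1 => y * cheb m y - cheb p y end
  end.

Lemma chebSS k y : cheb k.+2 y = y * cheb k.+1 y - cheb k y.
Proof. by []. Qed.

Lemma cheb_opp k y : cheb k (- y) = (-1) ^+ k * cheb k y.
Proof.
have [//] : cheb k (- y) = (-1) ^+ k * cheb k y /\
    cheb k.+1 (- y) = (-1) ^+ k.+1 * cheb k.+1 y.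
elim: k => [|k [IH1 IH2]]; first by rewrite /=; split; ring.
by split=> //; rewrite !chebSS IH1 IH2 !exprS; ring.
Qed.

Lemma cheb_ge2 k y : 2 <= y -> k.+1%:R <= cheb k y.
Proof.
move=> y2.
have [//] : k.+1%:R <= cheb k y /\ cheb k y + 1 <= cheb k.+1 y.
elim: k => [|k [IH1 IH2]]; first by rewrite /=; split; lra.
have h1 : k.+2%:R <= cheb k.+1 y.
  by rewrite -(natr1 k.+1); lra.
split=> //; rewrite chebSS.
have : 0 <= (y - 2) * cheb k.+1 y.
  by rewrite mulr_ge0 ?subr_ge0//; apply: le_trans h1.
by lra.
Qed.

(** At y = 2 the value is j + 1 and every increment is 1. Below 2 each step lowers the increment by
    (2 - y) times the current value, at most eta (k + 1); since eta (k + 1)^2 = 1/2, the increments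
    stay above 1/2. *)
Lemma cheb_near2 k y : 2 - (2 * k.+1%:R ^+ 2)^-1 <= y <= 2 ->
  k.+1%:R / 2 <= cheb k y.
Proof.
set eta := _^-1 => /andP[y1 y2].
have k0 : 0 < k.+1%:R :> R by [].
have eta0 : 0 < eta by rewrite invr_gt0 mulr_gt0// exprn_gt0.
have etak : eta * k.+1%:R * k.+1%:R = 1 / 2 by rewrite /eta; field; rewrite gt_eqF.
have key j : (j <= k)%N -> [/\ 1 - eta * j.+1%:R * k.+1%:R <= cheb j.+1 y - cheb j y,
    cheb j.+1 y - cheb j y <= 1, j.+1%:R / 2 <= cheb j y & cheb j y <= j.+1%:R].
  have etaj i : (i <= k)%N -> eta * i.+1%:R * k.+1%:R <= 1 / 2.
    move=> ik; rewrite -etak ler_wpM2r// ler_wpM2l ?ler_nat//.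
    exact: ltW.
  elim: j => [|j IH] jk.
    have k1 : 1 <= k.+1%:R :> R by rewrite ler1n.
    have : eta <= eta * k.+1%:R by rewrite ler_peMr// ltW.
    by rewrite /= mulr1; split; lra.
  have [h1 h2 h3 h4] := IH (ltnW jk).
  have h5 := etaj j (ltnW jk).
  rewrite chebSS -(natr1 j.+1).
  have j0 : 0 <= j.+1%:R :> R by [].
  have h6 : (2 - y) * cheb j.+1 y <= eta * k.+1%:R.
    apply: ler_pM; rewrite ?subr_ge0//; try lra.
    have : j.+2%:R <= k.+1%:R :> R by rewrite ler_nat.
    by rewrite -(natr1 j.+1); lra.
  have h7 : 0 <= (2 - y) * cheb j.+1 y by apply: mulr_ge0; lra.
  by split; lra.
by have [] := key k (leqnn k).
Qed.

Lemma cheb_large k y : 2 - (2 * k.+1%:R ^+ 2)^-1 <= `|y| ->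
  k.+1%:R / 2 <= `|cheb k y|.
Proof.
move=> hy.
have -> : `|cheb k y| = `|cheb k `|y| |.
  case: (ger0P y) => // _.
  by rewrite cheb_opp normrM normrX normrN1 expr1n mul1r.
apply: le_trans (ler_norm _).
have [h|h] := leP `|y| 2; first by apply: cheb_near2; rewrite hy.
apply: le_trans (cheb_ge2 _ (ltW h)).
by have : 0 <= k.+1%:R :> R by []; lra.
Qed.

End Chebyshev.

Section ChebyshevSum.
Context {R : realType} {V : lmodType R} (N : V -> R) (HN : seminorm N).

(** The vector form of sin((k+1)t) / sin t = e^{ikt} + e^{i(k-2)t} + ... + e^{-ikt}: it equals
    [cheb k D *: y 0] when y_{j+1} + y_{j-1} = D y_j holds exactly. *)
Definition cheb_sum (y : int -> V) (k : nat) : V :=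
  \sum_(j < k.+1) y (k%:Z - 2 * j%:Z).

(** The analogue of [chebSS]: adding the two neighbours of each index of the sum for k + 1 counts
    the indices of the sum for k + 2 once and the inner ones, those of the sum for k, once more. *)
Lemma cheb_sumSS (y : int -> V) k :
  cheb_sum y k.+2 + cheb_sum y k =
  \sum_(j < k.+2) (y (k.+1%:Z - 2 * j%:Z + 1) + y (k.+1%:Z - 2 * j%:Z - 1)).
Proof.
rewrite big_split/= {1}/cheb_sum big_ord_recr/= -addrA; congr (_ + _).
  by apply: eq_bigr => j _; congr y; lia.
rewrite [RHS]big_ord_recr/= addrC /cheb_sum; congr (_ + _).
  by apply: eq_bigr => j _; congr y; lia.
by congr y; lia.
Qed.

Lemma cheb_sum1 (y : int -> V) : cheb_sum y 1 = y (0 + 1) + y (0 - 1).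
Proof.
rewrite /cheb_sum !big_ord_recl big_ord0; congr (_ + _); exact: addr0.
Qed.

Lemma cheb_sum_approx (y : int -> V) (D r eps : R) (k : nat) :
  0 <= eps -> 1 <= r -> `|D| <= r ->
  (forall j : int, `|j| <= k%:Z -> N (y (j + 1) + y (j - 1) - D *: y j) <= eps) ->
  N (cheb_sum y k - cheb k D *: y 0) <= eps * (r + 2) ^+ k.
Proof.
move=> e0 r1 Dr.
pose err m := cheb_sum y m - cheb m D *: y 0.
have E0 : err 0%N = 0.
  by rewrite /err /cheb_sum big_ord1/= scale1r mulr0 subr0 subrr.
have E1 : err 1%N = y (0 + 1) + y (0 - 1) - D *: y 0.
  by rewrite /err cheb_sum1.
move=> hy.
have small m : (m <= k)%N -> N (err m) <= eps * (r + 2) ^+ m /\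
   ((m < k)%N -> N (err m.+1) <= eps * (r + 2) ^+ m.+1).
  elim: m => [|m IH] mk.
    split; first by rewrite E0 (sn0 HN) mulr1.
    move=> k0; rewrite E1; apply: le_trans (hy 0 _) _; first by rewrite normr0.
    by rewrite ler_peMr//; lra.
  have [h1 h2] := IH (ltnW mk); split; first exact: h2.
  move=> mk2; have {}h2 := h2 mk.
  (* The error obeys the Chebyshev recurrence with a source of m + 2 terms, each of size at most
     eps. *)
  have -> : err m.+2 = D *: err m.+1 - err m +
     \sum_(j < m.+2) (y (m.+1%:Z - 2 * j%:Z + 1) + y (m.+1%:Z - 2 * j%:Z - 1)
        - D *: y (m.+1%:Z - 2 * j%:Z)).
    rewrite sumrB -cheb_sumSS -scaler_sumr /err chebSS -/(cheb_sum y m.+1).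
    rewrite scalerBr scalerBl scalerA.
    set A := D *: cheb_sum y m.+1; set B := (_ * _) *: y 0; set C := cheb m D *: y 0.
    rewrite !opprB [RHS]addrC [RHS]addrA (addrA _ A) subrK.
    rewrite (addrAC _ (cheb_sum y m)) -[RHS]addrA (addrC (cheb_sum y m)) subrK.
    by rewrite [RHS]addrAC -[RHS]addrA.
  have h3 : N (\sum_(j < m.+2) (y (m.+1%:Z - 2 * j%:Z + 1)
      + y (m.+1%:Z - 2 * j%:Z - 1) - D *: y (m.+1%:Z - 2 * j%:Z))) <= m.+2%:R * eps.
    apply: le_trans (sn_sum HN _ _ _) _.
    rewrite -[m.+2 in leRHS]card_ord -sumr_const mulr_suml.
    by apply: ler_sum => j _; rewrite mul1r; apply: hy; have := ltn_ord j; lia.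
  have h4 := snB HN (D *: err m.+1) (err m).
  rewrite (snZ HN) in h4.
  have h5 : `|D| * N (err m.+1) <= r * (eps * (r + 2) ^+ m.+1).
    by apply: ler_pM => //; exact: sn_ge0.
  apply: le_trans (snD HN _ _) _.
  (* In the growth factor r + 2, the r pays for [D *: err m.+1]; of the remaining 2, one unit pays
     for [err m] and one for the source. *)
  have h6 : m.+2%:R <= (r + 2) ^+ m.+1.
    apply: (@le_trans _ _ (3 ^+ m.+1)); last by apply: ler_expr_base => //; lra.
    by rewrite -natrX ler_nat ltn_expl.
  have h7 : m.+2%:R * eps <= (r + 2) ^+ m.+1 * eps by rewrite ler_wpM2r.
  have h8 : (r + 2) ^+ m <= (r + 2) ^+ m.+1.
    by apply: ler_weXn2l => //; lra.
  have h9 : eps * (r + 2) ^+ m <= eps * (r + 2) ^+ m.+1 by rewrite ler_wpM2l.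
  rewrite [(r + 2) ^+ m.+2]exprS.
  by lra.
by have [] := small k (leqnn k).
Qed.

(* For |D| > k + 1 the case k = 1 of the Chebyshev sums suffices. *)
Lemma bad_trace_bound (y : int -> V) (D eps : R) (k : nat) :
  0 <= eps -> (0 < k)%N -> 2 - (2 * k.+1%:R ^+ 2)^-1 <= `|D| ->
  (forall j : int, `|j| <= k%:Z -> N (y (j + 1) + y (j - 1) - D *: y j) <= eps) ->
  (k.+1%:R / 2) ^+ 2 * N (y 0) ^+ 2 <=
    2 * N (cheb_sum y 1) ^+ 2 + 2 * N (cheb_sum y k) ^+ 2
    + 4 * (eps * (k + 3)%:R ^+ k) ^+ 2.
Proof.
move=> e0 k0 hD hy.
have k1 : 0 <= k.+1%:R / 2 :> R by rewrite divr_ge0.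
have sq (c : R) m d : k.+1%:R / 2 <= c -> 0 <= d ->
    c * N (y 0) <= N (cheb_sum y m) + d ->
    (k.+1%:R / 2) ^+ 2 * N (y 0) ^+ 2 <= 2 * N (cheb_sum y m) ^+ 2 + 2 * d ^+ 2.
  move=> hc d0 h.
  have N0 := sn_ge0 HN (y 0); have Nm := sn_ge0 HN (cheb_sum y m).
  have h1 : k.+1%:R / 2 * N (y 0) <= N (cheb_sum y m) + d.
    by apply: le_trans h; rewrite ler_wpM2r.
  have h2 : (k.+1%:R / 2 * N (y 0)) ^+ 2 <= (N (cheb_sum y m) + d) ^+ 2.
    by apply: ler_expr_base => //; rewrite mulr_ge0.
  rewrite exprMn in h2; apply: le_trans h2 _.
  have := sqr_ge0 (N (cheb_sum y m) - d); rewrite sqrrB sqrrD.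
  by lra.
have A1 : 0 <= N (cheb_sum y 1) ^+ 2 by exact: sqr_ge0.
have Ak : 0 <= N (cheb_sum y k) ^+ 2 by exact: sqr_ge0.
have p1 : 1 <= (k + 3)%:R ^+ k :> R by rewrite exprn_ege1// ler1n addnS.
have ee : eps <= eps * (k + 3)%:R ^+ k by rewrite ler_peMr.
have [Dk|Dk] := leP `|D| k.+1%:R.
  have k11 : 1 <= k.+1%:R :> R by rewrite ler1n.
  have := cheb_sum_approx e0 k11 Dk hy.
  have -> : k.+1%:R + 2 = (k + 3)%:R :> R by rewrite -natrD addn2 -addn3.
  move=> ha.
  have h1 : `|cheb k D| * N (y 0) <= N (cheb_sum y k) + eps * (k + 3)%:R ^+ k.
    rewrite -(snZ HN).
    have -> : cheb k D *: y 0 = cheb_sum y k - (cheb_sum y k - cheb k D *: y 0).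
      by rewrite opprB addrC subrK.
    by apply: le_trans (snB HN _ _) _; rewrite lerD2l.
  have := sq _ _ _ (cheb_large hD) (le_trans e0 ee) h1.
  by have := sqr_ge0 (eps * (k + 3)%:R ^+ k); lra.
have h1 : `|D| * N (y 0) <= N (cheb_sum y 1) + eps.
  rewrite cheb_sum1.
  rewrite -(snZ HN).
  have -> : D *: y 0 = y (0 + 1) + y (0 - 1) - (y (0 + 1) + y (0 - 1) - D *: y 0).
    by rewrite opprB addrC subrK.
  by apply: le_trans (snB HN _ _) _; rewrite lerD2l hy// normr0.
have h2 : k.+1%:R / 2 <= `|D| by have : 0 <= k.+1%:R :> R by []; lra.
have := sq _ _ _ h2 e0 h1.
have : eps ^+ 2 <= (eps * (k + 3)%:R ^+ k) ^+ 2 by exact: ler_expr_base.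
by have := sqr_ge0 eps; lra.
Qed.

End ChebyshevSum.

(** * Elliptic energies *)

Section Elliptic.
Context {R : realType}.
Variables (D eta : R).

(* Conserved by the recurrence x_{j+1} = D x_j - x_{j-1}, and definite since |D| < 2. *)
Let Q (x y : R) := x ^+ 2 + y ^+ 2 - D * x * y.

Let Q_lower x y : `|D| <= 2 - eta -> eta / 2 * (x ^+ 2 + y ^+ 2) <= Q x y.
Proof.
move=> hD; rewrite /Q.
have h : 2 * `|x * y| <= x ^+ 2 + y ^+ 2.
  by rewrite normrM -(real_normK (num_real x)) -(real_normK (num_real y));
    have := sqr_ge0 (`|x| - `|y|); rewrite sqrrB; lra.
have h1 : D * x * y <= `|D| * `|x * y|.
  by rewrite -normrM mulrA ler_norm.
have h2 : `|D| * `|x * y| <= (2 - eta) * `|x * y| by rewrite ler_wpM2r.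
have e0 : 0 <= 2 - eta by apply: le_trans hD.
have h3 : (2 - eta) * (2 * `|x * y|) <= (2 - eta) * (x ^+ 2 + y ^+ 2).
  by rewrite ler_wpM2l.
by lra.
Qed.

Let Q_upper x y : `|D| <= 2 -> Q x y <= 2 * (x ^+ 2 + y ^+ 2).
Proof.
move=> hD; rewrite /Q.
have h : 2 * `|x * y| <= x ^+ 2 + y ^+ 2.
  by rewrite normrM -(real_normK (num_real x)) -(real_normK (num_real y));
    have := sqr_ge0 (`|x| - `|y|); rewrite sqrrB; lra.
have h1 : - (D * x * y) <= `|D| * `|x * y|.
  by rewrite -normrM mulrA -normrN ler_norm.
have h2 : `|D| * `|x * y| <= 2 * `|x * y| by rewrite ler_wpM2r.
by lra.
Qed.

Let Q_step x y z e S : `|D| <= 2 -> 0 <= e <= 1 -> `|z + y - D * x| <= e * S ->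
  `|x| + `|y| <= S -> Q z x <= Q x y + 3 * e * S ^+ 2.
Proof.
move=> hD /andP[e0 e1] hz hS.
set t := z + y - D * x in hz.
have S0 : 0 <= S by apply: le_trans hS; rewrite addr_ge0.
have -> : Q z x = Q x y + (t ^+ 2 + t * (D * x - 2 * y)).
  by rewrite /Q (_ : z = D * x - y + t); [ring|rewrite /t; ring].
have h1 : t ^+ 2 <= (e * S) ^+ 2.
  by rewrite -(real_normK (num_real t)) ler_expr_base.
have h2 : t * (D * x - 2 * y) <= (e * S) * (2 * S).
  apply: le_trans (ler_norm _) _; rewrite normrM; apply: ler_pM => //.
  apply: le_trans (ler_normB _ _) _; rewrite !normrM.
  have : `|D| * `|x| <= 2 * `|x| by rewrite ler_wpM2r.
  by rewrite [ `|2| ]gtr0_norm//; lra.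
have h3 : (e * S) ^+ 2 <= e * S ^+ 2.
  by rewrite exprMn ler_wpM2r ?sqr_ge0// expr2 ler_piMr.
by lra.
Qed.

(** The sequences x and x' are the values at the first two sites of the successive blocks, coupled
    only through the error S. Their total energy F grows by a factor 1 + kap per step; the condition
    on e J gives kap J <= 1/2, so F at most doubles over the whole range, and definiteness of the
    form returns to the squares at the price 1/eta. *)
Lemma elliptic_recurrence (x x' : nat -> R) (e : R) (J : nat) :
  0 < eta -> `|D| <= 2 - eta -> 0 <= e -> 96 * e * J%:R <= eta -> e <= 1 ->
  let S j := `|x j| + `|x' j| + (`|x j.+1| + `|x' j.+1|) in
  (forall j, (j < J)%N -> `|x j.+2 + x j - D * x j.+1| <= e * S j) ->
  (forall j, (j < J)%N -> `|x' j.+2 + x' j - D * x' j.+1| <= e * S j) ->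
  forall j, (j <= J)%N ->
    x j ^+ 2 + x' j ^+ 2 <=
      8 / eta * (x 0%N ^+ 2 + x' 0%N ^+ 2 + (x 1%N ^+ 2 + x' 1%N ^+ 2)).
Proof.
move=> eta0 hD e0 heJ e1 S hx hx'.
have D2 : `|D| <= 2 by lra.
pose F j := Q (x j.+1) (x j) + Q (x' j.+1) (x' j).
have Flow j : eta / 2 * (x j ^+ 2 + x' j ^+ 2 + (x j.+1 ^+ 2 + x' j.+1 ^+ 2)) <= F j.
  by have := Q_lower (x j.+1) (x j) hD; have := Q_lower (x' j.+1) (x' j) hD;
     rewrite /F; lra.
have sq0 (t : R) : 0 <= t ^+ 2 by exact: sqr_ge0.
have F0 j : 0 <= F j.
  by apply: le_trans (Flow j); rewrite mulr_ge0 ?divr_ge0 ?addr_ge0 ?sq0// ltW.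
(* Each of the two energies gains at most 3 e S^2 in a step, and S^2 is at most 4 times the four
   squares, hence at most 8 F / eta: 48 = 6 . 8. *)
pose kap := 48 * e / eta.
have kap0 : 0 <= kap by rewrite /kap divr_ge0 ?mulr_ge0// ltW.
have step j : (j < J)%N -> F j.+1 <= F j * (1 + kap).
  move=> jJ.
  have S1 : `|x j.+1| + `|x j| <= S j.
    by rewrite /S; have := normr_ge0 (x' j); have := normr_ge0 (x' j.+1); lra.
  have S2 : `|x' j.+1| + `|x' j| <= S j.
    by rewrite /S; have := normr_ge0 (x j); have := normr_ge0 (x j.+1); lra.
  have ee : 0 <= e <= 1 by rewrite e0.
  have h1 := Q_step D2 ee (hx j jJ) S1.
  have h2 := Q_step D2 ee (hx' j jJ) S2.
  have h3 : S j ^+ 2 <= 4 * (x j ^+ 2 + x' j ^+ 2 + (x j.+1 ^+ 2 + x' j.+1 ^+ 2)).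
    rewrite /S -(real_normK (num_real (x j))) -(real_normK (num_real (x' j))).
    rewrite -(real_normK (num_real (x j.+1))) -(real_normK (num_real (x' j.+1))).
    set p := `|x j|; set p' := `|x' j|; set r := `|x j.+1|; set r' := `|x' j.+1|.
    have := sq0 (p - p'); have := sq0 (p - r); have := sq0 (p - r').
    have := sq0 (p' - r); have := sq0 (p' - r'); have := sq0 (r - r').
    by rewrite !sqrrB !sqrrD; lra.
  have h4 : S j ^+ 2 <= 8 / eta * F j.
    apply: le_trans h3 _.
    have h : 8 / eta * (eta / 2 * (x j ^+ 2 + x' j ^+ 2 + (x j.+1 ^+ 2 + x' j.+1 ^+ 2)))
        <= 8 / eta * F j by rewrite ler_wpM2l// divr_ge0// ltW.
    apply: le_trans h; rewrite mulrA le_eqVlt; apply/orP; left; apply/eqP.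
    by congr (_ * _); field; rewrite gt_eqF.
  have h5 : e * S j ^+ 2 <= e * (8 / eta * F j) by rewrite ler_wpM2l.
  rewrite {1}/F mulrDr mulr1 -/(F j).
  have -> : F j * kap = 6 * (e * (8 / eta * F j)) by rewrite /kap; ring.
  by rewrite /F in h5 *; lra.
have heJ2 j : (j <= J)%N -> 2 * kap * j%:R <= 1.
  move=> jJ; rewrite /kap.
  have : 96 * e * j%:R <= 96 * e * J%:R by rewrite ler_wpM2l ?mulr_ge0// ler_nat.
  move=> h; rewrite (_ : _ * _ = 96 * e * j%:R / eta); last by ring.
  by rewrite ler_pdivrMr// mul1r; exact: le_trans heJ.
(* A linear bound suffices in place of an exponential: (1 + 2 kap j)(1 + kap) <= 1 + 2 kap (j + 1)
   as long as 2 kap j <= 1. *)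
have grow j : (j <= J)%N -> F j <= F 0%N * (1 + 2 * kap * j%:R).
  elim: j => [|j IH] jJ; first by rewrite mulr0 addr0 mulr1.
  apply: le_trans (step j jJ) _.
  apply: le_trans (ler_wpM2r _ (IH (ltnW jJ))) _; first by lra.
  rewrite -[leLHS]mulrA ler_wpM2l// -(natr1 j).
  have := ler_wpM2l kap0 (heJ2 j (ltnW jJ)).
  by lra.
move=> j jJ.
have hF : F j <= F 0%N * 2.
  by apply: le_trans (grow j jJ) _; rewrite ler_wpM2l//; have := heJ2 j jJ; lra.
have hF0 : F 0%N <= 2 * (x 0%N ^+ 2 + x' 0%N ^+ 2 + (x 1%N ^+ 2 + x' 1%N ^+ 2)).
  by have := Q_upper (x 1%N) (x 0%N) D2; have := Q_upper (x' 1%N) (x' 0%N) D2;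
    rewrite /F; lra.
have hj := Flow j.
have h : 2 / eta * (eta / 2 * (x j ^+ 2 + x' j ^+ 2)) <=
   2 / eta * (4 * (x 0%N ^+ 2 + x' 0%N ^+ 2 + (x 1%N ^+ 2 + x' 1%N ^+ 2))).
  rewrite ler_wpM2l ?divr_ge0 ?(ltW eta0)//.
  have : 0 <= eta / 2 * (x j.+1 ^+ 2 + x' j.+1 ^+ 2).
    by rewrite mulr_ge0 ?divr_ge0 ?addr_ge0 ?sq0// ltW.
  by lra.
rewrite (_ : 2 / eta * (eta / 2 * _) = x j ^+ 2 + x' j ^+ 2) in h; last first.
  by field; rewrite gt_eqF.
apply: le_trans h _; rewrite le_eqVlt; apply/orP; left; apply/eqP; ring.
Qed.

End Elliptic.

Section BlockIndices.
Variables (q J j k : nat).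

Lemma block_range : (j <= J)%N -> (k < q)%N ->
  0 < (j * q)%N%:Z + k.+1%:Z <= (J.+1 * q)%N%:Z.
Proof. by nia. Qed.

Lemma block_pred : (j.+1 * q)%N%:Z - q%:Z = (j * q)%N%:Z.
Proof. by lia. Qed.

Lemma block_succ : (j * q)%N%:Z + q%:Z = (j.+1 * q)%N%:Z.
Proof. by lia. Qed.

Lemma block_range2 (m : int) : (j < J)%N ->
  (j * q)%N%:Z < m <= (j.+2 * q)%N%:Z -> 0 < m <= (J.+1 * q)%N%:Z.
Proof. by nia. Qed.

End BlockIndices.

Section BoundedSolutions.
Context {R : realType}.
Variables (a v : int -> R) (q J : nat) (K X E d eta : R).

Let D := discriminant q E (shifted a 0) (shifted v 0).

(** [elliptic_recurrence] controls the first two values of every block, and [gronwall] the sites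
    inside a block. One factor X bounds the data of block 1 by those of block 0, the other moves
    from the start of a block to its interior. The relation centred at block j + 1 reads up to block
    j + 2, whence the range J + 1. *)
Lemma bounded_solution (u : int -> R^o) :
  (0 < q)%N -> (0 < J)%N -> 0 < eta -> eta <= 1 -> `|D| <= 2 - eta ->
  2 * d * X * q%:R <= 1 -> 480 * X ^+ 3 * q%:R * d * J%:R <= eta ->
  (forall j, (j <= J.+1)%N -> block_ok q K X E d a v (j * q)%N%:Z) ->
  (forall m : int, 0 < m <= (J.+1 * q)%N%:Z -> residualz E a v u m = 0) ->
  forall n, (n <= J * q)%N ->
    `|u n%:Z| <= 6 * X ^+ 2 / eta * (`|u 0| + `|u 1|).
Proof.
move=> q0 J0 eta0 eta1 hD dXq hJ ok hu.
have w0 := ok 0%N (leq0n _).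
have [win0 dd0 _] := w0.
have d0 : 0 <= d by exact: le_trans (normr_ge0 _) (dd0 0%N (leq0n q)).
have X1 := window_X1 win0.
pose x j := u (j * q)%N%:Z; pose x' j := u ((j * q)%N%:Z + 1).
(* The error rate of [block_relation] for an exact solution; the hypothesis with 480 = 96 . 5
   becomes the smallness condition of [elliptic_recurrence]. *)
pose e := 5 * X ^+ 3 * q%:R * d.
have e0 : 0 <= e by rewrite /e !mulr_ge0// ?exprn_ge0//; lra.
have HN := absr_seminorm R.
have gr j n : (j <= J.+1)%N -> (j <= J)%N -> (n <= q)%N ->
   `|u ((j * q)%N%:Z + n%:Z)| + `|u ((j * q)%N%:Z + n.+1%:Z)|
     <= X * (`|x j| + `|x' j|).
  move=> jJ1 jJ nq; have [win _ _] := ok j jJ1.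
  have := gronwall HN (phi := shifted u (j * q)%N%:Z) win (lexx 0).
  rewrite mulr0 addr0 /shifted addr0 => h; apply: h => // k kq.
  rewrite -/(shifted u _) residual_shifted hu ?normr0//.
  exact: block_range.
have hb j : (j < J)%N ->
   `|x j.+2 + x j - D * x j.+1| <= e * (`|x j| + `|x' j| + (`|x j.+1| + `|x' j.+1|)) /\
   `|x' j.+2 + x' j - D * x' j.+1| <= e * (`|x j| + `|x' j| + (`|x j.+1| + `|x' j.+1|)).
  move=> jJ.
  have := @block_relation R R^o _ HN q K X E d a v u (j.+1 * q)%N%:Z 0 q0 (lexx _) dXq w0.
  rewrite block_pred block_succ => h.
  have [|||//|h1 h2] := h.
  - by apply: ok; exact: leq_trans jJ _.
  - by apply: ok; exact: leq_trans (ltnW jJ) _.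
  - by rewrite -[q in q%:Z]mul1n; exact: ok.
  - by move=> m /(block_range2 jJ) hm; rewrite hu ?normr0.
  rewrite mulr0 add0r -/e in h1 h2.
  rewrite [X in e * X]addrC in h1; rewrite [X in e * X]addrC in h2.
  exact: conj h1 h2.
have he : 96 * e * J%:R <= eta by apply: le_trans hJ; rewrite /e; lra.
have J1 : 1 <= J%:R :> R by rewrite ler1n.
have e1 : e <= 1.
  have : e <= e * J%:R by rewrite ler_peMr.
  by lra.
have hel := @elliptic_recurrence R D eta x x' e J eta0 hD e0 he e1
   (fun j jJ => (hb j jJ).1) (fun j jJ => (hb j jJ).2).
move=> n nJ.
have jJ : (n %/ q <= J)%N by rewrite -(mulnK J q0) leq_div2r.
have rq : (n %% q <= q)%N by rewrite ltnW// ltn_mod.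
have hn := gr _ _ (leqW jJ) jJ rq.
have := hel _ jJ; set j := (n %/ q)%N in jJ hn *.
rewrite -PoszD -divn_eq in hn.
set Y := `|u 0| + `|u 1|.
have Y0 : 0 <= Y by rewrite addr_ge0.
have g1 : `|x 1%N| + `|x' 1%N| <= X * Y.
  have := gr 0%N q isT isT (leqnn q).
  by rewrite addzS block_succ.
have sqsum (s t : R) : s ^+ 2 + t ^+ 2 <= (`|s| + `|t|) ^+ 2.
  rewrite -(real_normK (num_real s)) -(real_normK (num_real t)) sqrrD.
  by have := mulr_ge0 (normr_ge0 s) (normr_ge0 t); lra.
have k1 : x 1%N ^+ 2 + x' 1%N ^+ 2 <= (X * Y) ^+ 2.
  by apply: le_trans (sqsum _ _) _; apply: ler_expr_base => //; exact: addr_ge0.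
have k0 : x 0%N ^+ 2 + x' 0%N ^+ 2 <= (X * Y) ^+ 2.
  apply: le_trans (sqsum _ _) _; apply: ler_expr_base; first exact: addr_ge0.
  by rewrite /x /x' mul0n add0r -/Y ler_peMl.
move=> k2.
have k3 : (`|x j| + `|x' j|) ^+ 2 <= 2 * (x j ^+ 2 + x' j ^+ 2).
  rewrite -(real_normK (num_real (x j))) -(real_normK (num_real (x' j))) sqrrD.
  by have := sqr_ge0 (`|x j| - `|x' j|); rewrite sqrrB; lra.
have k4 : 8 / eta * (x 0%N ^+ 2 + x' 0%N ^+ 2 + (x 1%N ^+ 2 + x' 1%N ^+ 2)) <=
    8 / eta * (2 * (X * Y) ^+ 2).
  by rewrite ler_wpM2l ?divr_ge0 ?(ltW eta0)//; lra.
have k5 : (`|x j| + `|x' j|) ^+ 2 <= (6 / eta * (X * Y)) ^+ 2.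
  have sXY : 0 <= (X * Y) ^+ 2 by exact: sqr_ge0.
  (* Rounding 32 / eta up to the perfect square 36 / eta^2, which uses eta <= 1. *)
  have : 32 / eta * (X * Y) ^+ 2 <= 36 / eta ^+ 2 * (X * Y) ^+ 2.
    rewrite ler_wpM2r// ler_pdivlMr ?exprn_gt0// expr2.
    by rewrite mulrA divfK ?gt_eqF//; lra.
  have -> : (6 / eta * (X * Y)) ^+ 2 = 36 / eta ^+ 2 * (X * Y) ^+ 2.
    by field; rewrite gt_eqF.
  have -> : 32 / eta * (X * Y) ^+ 2 = 2 * (8 / eta * (2 * (X * Y) ^+ 2)) by ring.
  by lra.
have k6 : `|x j| + `|x' j| <= 6 / eta * (X * Y).
  have XY : 0 <= 6 / eta * (X * Y).
    by rewrite mulr_ge0 ?divr_ge0 ?(ltW eta0)// mulr_ge0//; lra.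
  by rewrite -(@ler_pXn2r _ 2) ?nnegrE ?addr_ge0.
have k7 : X * (`|x j| + `|x' j|) <= X * (6 / eta * (X * Y)) by rewrite ler_wpM2l//; lra.
have k8 := normr_ge0 (u ((j * q)%N%:Z + (n %% q).+1%:Z)).
have -> : 6 * X ^+ 2 / eta * Y = X * (6 / eta * (X * Y)) by ring.
by apply: le_trans k7; apply: le_trans hn; rewrite lerDl.
Qed.

End BoundedSolutions.

(** * Bounds for the projected basis *)

Section JacobiBasis.
Context {R : realType} {V : lmodType R} (ip : V -> V -> R).
Context (H : V -> V) (P : set (measurableTypeR R) -> V -> V).
Context (HP : resolution ip H P).
Variables (a v : int -> R) (e : int -> V).

Definition jacobi_basis :=
  (forall m n, ip (e m) (e n) = (m == n)%:R) /\
  (forall m, H (e m) = a m *: e (m + 1) + a (m - 1) *: e (m - 1) + v m *: e m).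

Hypothesis He : jacobi_basis.
Let Hip := rs_ip HP.
Notation N := (ipn ip).
Let HN := ipn_seminorm Hip.

Lemma resolution_sum (I : Type) (r : seq I) (F : I -> V) :
  H (\sum_(i <- r) F i) = \sum_(i <- r) H (F i).
Proof.
elim/big_rec2 : _ => [|i y x _ <-]; last by rewrite (rs_HD HP).
by have := rs_HZ HP 0 0; rewrite !scale0r.
Qed.

Lemma proj_basis_le1 B m : measurable B -> N (P B (e m)) <= 1.
Proof.
move=> mB; apply: le_trans (proj_le HP _ mB) _.
by rewrite /ipn; have [-> _] := He; rewrite eqxx sqrtr1.
Qed.

(** Orthonormality yields the square root of L where the triangle inequality would yield L. This
    gain is what produces the factor 1/L in [proj_basis_le]. *)
Lemma basis_comb_le (L : nat) (f : 'I_L -> int) (c : 'I_L -> R) (b : R) :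
  injective f -> 0 <= b -> (forall i, `|c i| <= b) ->
  N (\sum_i c i *: e (f i)) <= b * Num.sqrt L%:R.
Proof.
move=> inj b0 hc; have [he _] := He.
rewrite -(@ler_pXn2r _ 2) ?nnegrE ?mulr_ge0 ?ipn_ge0 ?sqrtr_ge0//.
rewrite (ipn_sq Hip) (orthonormal_sum Hip _ he inj) exprMn sqr_sqrtr//.
rewrite mulrC mulr_natl -[L in leRHS]card_ord -sumr_const; apply: ler_sum => i _.
by rewrite -(real_normK (num_real (c i))) ler_expr_base.
Qed.

Lemma proj_residual B c m : measurable B ->
  residualz c a v (fun n => P B (e n)) m = P B (H (e m) - c *: e m).
Proof.
move=> mB; have [_ ->] := He; rewrite /residualz.
rewrite (projB HP) // !(rs_PD HP)// !(rs_PZ HP)//.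
by rewrite scalerBl addrA.
Qed.

(** The projected basis is thus an approximate generalised eigenfunction with values in the Hilbert
    space, to which the transfer estimates apply. *)
Lemma proj_residual_le B c h m : measurable B -> 0 < h ->
  B `<=` [set x : R | c - h <= x <= c + h] ->
  N (residualz c a v (fun n => P B (e n)) m) <= h * N (P B (e m)).
Proof. by move=> mB h0 sB; rewrite proj_residual//; exact: (proj_almost_eigen HP). Qed.

(* Beyond 5 A the eigenvalue equation contracts the supremum of the |P_B e_n| by 1/2. *)
Lemma proj_far B c h A m : measurable B -> 0 < h -> 0 < A ->
  (forall n, 0 <= a n <= A) -> (forall n, `|v n| <= A) -> 5 * A + h <= `|c| ->
  B `<=` [set x : R | c - h <= x <= c + h] -> N (P B (e m)) = 0.
Proof.
move=> mB h0 A0 ha hv hc sB.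
have key k n : N (P B (e n)) <= 2^-1 ^+ k.
  elim: k n => [|k IH] n; first by rewrite expr0 proj_basis_le1.
  have h1 := proj_residual_le n mB h0 sB.
  have h2 : `|v n - c| * N (P B (e n)) <= h * N (P B (e n)) +
     (a n * N (P B (e (n + 1))) + a (n - 1) * N (P B (e (n - 1)))).
    have /andP[an0 _] := ha n; have /andP[an1 _] := ha (n - 1).
    rewrite -(snZ HN) -{1}(ger0_norm an0) -{1}(ger0_norm an1) -!(snZ HN).
    have -> : (v n - c) *: P B (e n) = residualz c a v (fun n => P B (e n)) n -
       (a n *: P B (e (n + 1)) + a (n - 1) *: P B (e (n - 1))).
      by rewrite /residualz [RHS]addrAC subrr add0r.
    apply: le_trans (snB HN _ _) _; apply: lerD => //.
    exact: (snD HN).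
  have h3 : 4 * A + h <= `|v n - c|.
    by have := lerB_dist c (v n); rewrite distrC; have := hv n; lra.
  have h4 : (4 * A + h) * N (P B (e n)) <= `|v n - c| * N (P B (e n)).
    by rewrite ler_wpM2r// ipn_ge0.
  have h5 : a n * N (P B (e (n + 1))) <= A * 2^-1 ^+ k.
    by have /andP[? ?] := ha n; apply: ler_pM => //; exact: ipn_ge0.
  have h6 : a (n - 1) * N (P B (e (n - 1))) <= A * 2^-1 ^+ k.
    by have /andP[? ?] := ha (n - 1); apply: ler_pM => //; exact: ipn_ge0.
  rewrite exprS -(@ler_pM2l _ (4 * A)); last by lra.
  by lra.
apply/eqP; rewrite eq_le ipn_ge0 andbT.
apply/ler_addgt0Pr => eps eps0; rewrite add0r.
have /cvgrPdist_lt/(_ _ eps0)[k _ hk] : (fun k => (2^-1 : R) ^+ k) @ \oo --> (0 : R).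
  by apply: cvg_expr; rewrite ger0_norm ?invr_ge0// invf_lt1// ltr1n.
have := hk k (leqnn k); rewrite /= sub0r normrN ger0_norm ?exprn_ge0 ?invr_ge0//.
by move=> /ltW; exact: le_trans (key k m).
Qed.

(* Lagrange's identity: the Wronskian W_n of a generalised eigenfunction u and of
   the projected basis is almost constant; averaging it over n bounds W_0. *)
Lemma proj_basis_le (B : set (measurableTypeR R)) (E A b : R) (L : nat) (m : int)
    (u : int -> R^o) :
  measurable B -> (0 < L)%N ->
  B `<=` [set x : R | E - L%:R^-1 <= x <= E + L%:R^-1] ->
  (forall n, 0 <= a n <= A) -> u m = 0 ->
  (forall k, (k < L)%N -> residualz E a v u (m + k.+1%:Z) = 0) ->
  (forall k, (k <= L)%N -> `|u (m + k%:Z)| <= b) ->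
  (a m * u (m + 1)) ^+ 2 * N (P B (e m)) ^+ 2 <= ((1 + 2 * A) * b) ^+ 2 / L%:R.
Proof.
move=> mB L0 sB ha um hu hb.
pose phi n := P B (e n).
pose W n := a n *: (u n *: phi (n + 1) - u (n + 1) *: phi n).
have b0 : 0 <= b by exact: le_trans (normr_ge0 _) (hb 0%N isT).
have A0 : 0 <= A by have /andP[h1 h2] := ha 0; exact: le_trans h1 h2.
have Lr : 0 < L%:R :> R by rewrite ltr0n.
have sL : 0 < Num.sqrt L%:R :> R by rewrite sqrtr_gt0.
have sL2 : Num.sqrt L%:R ^+ 2 = L%:R :> R by rewrite sqr_sqrtr// ltW.
have lagrange n : residualz E a v u (n + 1) = 0 ->
    W (n + 1) - W n = u (n + 1) *: residualz E a v phi (n + 1).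
  rewrite /W /residualz addrK => h.
  have h' : u (n + 1) * (v (n + 1) - E) = - (a (n + 1) * u (n + 1 + 1)) - a n * u n.
    have {}h : a (n + 1) * u (n + 1 + 1) + a n * u n + (v (n + 1) - E) * u (n + 1) = 0.
      exact: h.
    by rewrite mulrC; lra.
  rewrite !scalerBr !scalerDr !scalerA h' scalerBl scaleNr opprB addrACA.
  by rewrite ![u (n + 1) * a _]mulrC.
have telescope k : (k <= L)%N -> W (m + k%:Z) = W m +
    \sum_(i < k) u (m + i.+1%:Z) *: residualz E a v phi (m + i.+1%:Z).
  elim: k => [|k IH] kL; first by rewrite big_ord0 !addr0.
  rewrite big_ord_recr/= addrA -IH ?(ltnW kL)// addzS -lagrange; last first.
    by rewrite -addzS hu.
  by rewrite addrC subrK.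
have Lh : 0 < L%:R^-1 :> R by rewrite invr_gt0.
have partial k : (k < L)%N ->
    N (\sum_(i < k) u (m + i.+1%:Z) *: residualz E a v phi (m + i.+1%:Z)) <=
    L%:R^-1 * (b * Num.sqrt L%:R).
  move=> kL.
  (* The increments are not estimated one by one: their sum is [P B (H - E)] applied to a single
     combination of basis vectors, whose norm is at most b times the square root of L. *)
  have -> : \sum_(i < k) u (m + i.+1%:Z) *: residualz E a v phi (m + i.+1%:Z) =
     P B (H (\sum_(i < k) u (m + i.+1%:Z) *: e (m + i.+1%:Z))
       - E *: (\sum_(i < k) u (m + i.+1%:Z) *: e (m + i.+1%:Z))).
    rewrite resolution_sum scaler_sumr -sumrB (proj_sum HP)//.
    apply: eq_bigr => i _; rewrite proj_residual// (rs_HZ HP) scalerA [E * _]mulrC.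
    by rewrite -scalerA -scalerBr (rs_PZ HP).
  apply: le_trans (proj_almost_eigen HP _ mB Lh sB) _.
  rewrite ler_pM2l//; apply: le_trans (proj_le HP _ mB) _.
  have := @basis_comb_le k (fun i => m + i.+1%:Z) (fun i => u (m + i.+1%:Z)) b.
  move=> h; apply: le_trans (h _ _ _) _ => //.
  - by move=> i j /addrI[] /val_inj.
  - by move=> i; apply: hb; exact: leq_trans (ltn_ord i) (ltnW kL).
  - by rewrite ler_wpM2l// ler_sqrt// ?ler_nat// ltnW.
have average : N (\sum_(k < L) W (m + k%:Z)) <= 2 * (A * b) * Num.sqrt L%:R.
  (* The sum of the Wronskians is likewise a difference of two projected combinations of distinct
     basis vectors. *)
  have -> : \sum_(k < L) W (m + k%:Z) =
     P B (\sum_(k < L) (a (m + k%:Z) * u (m + k%:Z)) *: e (m + k%:Z + 1)) -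
     P B (\sum_(k < L) (a (m + k%:Z) * u (m + k%:Z + 1)) *: e (m + k%:Z)).
    rewrite !(proj_sum HP)// -sumrB; apply: eq_bigr => k _.
    by rewrite /W scalerBr !scalerA !(rs_PZ HP).
  have ab (k : 'I_L) j : (j <= L)%N -> `|a (m + k%:Z) * u (m + j%:Z)| <= A * b.
    move=> jL; have /andP[a0 aA] := ha (m + k%:Z).
    by rewrite normrM (ger0_norm a0); apply: ler_pM => //; exact: hb.
  have Ab0 : 0 <= A * b by rewrite mulr_ge0.
  apply: le_trans (snB HN _ _) _; rewrite -mulrA mulr_natl mulr2n; apply: lerD.
  - apply: le_trans (proj_le HP _ mB) _; apply: basis_comb_le => //.
      by move=> i j /addIr/addrI[] /val_inj.
    by move=> k; apply: ab; exact: ltnW.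
  - apply: le_trans (proj_le HP _ mB) _; apply: basis_comb_le => //.
      by move=> i j /addrI[] /val_inj.
    by move=> k; rewrite -addzS; exact: ab.
have main : L%:R * N (W m) <= (1 + 2 * A) * b * Num.sqrt L%:R.
  have -> : L%:R * N (W m) = N (\sum_(k < L) W m).
    by rewrite sumr_const card_ord -[W m *+ L]scaler_nat (snZ HN (L%:R)) ger0_norm// ltW.
  have -> : \sum_(k < L) W m = \sum_(k < L) W (m + k%:Z) -
     \sum_(k < L) \sum_(i < k) u (m + i.+1%:Z) *: residualz E a v phi (m + i.+1%:Z).
    rewrite -sumrB; apply: eq_bigr => k _.
    by rewrite (telescope _ (ltnW (ltn_ord k))) addrK.
  apply: le_trans (snB HN _ _) _.
  have h1 : N (\sum_(k < L) \sum_(i < k) u (m + i.+1%:Z) *: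
     residualz E a v phi (m + i.+1%:Z)) <= b * Num.sqrt L%:R.
    apply: le_trans (sn_sum HN _ _ _) _.
    have -> : b * Num.sqrt L%:R = \sum_(k < L) (L%:R^-1 * (b * Num.sqrt L%:R)).
      by rewrite sumr_const card_ord -[RHS]mulr_natl mulVKf ?gt_eqF.
    by apply: ler_sum => k _; exact: partial.
  by lra.
have Wm : N (W m) = `|a m * u (m + 1)| * N (P B (e m)).
  by rewrite /W um scale0r sub0r scalerN (snN HN) scalerA (snZ HN).
rewrite Wm in main.
have Np : 0 <= N (P B (e m)) by exact: ipn_ge0.
have : (L%:R * (`|a m * u (m + 1)| * N (P B (e m)))) ^+ 2 <=
   ((1 + 2 * A) * b * Num.sqrt L%:R) ^+ 2.
  by apply: ler_expr_base => //; rewrite !mulr_ge0// ltW.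
rewrite !exprMn sL2 real_normK ?num_real// exprMn => h.
rewrite ler_pdivlMr// -(ler_pM2l Lr).
by lra.
Qed.

End JacobiBasis.

Lemma sqr_sum_le (R : realType) (I : finType) (x : I -> R) :
  (\sum_i x i) ^+ 2 <= #|I|%:R * \sum_i x i ^+ 2.
Proof.
have -> : #|I|%:R * \sum_i x i ^+ 2 =
    \sum_i \sum_j (x i ^+ 2 + x j ^+ 2) / 2.
  have row i : \sum_j (x i ^+ 2 + x j ^+ 2) / 2 =
      (#|I|%:R * x i ^+ 2 + \sum_j x j ^+ 2) / 2.
    by rewrite -mulr_suml big_split/= sumr_const mulr_natl.
  rewrite (eq_bigr _ (fun i _ => row i)) -mulr_suml big_split/= -mulr_sumr.
  by rewrite sumr_const -[X in _ + X]mulr_natl; lra.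
rewrite expr2 big_distrlr/=; apply: ler_sum => i _; apply: ler_sum => j _.
by have := sqr_ge0 (x i - x j); rewrite sqrrB; lra.
Qed.

Section CenteredIndices.
Variables (M : nat) (m : int).
Hypothesis mM : `|m| <= M%:Z.

Lemma centered_lt : (absz (m + M%:Z)%R < 2 * M + 1)%N.
Proof. by move: mM; lia. Qed.

Lemma centered_sub : (absz (m + M%:Z))%:Z - M%:Z = m.
Proof. by move: mM; lia. Qed.

End CenteredIndices.

Section WindowIndices.
Variables (k q : nat) (j : int).
Hypotheses (q0 : (0 < q)%N) (jk : `|j| <= k%:Z).

Lemma window_index (m : int) : j * q%:Z - q%:Z < m <= j * q%:Z + q%:Z ->
  `|m| <= (k.+2 * q)%N%:Z.
Proof. by move: q0 jk; nia. Qed.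

Lemma window_index1 (s : int) : 0 <= s <= 1 -> `|j * q%:Z + s| <= (k.+2 * q)%N%:Z.
Proof. by move: q0 jk; nia. Qed.

Lemma window_index2 (s : int) : 0 <= s <= 1 ->
  `|j * q%:Z - q%:Z + s| <= (k.+2 * q)%N%:Z.
Proof. by move: q0 jk; nia. Qed.

End WindowIndices.

Section BadEnergies.
Context {R : realType} {V : lmodType R} (ip : V -> V -> R).
Context (H : V -> V) (P : set (measurableTypeR R) -> V -> V).
Context (HP : resolution ip H P).
Variables (a v : int -> R) (e : int -> V).
Hypothesis He : jacobi_basis ip H a v e.
Let Hip := rs_ip HP.
Notation N := (ipn ip).
Let HN := ipn_seminorm Hip.

(** The pieces over disjoint sets are orthogonal. In a sum over energy cells the number of cells
    therefore does not enter. *)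
Lemma bessel (T : finType) (S : T -> set (measurableTypeR R)) u :
  (forall t, measurable (S t)) ->
  (forall t t', t != t' -> S t `&` S t' = set0) ->
  \sum_t N (P (S t) u) ^+ 2 <= N u ^+ 2.
Proof.
move=> mS dS; pose w := \sum_t P (S t) u.
have uw : ip u w = \sum_t N (P (S t) u) ^+ 2.
  by rewrite (ip_sumr Hip); apply: eq_bigr => t _; rewrite (ipn_proj HP).
have ww : ip w w = \sum_t N (P (S t) u) ^+ 2.
  rewrite (ip_sumr Hip); apply: eq_bigr => t _.
  rewrite (ipC Hip) (ip_sumr Hip) (bigD1 t)//= -(ipn_sq Hip) big1 ?addr0// => t' tt'.
  rewrite (rs_Psym HP)// (rs_PI HP)// dS// (rs_P0 HP).
  by rewrite (ip0l Hip).
have := ip_ge0 Hip (u - w).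
rewrite (ipBl Hip) !(ipBr Hip) (ipC Hip w u) ww uw (ipn_sq Hip).
by lra.
Qed.

Lemma cheb_sum_norm (k q : nat) (s : int) : (0 < q)%N ->
  N (cheb_sum (fun j => e (j * q%:Z + s)) k) ^+ 2 = k.+1%:R.
Proof.
move=> q0; have [he _] := He.
rewrite (ipn_sq Hip) /cheb_sum.
under eq_bigr do rewrite -[e _]scale1r.
rewrite (orthonormal_sum Hip (fun=> 1) he).
  by rewrite expr1n sumr_const card_ord.
move=> i j /addIr /mulIf; rewrite eqz_nat -lt0n q0 => /(_ isT).
move=> h; apply: val_inj => /=; lia.
Qed.

(* The Chebyshev sums of the projected basis are projections of the vector
   sum_j e_{(k - 2 j) q + s}, of squared norm only k + 1, whereas cheb k is of size k
   at a bad trace. *)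
Lemma bad_measure (T : finType) (S : T -> set (measurableTypeR R)) (lam : T -> R)
    (k q : nat) (K X d tau : R) (s : int) :
  (0 < k)%N -> (0 < q)%N -> 0 < tau -> tau <= d -> 2 * d * X * q%:R <= 1 ->
  0 <= s <= 1 ->
  (forall t, measurable (S t)) ->
  (forall t t', t != t' -> S t `&` S t' = set0) ->
  (forall t, S t `<=` [set x : R | lam t - tau <= x <= lam t + tau]) ->
  (forall t (j : int), `|j| <= k.+1%:Z -> block_ok q K X (lam t) d a v (j * q%:Z)) ->
  (forall t, 2 - (2 * k.+1%:R ^+ 2)^-1 <=
     `|discriminant q (lam t) (shifted a 0) (shifted v 0)|) ->
  (k.+1%:R / 2) ^+ 2 * (\sum_t N (P (S t) (e s)) ^+ 2) <=
    2 * 2 + 2 * k.+1%:R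
    + 4 * (24 * X ^+ 3 * q%:R * d * (k + 3)%:R ^+ k * (2 * (k.+2 * q) + 1)%:R) ^+ 2.
Proof.
move=> k0 q0 tau0 taud dXq s01 mS dS sS ok hD.
set M := (k.+2 * q)%N.
pose idx (i : 'I_(2 * M + 1)) : int := i%:Z - M%:Z.
(* [G t] dominates every projected vector that the relations touch, and its squares sum to at most
   (2 M + 1)^2 by [bessel]. Errors proportional to [G t], rather than to 1, remain summable over the
   cells. *)
pose G t := \sum_i N (P (S t) (e (idx i))).
have d0 : 0 <= d by exact: le_trans (ltW tau0) taud.
have Np t u : 0 <= N (P (S t) u) by exact: ipn_ge0.
have G0 t : 0 <= G t by apply: sumr_ge0.
have GM t (m : int) : `|m| <= M%:Z -> N (P (S t) (e m)) <= G t.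
  move=> mM; have [i <-] : exists i, idx i = m.
    exists (Ordinal (centered_lt mM)); rewrite /idx/=; exact: centered_sub.
  by rewrite /G (bigD1 i)//= lerDl sumr_ge0.
pose y t (j : int) := P (S t) (e (j * q%:Z + s)).
(* 24 = 4 + 5 . 4: the residual term with tau <= d, and four projected vectors in the perturbation
   term. *)
pose eps t := 24 * X ^+ 3 * q%:R * d * G t.
have heps t : 0 <= eps t.
  have X0 : 0 <= X by by have [/window_X1/(le_trans ler01)] := ok t 0 isT.
  by rewrite /eps !mulr_ge0// exprn_ge0.
have ytr t (j : int) : `|j| <= k%:Z ->
    N (y t (j + 1) + y t (j - 1) -
       discriminant q (lam t) (shifted a 0) (shifted v 0) *: y t j) <= eps t.
  move=> jk.
  have okb : block_ok q K X (lam t) d a v (j * q%:Z) by apply: ok; lia.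
  have okc : block_ok q K X (lam t) d a v (j * q%:Z - q%:Z).
    by rewrite -[X in _ - X]mul1r -mulrBl; apply: ok; lia.
  have ok0 : block_ok q K X (lam t) d a v 0.
    by rewrite -[0](mul0r q%:Z); apply: ok.
  have ok1 : block_ok q K X (lam t) d a v q%:Z.
    by rewrite -[q%:Z]mul1r; apply: ok.
  have rho0 : 0 <= tau * G t by rewrite mulr_ge0// ltW.
  have [m|h1 h2] := block_relation (phi := fun n => P (S t) (e n)) HN q0 rho0 dXq
    ok0 okb okc ok1.
    move=> hm; apply: le_trans (proj_residual_le HP He _ (mS t) tau0 (sS t)) _.
    by rewrite ler_pM2l// GM//; exact: window_index hm.
  set B := 4 * _ * _ * _ + _ in h1 h2.
  have hB : B <= eps t.
    have g1 := GM t _ (window_index1 q0 jk (s := 0) isT).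
    have g2 := GM t _ (window_index1 q0 jk (s := 1) isT).
    have g3 := GM t _ (window_index2 q0 jk (s := 0) isT).
    have g4 := GM t _ (window_index2 q0 jk (s := 1) isT).
    rewrite !addr0 in g1 g3.
    have X1' : 1 <= X by have [/window_X1] := ok0.
    have X0 : 0 <= X by exact: le_trans ler01 X1'.
    have X2 : 0 <= X ^+ 2 by rewrite exprn_ge0.
    have X3 : 0 <= X ^+ 3 by rewrite exprn_ge0.
    have X23 : X ^+ 2 <= X ^+ 3 by apply: ler_weXn2l.
    have c1 : 4 * X ^+ 2 * q%:R * (tau * G t) <= 4 * X ^+ 3 * q%:R * (d * G t).
      apply: ler_pM => //; first by rewrite !mulr_ge0.
        by rewrite ler_wpM2r// ler_wpM2l.
      by rewrite ler_wpM2r.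
    have c2 : 5 * X ^+ 3 * q%:R * d * (N (P (S t) (e (j * q%:Z)))
        + N (P (S t) (e (j * q%:Z + 1))) + (N (P (S t) (e (j * q%:Z - q%:Z)))
        + N (P (S t) (e (j * q%:Z - q%:Z + 1))))) <= 5 * X ^+ 3 * q%:R * d * (4 * G t).
      by rewrite ler_wpM2l ?mulr_ge0//; lra.
    by rewrite /B /eps; lra.
  have ej1 : (j + 1) * q%:Z = j * q%:Z + q%:Z by rewrite mulrDl mul1r.
  have ej2 : (j - 1) * q%:Z = j * q%:Z - q%:Z by rewrite mulrBl mul1r.
  rewrite /y ej1 ej2; apply: le_trans hB.
  have [->|->] : s = 0 \/ s = 1 by lia.
    by rewrite !addr0.
  by [].
have each t := bad_trace_bound HN (heps t) k0 (hD t) (ytr t).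
have y0 t : y t 0 = P (S t) (e s) by rewrite /y mul0r add0r.
have csum t m : cheb_sum (y t) m = P (S t) (cheb_sum (fun j => e (j * q%:Z + s)) m).
  by rewrite /cheb_sum (proj_sum HP).
have sum1 m : \sum_t N (cheb_sum (y t) m) ^+ 2 <= m.+1%:R.
  under eq_bigr do rewrite csum.
  by apply: le_trans (bessel _ mS dS) _; rewrite cheb_sum_norm.
have sumG : \sum_t G t ^+ 2 <= (2 * M + 1)%:R ^+ 2.
  apply: (@le_trans _ _ (\sum_t (2 * M + 1)%:R * \sum_i N (P (S t) (e (idx i))) ^+ 2)).
    by apply: ler_sum => t _; apply: le_trans (sqr_sum_le _) _; rewrite card_ord.
  rewrite -mulr_sumr exchange_big/= expr2 ler_wpM2l//.
  rewrite -[X in _ <= X%:R]card_ord -sumr_const; apply: ler_sum => i _.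
  apply: le_trans (bessel _ mS dS) _; have [he _] := He.
  by rewrite (ipn_sq Hip) he eqxx.
rewrite mulr_sumr.
apply: (@le_trans _ _ (\sum_t (2 * N (cheb_sum (y t) 1) ^+ 2 +
    2 * N (cheb_sum (y t) k) ^+ 2 + 4 * (eps t * (k + 3)%:R ^+ k) ^+ 2))).
  by apply: ler_sum => t _; rewrite -y0.
rewrite !big_split/= -!mulr_sumr.
have s1 := sum1 1%N; have sk := sum1 k.
have se : \sum_t (eps t * (k + 3)%:R ^+ k) ^+ 2 <=
    (24 * X ^+ 3 * q%:R * d * (k + 3)%:R ^+ k * (2 * M + 1)%:R) ^+ 2.
  have -> : \sum_t (eps t * (k + 3)%:R ^+ k) ^+ 2 =
      (24 * X ^+ 3 * q%:R * d * (k + 3)%:R ^+ k) ^+ 2 * \sum_t G t ^+ 2.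
    by rewrite mulr_sumr; apply: eq_bigr => t _; rewrite -exprMn /eps; congr (_ ^+ 2); ring.
  by rewrite [leRHS]exprMn ler_wpM2l// sqr_ge0.
by lra.
Qed.

End BadEnergies.

Section BlockWindow.
Variables (q J i k : nat).
Hypotheses (iJ : (i < J)%N) (kq : (k <= q)%N).

Lemma block_window_up : `|k%:Z + (i * q)%N%:Z| <= (J.+1 * q)%N%:Z.
Proof. by move: iJ kq; nia. Qed.

Lemma block_window_down : `|k%:Z - (i * q)%N%:Z| <= (J.+1 * q)%N%:Z.
Proof. by move: iJ kq; nia. Qed.

End BlockWindow.

Section ApproximatePeriods.
Context {R : realType}.
Variables (q : nat) (theta r : R).

Definition almost_period (a : int -> R) := forall m : int, `|m|%:~R <= r ->
  `|a m - a (m + q%:Z)| <= theta /\ `|a m - a (m - q%:Z)| <= theta.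

(** Each of the |j| shifts by q costs theta, and the radius leaves every intermediate site inside
    the range of the hypothesis. *)
Lemma almost_period_iter (a : int -> R) (J : nat) (j : int) k :
  almost_period a -> 0 <= theta -> (J.+1 * q)%:R <= r -> `|j| <= J%:Z -> (k <= q)%N ->
  `|a k%:Z - a (j * q%:Z + k%:Z)| <= J%:R * theta.
Proof.
move=> ha t0 hr jJ kq.
have up i : (i <= J)%N -> `|a k%:Z - a (k%:Z + (i * q)%N%:Z)| <= i%:R * theta.
  elim: i => [|i IH] iJ; first by rewrite mul0n addr0 subrr normr0 mul0r.
  have h : `|k%:Z + (i * q)%N%:Z|%:~R <= r.
    by apply: le_trans hr; rewrite pmulrn ler_int block_window_up.
  have [h1 _] := ha _ h.
  have -> : k%:Z + (i.+1 * q)%N%:Z = k%:Z + (i * q)%N%:Z + q%:Z by rewrite mulSn PoszD; ring.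
  apply: le_trans (ler_distD (a (k%:Z + (i * q)%N%:Z)) _ _) _.
  by rewrite -natr1 mulrDl mul1r; apply: lerD => //; apply: IH; exact: ltnW.
have down i : (i <= J)%N -> `|a k%:Z - a (k%:Z - (i * q)%N%:Z)| <= i%:R * theta.
  elim: i => [|i IH] iJ; first by rewrite mul0n subr0 subrr normr0 mul0r.
  have h : `|k%:Z - (i * q)%N%:Z|%:~R <= r.
    by apply: le_trans hr; rewrite pmulrn ler_int block_window_down.
  have [_ h1] := ha _ h.
  have -> : k%:Z - (i.+1 * q)%N%:Z = k%:Z - (i * q)%N%:Z - q%:Z by rewrite mulSn PoszD; ring.
  apply: le_trans (ler_distD (a (k%:Z - (i * q)%N%:Z)) _ _) _.
  by rewrite -natr1 mulrDl mul1r; apply: lerD => //; apply: IH; exact: ltnW.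
have mono i : (i <= J)%N -> i%:R * theta <= J%:R * theta.
  by move=> iJ; rewrite ler_wpM2r// ler_nat.
case: j jJ => i iJ.
  have {}iJ : (i <= J)%N by [].
  by rewrite [_ * _ + _]addrC -PoszM; apply: le_trans (up i iJ) (mono i iJ).
have {}iJ : (i.+1 <= J)%N by [].
by rewrite NegzE mulNr [- _ + _]addrC -PoszM; apply: le_trans (down _ iJ) (mono _ iJ).
Qed.

End ApproximatePeriods.

Section GoodEnergies.
Context {R : realType} {V : lmodType R} (ip : V -> V -> R).
Context (H : V -> V) (P : set (measurableTypeR R) -> V -> V).
Context (HP : resolution ip H P).
Variables (a v : int -> R) (e : int -> V).
Hypothesis He : jacobi_basis ip H a v e.
Notation N := (ipn ip).

(** At negative sites the value is a mirror image without meaning; the equation is claimed only at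
    sites n >= 1. *)
Definition solutionz (E x y : R) (n : int) : R^o :=
  solution (shifted a 0) (shifted v 0) E x y (absz n).

Lemma solutionz_residual E x y (n : nat) : (forall m, a m != 0) ->
  residualz E a v (solutionz E x y) n.+1%:Z = 0.
Proof.
move=> a0; have := residual_shifted E a v (solutionz E x y) 0 n.
rewrite add0r => <-.
rewrite /residual /shifted /GRing.scale/= !add0r.
have := @solutionSS _ (shifted a 0) (shifted v 0) E x y n.
by rewrite /shifted !add0r; apply.
Qed.

(** The Wronskian of [P S (e m)] with the solution that vanishes at m and equals 1 at m + 1 reduces
    to a single term at m, so [proj_basis_le] bounds the projected vector once this solution is
    bounded. *)
Lemma good_energy (q J L : nat) (A K X d eta E : R) (m : nat)
    (S : set (measurableTypeR R)) :
  (0 < q)%N -> (0 < J)%N -> (m <= 1)%N -> (0 < L)%N -> (L.+1 <= J * q)%N ->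
  0 < eta -> eta <= 1 -> 1 <= A -> (forall n, 0 < a n <= A) ->
  `|discriminant q E (shifted a 0) (shifted v 0)| <= 2 - eta ->
  2 * d * X * q%:R <= 1 -> 480 * X ^+ 3 * q%:R * d * J%:R <= eta ->
  (forall j : int, `|j| <= J.+1%:Z -> block_ok q K X E d a v (j * q%:Z)) ->
  measurable S -> S `<=` [set x : R | E - L%:R^-1 <= x <= E + L%:R^-1] ->
  N (P S (e m%:Z)) ^+ 2 <= (18 * A ^+ 2 * X ^+ 4 / eta) ^+ 2 / L%:R.
Proof.
move=> q0 J0 m1 L0 LJ eta0 eta1 A1 ha hD dXq hJ ok mS sS.
have an0 n : a n != 0 by have /andP[/lt0r_neq0] := ha n.
have okn (j : nat) : (j <= J.+1)%N -> block_ok q K X E d a v (j * q)%N%:Z.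
  by move=> jJ; rewrite PoszM; apply: ok.
have [win0 _ _] := okn 0%N isT.
have X1 : 1 <= X := window_X1 win0.
have X0 : 0 <= X := le_trans ler01 X1.
have a0X : (a 0)^-1 <= X.
  (* The window at block 0 controls the weights from site 1 on; [a 0] is the last weight of the
     window at block -1. *)
  have [winq _ _] := ok (- 1) isT.
  have := @window_inv _ q K X E _ _ q.-1 _ winq.
  by rewrite prednK// /shifted mulN1r addNr; apply.
have a1X : (a 1)^-1 <= X by have := window_inv q0 win0; rewrite mul0n.
(* For m = 1 the recurrence is solved backwards: this value at site 0, with 0 at site 1, forces the
   value 1 at site 2. *)
pose x := (if m == 0%N then 0 else - a 1 / a 0) : R.
pose y := (if m == 0%N then 1 else 0) : R.
pose u := solutionz E x y.
have [um um1 amX] : [/\ u m%:Z = 0, u (m%:Z + 1) = 1 & (a m%:Z)^-1 <= X].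
  rewrite /u /solutionz /x /y /solution /shifted.
  clear u x y; case: m m1 => [|[|//]] _ /=; split => //.
  rewrite add0r [0 + 1%:Z]add0r mulr0 addr0.
  change (- (a 0 * (- a 1 / a 0)) / a 1 = 1); field; by rewrite !an0.
have xy : `|u 0| + `|u 1| <= A * X.
  rewrite /u /solutionz /x /y /solution /=.
  have AX : 1 <= A * X by rewrite mulr_ege1.
  case: ifP => _; first by rewrite normr0 normr1 add0r.
  rewrite normr0 addr0 normrM normrN.
  have /andP[p0 _] := ha 0; have /andP[p1 p1A] := ha 1.
  rewrite [ `|a 1| ]gtr0_norm// [ `|_^-1| ]gtr0_norm ?invr_gt0//.
  by apply: ler_pM => //; rewrite ?invr_ge0 ltW.
have hu n : (n <= J * q)%N -> `|u n%:Z| <= 6 * X ^+ 2 / eta * (A * X).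
  move=> nJ.
  apply: le_trans (bounded_solution q0 J0 eta0 eta1 hD dXq hJ okn _ nJ) _.
    by move=> [[|k]|k] // _; exact: solutionz_residual.
  by rewrite ler_wpM2l// divr_ge0 ?mulr_ge0 ?exprn_ge0// ltW.
have sol k : (k < L)%N -> residualz E a v u (m%:Z + k.+1%:Z) = 0.
  by move=> kL; rewrite -PoszD addnS; exact: solutionz_residual.
have ubd k : (k <= L)%N -> `|u (m%:Z + k%:Z)| <= 6 * X ^+ 2 / eta * (A * X).
  move=> kL; rewrite -PoszD; apply: hu; apply: leq_trans LJ.
  by rewrite -add1n leq_add.
have ha' n : 0 <= a n <= A by have /andP[/ltW-> ->] := ha n.
have := proj_basis_le HP He mS L0 sS ha' um sol ubd.
rewrite um1 mulr1 => h.
have /andP[am0 _] := ha m%:Z.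
have Np : 0 <= N (P S (e m%:Z)) ^+ 2 by exact: sqr_ge0.
have Lr : 0 < L%:R :> R by rewrite ltr0n.
rewrite ler_pdivlMr// in h; rewrite ler_pdivlMr//.
have aX : 1 <= X ^+ 2 * a m%:Z ^+ 2.
  rewrite -exprMn; apply: exprn_ege1.
  by rewrite -(mulVf (lt0r_neq0 am0)) ler_wpM2r// ltW.
have h1 : N (P S (e m%:Z)) ^+ 2 * L%:R <=
    X ^+ 2 * a m%:Z ^+ 2 * (N (P S (e m%:Z)) ^+ 2 * L%:R).
  by rewrite ler_peMl// mulr_ge0// ltW.
have h2 : X ^+ 2 * (a m%:Z ^+ 2 * N (P S (e m%:Z)) ^+ 2 * L%:R) <=
   X ^+ 2 * ((1 + 2 * A) * (6 * X ^+ 2 / eta * (A * X))) ^+ 2.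
  by rewrite ler_wpM2l// sqr_ge0.
apply: le_trans h1 _.
have -> : X ^+ 2 * a m%:Z ^+ 2 * (N (P S (e m%:Z)) ^+ 2 * L%:R) =
    X ^+ 2 * (a m%:Z ^+ 2 * N (P S (e m%:Z)) ^+ 2 * L%:R) by ring.
apply: le_trans h2 _; rewrite -exprMn.
have Y0 : 0 <= 6 * A * X ^+ 4 / eta.
  by rewrite !mulr_ge0 ?invr_ge0 ?(ltW eta0) ?exprn_ge0//; lra.
(* 18 = 3 . 6 after 1 + 2 A <= 3 A. In X^4, two factors come from [bounded_solution], one from the
   initial values and one from dividing by [a m]. *)
have -> : 18 * A ^+ 2 * X ^+ 4 / eta = (3 * A) * (6 * A * X ^+ 4 / eta) by ring.
have -> : X * ((1 + 2 * A) * (6 * X ^+ 2 / eta * (A * X))) =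
    (1 + 2 * A) * (6 * A * X ^+ 4 / eta) by ring.
apply: ler_expr_base; first by rewrite mulr_ge0//; lra.
by rewrite ler_wpM2r//; lra.
Qed.

End GoodEnergies.

(** * Borel transforms *)

Section BorelTransform.
Context {R : realType}.
Let T := measurableTypeR R.
Implicit Types (mu : {measure set T -> \bar R}) (E e : R).

Lemma cauchy_kernelE (x E e : R) :
  (x%:C - (E +i* e))^-1 =
    ((x - E) / ((x - E) ^+ 2 + e ^+ 2)) +i* (e / ((x - E) ^+ 2 + e ^+ 2)).
Proof.
have -> : (x%:C - (E +i* e))^-1 = ((x - E) / ((x - E) ^+ 2 + (0 - e) ^+ 2)) -i*
   ((0 - e) / ((x - E) ^+ 2 + (0 - e) ^+ 2)) by [].
by rewrite sub0r sqrrN mulNr opprK.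
Qed.

Definition dyadic_itv E j : set T := [set` `[E - 2^-1 ^+ j, E + 2^-1 ^+ j]].

(** A step function above 1 / max(|x - E|, 2^-J): the weight 2^(j+1) sits on the interval of radius
    2^-j, and the constant 1 covers |x - E| >= 1. *)
Fixpoint dyadic_majorant E J (x : T) : R :=
  if J is j.+1 then dyadic_majorant E j x + 2 ^+ j.+2 * \1_(dyadic_itv E j.+1) x
  else 1 + 2 * \1_(dyadic_itv E 0) x.

Lemma indic_ge0 (A : set T) x : 0 <= \1_A x :> R.
Proof. by rewrite indicE. Qed.

Lemma dyadic_majorant_ge1 E J x : 1 <= dyadic_majorant E J x.
Proof.
elim: J => [|J IH] /=; first by rewrite lerDl mulr_ge0// indic_ge0.
by apply: le_trans IH _; rewrite lerDl mulr_ge0 ?exprn_ge0 ?indic_ge0.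
Qed.

Lemma dyadic_majorant_ge E J j x : (j <= J)%N -> `|x - E| <= 2^-1 ^+ j ->
  2 ^+ j.+1 <= dyadic_majorant E J x.
Proof.
move=> jJ h.
have one : \1_(dyadic_itv E j) x = 1 :> R.
  rewrite indicE mem_set// /dyadic_itv/= in_itv/=.
  by move: h; rewrite ler_norml; move=> /andP[? ?]; apply/andP; split; lra.
elim: J jJ => [|J IH].
  by rewrite leqn0 => /eqP j0; rewrite j0 in one *; rewrite /= one; lra.
rewrite leq_eqVlt => /orP[/eqP jJ|/IH h1] /=.
  by rewrite -jJ one mulr1 lerDr (le_trans ler01)// dyadic_majorant_ge1.
by apply: le_trans h1 _; rewrite lerDl mulr_ge0 ?exprn_ge0 ?indic_ge0.
Qed.

(** If t lies between 2^-(j+1) and 2^-j, then x belongs to the interval of index j, whose weight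
    2^(j+1) exceeds 1/t. The induction locates this j. *)
Lemma cauchy_kernel_le E J (t y : R) : 0 <= t -> y = Num.max t (2^-1 ^+ J) ->
  forall x, `|x - E| = t -> y^-1 <= dyadic_majorant E J x.
Proof.
move=> t0 -> x xt.
have p0 j : 0 < 2^-1 ^+ j :> R by rewrite exprn_gt0// invr_gt0.
have inv j : (2^-1 ^+ j)^-1 = 2 ^+ j :> R by rewrite exprVn invrK.
have [tJ|tJ] := leP t (2^-1 ^+ J).
  rewrite inv; apply: le_trans (dyadic_majorant_ge (leqnn J) _); rewrite ?xt//.
  by rewrite ler_eXn2l// ltr1n.
have step j : (j <= J)%N -> 2^-1 ^+ j < t -> t^-1 <= dyadic_majorant E J x.
  elim: j => [|j IH] jJ jt.
    apply: le_trans (dyadic_majorant_ge1 E J x).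
    by rewrite invf_le1 ?(ltW jt)// (lt_trans _ jt).
  have [h|h] := leP t (2^-1 ^+ j); last by apply: IH => //; exact: ltnW.
  apply: le_trans (dyadic_majorant_ge (ltnW jJ) _); rewrite ?xt//.
  by rewrite -inv lef_pV2 ?posrE// ?ltW// (lt_trans _ jt).
exact: step tJ.
Qed.

Lemma dyadic_majorant_measurable E J : measurable_fun setT (dyadic_majorant E J).
Proof.
have mi j : measurable_fun setT (\1_(dyadic_itv E j) : T -> R).
  by apply: measurable_indic; exact: measurable_itv.
elim: J => [|J IH] /=; apply: measurable_funD => //; apply: measurable_funM => //.
Qed.

(** Every dyadic level contributes the same amount 2^(j+1) . 2 G 2^-j = 4 G, so the sum over scales
    costs only a factor J + 1; the constant part contributes the total mass. *)
Lemma dyadic_majorant_integral mu E J (G : R) : 1 <= G ->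
  (mu setT <= 2%:E)%E ->
  (forall j, (j <= J)%N -> (mu (dyadic_itv E j) <= (2 * G * 2^-1 ^+ j)%:E)%E) ->
  (\int[mu]_x (dyadic_majorant E J x)%:E <= (2 + 4 * G * J.+1%:R)%:E)%E.
Proof.
move=> G1 mu2 hmu.
have mI j : measurable (dyadic_itv E j) by exact: measurable_itv.
have iI j k : 0 <= k -> (\int[mu]_x (k * \1_(dyadic_itv E j) x)%:E =
    k%:E * mu (dyadic_itv E j))%E.
  move=> k0; under eq_integral do rewrite EFinM.
  rewrite ge0_integralZl_EFin//.
  - by rewrite integral_indic// setIT.
  - by apply/measurable_EFinP; exact: measurable_indic.
have mk j k : measurable_fun setT (fun x : T => (k * \1_(dyadic_itv E j) x)%:E).
  apply/measurable_EFinP; apply: measurable_funM; first exact: measurable_cst.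
  exact: measurable_indic.
elim: J hmu => [|J IH] hmu /=.
  under eq_integral do rewrite EFinD.
  rewrite ge0_integralD//=.
  rewrite iI// integral_cst// mul1e.
  apply: (@le_trans _ _ (2%:E + 2%:E * (2 * G * 2^-1 ^+ 0)%:E)%E).
    by apply: leeD => //; apply: lee_wpmul2l => //; exact: hmu.
  by rewrite -EFinM -EFinD lee_fin expr0; lra.
under eq_integral do rewrite EFinD.
rewrite ge0_integralD//=.
- rewrite iI ?exprn_ge0//.
  apply: (@le_trans _ _ ((2 + 4 * G * J.+1%:R)%:E +
      (2 ^+ J.+2)%:E * (2 * G * 2^-1 ^+ J.+1)%:E)%E).
    apply: leeD; first by apply: IH => j jJ; apply: hmu; exact: leqW.
    by apply: lee_wpmul2l; [rewrite lee_fin exprn_ge0|exact: hmu].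
  rewrite -EFinM -EFinD lee_fin -(natr1 J.+1) exprS exprVn.
  have p : 2 ^+ J.+1 != 0 :> R by rewrite expf_neq0.
  have -> : 2 * 2 ^+ J.+1 * (2 * G * (2 ^+ J.+1)^-1) = 4 * G by field.
  by lra.
- by move=> x _; rewrite lee_fin (le_trans ler01)// dyadic_majorant_ge1.
- by apply/measurable_EFinP; exact: dyadic_majorant_measurable.
Qed.

Lemma Rintegral_le_dyadic mu E J (G : R) (f : T -> R) : 1 <= G ->
  (mu setT <= 2%:E)%E ->
  (forall j, (j <= J)%N -> (mu (dyadic_itv E j) <= (2 * G * 2^-1 ^+ j)%:E)%E) ->
  measurable_fun setT f -> (forall x, `|f x| <= dyadic_majorant E J x) ->
  `|\int[mu]_x f x| <= 2 + 4 * G * J.+1%:R.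
Proof.
move=> G1 mu2 hmu mf fg.
have h := dyadic_majorant_integral G1 mu2 hmu.
have le1 : (\int[mu]_x `|(f x)%:E| <= (2 + 4 * G * J.+1%:R)%:E)%E.
  apply: le_trans h; apply: ge0_le_integral => //.
  - by apply: measurableT_comp => //; apply/measurable_EFinP.
  - by apply/measurable_EFinP; exact: dyadic_majorant_measurable.
  - by move=> x _ /=; rewrite lee_fin.
have int : mu.-integrable setT (EFin \o f).
  apply/integrableP; split; first exact/measurable_EFinP.
  by apply: le_lt_trans le1 _; rewrite ltry.
rewrite -lee_fin EFin_normr_Rintegral//.
by apply: le_trans le1; apply: le_abse_integral => //; exact/measurable_EFinP.
Qed.

Lemma borel_transform_le mu E J (G : R) : 1 <= G ->
  (mu setT <= 2%:E)%E ->
  (forall j, (j <= J)%N -> (mu (dyadic_itv E j) <= (2 * G * 2^-1 ^+ j)%:E)%E) ->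
  normc (borel_transform mu (E +i* (2^-1 ^+ J))) <= 12 * G * J.+1%:R.
Proof.
move=> G1 mu2 hmu; set e := 2^-1 ^+ J.
have e0 : 0 < e by rewrite exprn_gt0// invr_gt0.
have den x : 0 < (x - E) ^+ 2 + e ^+ 2 by rewrite ltr_wpDl ?sqr_ge0// exprn_gt0.
have md : measurable_fun setT (fun x : T => ((x - E) ^+ 2 + e ^+ 2)^-1 : R).
  have cf : continuous (fun x : R => ((x - E) ^+ 2 + e ^+ 2)^-1).
    move=> x.
    have h : (fun y : R => y - E) @ x --> x - E.
      by apply: cvgB; [exact: cvg_id|exact: cvg_cst].
    apply: cvgV; first by rewrite gt_eqF.
    by apply: cvgD; [exact: (cvgM h h)|exact: cvg_cst].
  exact: continuous_measurable_fun.
(* Covers both parts of the kernel: s = x - E for the real part and s = e for the imaginary part. *)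
have ker (x : R) (s : R) : `|s| <= Num.max `|x - E| e ->
    `|s / ((x - E) ^+ 2 + e ^+ 2)| <= dyadic_majorant E J x.
  move=> hs; set y := Num.max _ _ in hs.
  have y0 : 0 < y by rewrite /y lt_max e0 orbT.
  have h := cauchy_kernel_le (normr_ge0 _) (erefl y) (erefl `|x - E|).
  apply: le_trans h; rewrite normrM [ `|_^-1| ]gtr0_norm ?invr_gt0//.
  rewrite ler_pdivrMr// mulrC ler_pdivlMr//.
  have : y ^+ 2 <= (x - E) ^+ 2 + e ^+ 2.
    rewrite /y; have [_|_] := leP `|x - E| e; first by rewrite lerDr sqr_ge0.
    by rewrite real_normK ?num_real// lerDl sqr_ge0.
  have : `|s| * y <= y * y by rewrite ler_wpM2r// ltW.
  by rewrite expr2; lra.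
have re : `|\int[mu]_x complex.Re ((x%:C - (E +i* e))^-1)| <= 2 + 4 * G * J.+1%:R.
  apply: Rintegral_le_dyadic G1 mu2 hmu _ _ => [|x].
    under eq_fun do rewrite cauchy_kernelE/=.
    apply: measurable_funM => //; apply: measurable_funB => //.
  by rewrite cauchy_kernelE/= ker// le_max lexx.
have im : `|\int[mu]_x complex.Im ((x%:C - (E +i* e))^-1)| <= 2 + 4 * G * J.+1%:R.
  apply: Rintegral_le_dyadic G1 mu2 hmu _ _ => [|x].
    under eq_fun do rewrite cauchy_kernelE/=.
    by apply: measurable_funM.
  by rewrite cauchy_kernelE/= ker// le_max (gtr0_norm e0) lexx orbT.
rewrite /borel_transform /=.
set p := Rintegral _ _ _ in re *; set r := Rintegral _ _ _ in im *.
apply: (@le_trans _ _ (`|p| + `|r|)).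
  rewrite -[leRHS]ger0_norm ?addr_ge0// -sqrtr_sqr ler_sqrt ?sqr_ge0// sqrrD.
  rewrite !real_normK ?num_real//.
  by have := mulr_ge0 (normr_ge0 p) (normr_ge0 r); lra.
have J1 : 1 <= J.+1%:R :> R by rewrite ler1n.
have : 1 <= G * J.+1%:R by rewrite mulr_ege1.
by lra.
Qed.

End BorelTransform.

(** * Exceptional sets at one scale *)

Section Mesh.
Context {R : realType}.
Variables (r tau : R).
Hypothesis tau0 : 0 < tau.

Definition mesh (i : nat) : set (measurableTypeR R) :=
  [set` `[- r + i%:R * tau, - r + i.+1%:R * tau[].

Lemma mesh_disjoint i j : i != j -> mesh i `&` mesh j = set0.
Proof.
have tau_gt0 := tau0.
wlog ij : i j / (i < j)%N.
  move=> h; rewrite neq_ltn => /orP[ij|ij]; first by apply: h => //; rewrite ltn_eqF.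
  by rewrite setIC; apply: h => //; rewrite ltn_eqF.
move=> _; apply/seteqP; split=> // x []; rewrite /mesh/= !in_itv/= => /andP[_ h1] /andP[h2 _].
have : i.+1%:R * tau <= j%:R * tau by rewrite ler_wpM2r ?ler_nat// ltW.
by lra.
Qed.

Lemma mesh_cover (M : nat) x : 2 * r <= M%:R * tau -> - r < x < r ->
  exists i : 'I_M, mesh i x.
Proof.
have tau_gt0 := tau0.
move=> hM /andP[x1 x2]; set k := Num.truncn ((x + r) / tau).
have xr : 0 <= (x + r) / tau by rewrite divr_ge0 ?(ltW tau0)//; lra.
have /andP[k1 k2] := truncn_itv xr.
rewrite -/k ler_pdivlMr// in k1; rewrite -/k ltr_pdivrMr// in k2.
have kM : (k < M)%N.
  rewrite -(@ltr_nat R) -(ltr_pM2r tau0); lra.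
by exists (Ordinal kM); rewrite /mesh/= in_itv/=; apply/andP; split; lra.
Qed.

Lemma mesh_sub i l : mesh i l -> mesh i `<=` [set x : R | l - tau <= x <= l + tau].
Proof.
have tau_gt0 := tau0.
rewrite /mesh /= in_itv/= => /andP[l1 l2] x; rewrite /= in_itv/= => /andP[x1 x2].
by rewrite -natr1 mulrDl mul1r in l2 x2; apply/andP; split; lra.
Qed.

End Mesh.

Lemma measure_bigsetU_le (R : realType) (mu : {measure set (measurableTypeR R) -> \bar R})
    (I : Type) (s : seq I) (F : I -> set (measurableTypeR R)) :
  (forall i, measurable (F i)) ->
  (mu (\big[setU/set0]_(i <- s) F i) <= \sum_(i <- s) mu (F i))%E.
Proof.
move=> mF; elim: s => [|i s IH]; first by rewrite !big_nil measure0.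
rewrite !big_cons; apply: le_trans (measureU2 _ _ _) _ => //.
  exact: bigsetU_measurable.
by apply: leeD.
Qed.

Section OneScale.
Context {R : realType} {V : lmodType R} (ip : V -> V -> R).
Context (H : V -> V) (P : set (measurableTypeR R) -> V -> V).
Context (HP : resolution ip H P).
Variables (a v : int -> R) (e : int -> V).
Hypothesis He : jacobi_basis ip H a v e.
Notation N := (ipn ip).
Variables (mu : {measure set (measurableTypeR R) -> \bar R}) (r A : R).
Hypothesis Hmu : forall B, measurable B ->
  mu B = (N (P B (e 0)) ^+ 2 + N (P B (e 1)) ^+ 2)%:E.
Hypothesis Hr : forall u, P [set` `]- r, r[] u = u.
Hypothesis A1 : 1 <= A.
Hypothesis ha : forall n, 0 < a n <= A.
Hypothesis hv : forall n, `|v n| <= A.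

Let mu_le2 B : measurable B -> (mu B <= 2%:E)%E.
Proof.
move=> mB; rewrite Hmu// lee_fin.
have h m : N (P B (e m)) ^+ 2 <= 1.
  by rewrite expr_le1 ?ipn_ge0//; exact: (proj_basis_le1 HP He).
by have := h 0; have := h 1; lra.
Qed.

Let mu_window : mu (~` [set` `]- r, r[]) = 0%E.
Proof.
have mC : measurable (~` [set` `]- r, r[] : set (measurableTypeR R)).
  by apply: measurableC; exact: measurable_itv.
rewrite Hmu//.
have h u : P (~` [set` `]- r, r[]) u = 0.
  by rewrite -(Hr u) (rs_PI HP)// setICl (rs_P0 HP).
by rewrite !h (sn0 (ipn_seminorm (rs_ip HP))) expr0n addr0.
Qed.

(** The trace is not constant on a cell, so a cell is discarded as soon as it contains one bad
    energy; that energy then serves as the centre in [bad_measure]. Every energy outside the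
    discarded cells satisfies the bound on its own trace, as [good_energy] requires. *)
Lemma one_scale (k q J' : nat) (X d : R) :
  let eta := (2 * k.+1%:R ^+ 2)^-1 in
  let J := (2 ^ J').+1 in
  (0 < k)%N -> (0 < q)%N -> (k <= J)%N -> 0 < d -> d <= 1 ->
  (forall l : R, `|l| <= 6 * A ->
     forall j : int, `|j| <= J.+1%:Z -> block_ok q (7 * A) X l d a v (j * q%:Z)) ->
  2 * d * X * q%:R <= 1 ->
  480 * X ^+ 3 * q%:R * d * J%:R <= eta ->
  24 * X ^+ 3 * q%:R * d * (k + 3)%:R ^+ k * (2 * (k.+2 * q) + 1)%:R <= 1 / 2 ->
  exists U : set (measurableTypeR R), [/\ measurable U,
    (mu U <= (40 / k.+1%:R)%:E)%E &
    forall E, ~ U E -> normc (borel_transform mu (E +i* (2^-1 ^+ J'))) <=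
      12 * (18 * A ^+ 2 * X ^+ 4 / eta) ^+ 2 * J'.+1%:R].
Proof.
move=> eta J k0 q0 kJ d0 d1 ok dXq hJ hsmall.
have A_ge1 := A1.
have eta0 : 0 < eta by rewrite invr_gt0 mulr_gt0// exprn_gt0.
have k1 : 1 <= k.+1%:R :> R by rewrite ler1n.
have eta1 : eta <= 1.
  rewrite invf_le1 ?mulr_gt0 ?exprn_gt0//.
  have : 1 <= k.+1%:R ^+ 2 :> R by rewrite exprn_ege1.
  by lra.
pose D l := discriminant q l (shifted a 0) (shifted v 0).
have [M hM] : exists M : nat, 2 * r <= M%:R * d.
  exists (Num.truncn (2 * r / d)).+1; rewrite -ler_pdivrMr//; exact: ltW (truncnS_gt _).
(* The threshold 6 A leaves room for the half-width d <= 1 <= A in [proj_far]. Nearer energies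
   satisfy |v - l| <= 7 A, the bound K of the windows. *)
pose far (i : 'I_M) := `[< exists2 l : R, mesh r d i l & 6 * A <= `|l| >].
pose bad (i : 'I_M) :=
  `[< exists l : R, [/\ mesh r d i l, `|l| <= 6 * A & 2 - eta <= `|D l| ] >].
have mS i : measurable (mesh r d i) by exact: measurable_itv.
have farP i m : far i -> N (P (mesh r d i) (e m)) = 0.
  move=> /asboolP[l il hl]; apply: (proj_far HP He m (mS i) d0 _ _ hv _ (mesh_sub d0 il)).
  - exact: lt_le_trans ltr01 A1.
  - by move=> n; have /andP[/ltW-> ->] := ha n.
  - by lra.
have badP m : (m <= 1)%N ->
    \sum_(i < M | bad i) N (P (mesh r d i) (e m%:Z)) ^+ 2 <= 20 / k.+1%:R.
  move=> m1.
  have [/existsP[i0 /asboolP[l0 [_ l0A l0D]]]|/existsPn nob] := boolP [exists i, bad i]; last first.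
    by rewrite big1 ?divr_ge0// => i; rewrite (negbTE (nob i)).
  (* Cells that are not bad are emptied rather than removed, so that the index type stays ['I_M].
     Their centre defaults to the known bad energy [l0], which keeps the hypotheses on [lam] true
     for every index. *)
  pose S' i := if bad i then mesh r d i else set0.
  pose lam i := xget l0 [set l | [/\ mesh r d i l, `|l| <= 6 * A & 2 - eta <= `|D l| ]].
  have lamP i : `|lam i| <= 6 * A /\ 2 - eta <= `|D (lam i)|.
    by rewrite /lam; case: xgetP => [l _ []|].
  have lamS i : bad i -> mesh r d i (lam i).
    move=> /asboolP[l hl]; rewrite /lam; case: xgetP => [l' _ []//|/(_ l)].
    by move/(_ hl).
  have := @bad_measure _ _ _ _ _ HP a v e He 'I_M S' lam k q (7 * A) X d d m%:Z
     k0 q0 d0 (lexx d) dXq _ _ _ _ _ _.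
  move=> h.
  have {}h : (k.+1%:R / 2) ^+ 2 * (\sum_i N (P (S' i) (e m%:Z)) ^+ 2) <=
      2 * 2 + 2 * k.+1%:R + 4 *
      (24 * X ^+ 3 * q%:R * d * (k + 3)%:R ^+ k * (2 * (k.+2 * q) + 1)%:R) ^+ 2.
    apply: h.
    - by case: m m1 => [|[]].
    - by move=> i; rewrite /S'; case: (bad i).
    - move=> i j ij; rewrite /S'; case: (bad i); last by rewrite set0I.
      case: (bad j); last by rewrite setI0.
      exact: (mesh_disjoint _ d0 ij).
    - move=> i; rewrite /S'; have [bi|_] := boolP (bad i); last exact: sub0set.
      exact: mesh_sub (lamS i bi).
    - move=> i j jk; apply: ok; first by have [] := lamP i.
      by apply: le_trans jk _; rewrite lez_nat ltnS.
    - by move=> i; have [_] := lamP i.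
  have -> : \sum_(i < M | bad i) N (P (mesh r d i) (e m%:Z)) ^+ 2 =
      \sum_i N (P (S' i) (e m%:Z)) ^+ 2.
    rewrite big_mkcond/=; apply: eq_bigr => i _; rewrite /S'; case: ifP => // _.
    by rewrite (rs_P0 HP) (sn0 (ipn_seminorm (rs_ip HP))) expr0n.
  set Sg := \sum_i _ in h *.
  set sm := 24 * _ * _ * _ * _ * _ in hsmall h.
  have sm0 : 0 <= sm.
    have [win _ _] := ok l0 l0A 0 isT.
    have X0 : 0 <= X by exact: le_trans ler01 (window_X1 win).
    by rewrite /sm !mulr_ge0// ?exprn_ge0// ltW.
  have sm2 : sm ^+ 2 <= (1 / 2) ^+ 2 by exact: ler_expr_base.
  (* The right side of [h] is at most 4 + 2 (k + 1) + 1, and 5 <= 3 (k + 1) because k >= 1. *)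
  have h1 : (k.+1%:R / 2) ^+ 2 * Sg <= 5 * k.+1%:R.
    have k2 : 2 <= k.+1%:R :> R by rewrite ler_nat.
    by rewrite expr2 in sm2; lra.
  rewrite ler_pdivlMr//.
  rewrite -(@ler_pM2l _ (k.+1%:R / 4)); last by rewrite divr_gt0.
  have -> : k.+1%:R / 4 * (Sg * k.+1%:R) = (k.+1%:R / 2) ^+ 2 * Sg by field.
  by lra.
pose F (i : 'I_M) := if far i || bad i then mesh r d i else set0.
have mF i : measurable (F i) by rewrite /F; case: ifP.
exists (~` [set` `]- r, r[] `|` \big[setU/set0]_(i < M) F i); split.
- apply: measurableU; last by apply: bigsetU_measurable => i _; exact: mF.
  by apply: measurableC; exact: measurable_itv.
- apply: le_trans (measureU2 _ _ _) _.
  + by apply: measurableC; exact: measurable_itv.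
  + by apply: bigsetU_measurable => i _; exact: mF.
  rewrite [X in (X + _)%E](_ : _ = 0%E); last exact: mu_window.
  rewrite add0e; apply: le_trans (measure_bigsetU_le _ _ mF) _.
  apply: (@le_trans _ _ (\sum_(i < M) (if bad i then
     N (P (mesh r d i) (e 0)) ^+ 2 + N (P (mesh r d i) (e 1)) ^+ 2 else 0)%:E)%E).
    apply: lee_sum => i _; rewrite /F.
    have [fi|] := boolP (far i); rewrite /=.
      rewrite Hmu// !(farP i)// expr0n/= addr0 lee_fin.
      by case: ifP => // _; rewrite expr0n/= addr0.
    by case: ifP => _ _; [rewrite Hmu|rewrite measure0].
  rewrite sumEFin lee_fin -big_mkcond/= big_split/=.
  have h0 := badP 0%N isT; have h1 := badP 1%N isT.
  have -> : 40 / k.+1%:R = 20 / k.+1%:R + 20 / k.+1%:R :> R by rewrite -mulrDl; congr (_ / _); ring.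
  exact: lerD.
- move=> E nUE.
  have Er : - r < E < r.
    apply/negP => h; apply: nUE; left => /=; rewrite in_itv/=.
    by move=> h'; apply: h.
  have [i iE] := mesh_cover d0 hM Er.
  have nfb : ~~ (far i || bad i).
    apply/negP => fb; apply: nUE; right; rewrite (bigD1 i)//=; left.
    by rewrite /F fb.
  move: nfb; rewrite negb_or => /andP[/asboolPn nfar /asboolPn nbad].
  have E6 : `|E| <= 6 * A.
    by rewrite leNgt; apply/negP => h; apply: nfar; exists E => //; exact: ltW.
  have hD : `|D E| <= 2 - eta.
    by rewrite leNgt; apply/negP => h; apply: nbad; exists E; split => //; exact: ltW.
  have X1 : 1 <= X.
    by have [win _ _] := ok E E6 0 isT; exact: window_X1 win.
  pose G := (18 * A ^+ 2 * X ^+ 4 / eta) ^+ 2.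
  have G1 : 1 <= G.
    apply: exprn_ege1; rewrite ler_pdivlMr// mul1r.
    have A2 : 1 <= A ^+ 2 by rewrite exprn_ege1.
    have : 1 <= A ^+ 2 * X ^+ 4 by rewrite mulr_ege1// exprn_ege1.
    by lra.
  apply: borel_transform_le G1 _ _; first by apply: mu_le2.
  move=> j jJ.
  have mI : measurable (dyadic_itv E j) by exact: measurable_itv.
  have L0 : (0 < 2 ^ j)%N by rewrite expn_gt0.
  have invL : (2 ^ j)%:R^-1 = 2^-1 ^+ j :> R by rewrite natrX exprVn.
  have sI : dyadic_itv E j `<=`
      [set x : R | E - (2 ^ j)%:R^-1 <= x <= E + (2 ^ j)%:R^-1].
    by move=> x; rewrite /dyadic_itv /= in_itv/= invL.
  (* The extra 1 in J = 2^J' + 1 accommodates the last site m + L with m <= 1. *)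
  have LJ : ((2 ^ j).+1 <= J * q)%N.
    by apply: leq_trans (leq_pmulr _ q0); rewrite ltnS leq_exp2l.
  have ge m : (m <= 1)%N -> N (P (dyadic_itv E j) (e m%:Z)) ^+ 2 <= G * 2^-1 ^+ j.
    move=> m1; rewrite -invL.
    exact: (good_energy HP He q0 _ m1 L0 LJ eta0 eta1 A1 ha hD dXq hJ (ok E E6) mI sI).
  rewrite Hmu// lee_fin.
  by have := ge 0%N isT; have := ge 1%N isT; lra.
Qed.

End OneScale.

(** * Choice of the exponents *)

Section Exponents.
Context {R : realType}.
Variables (Lambda A delta beta gamma : R).

(* exp (growth_rate * q) bounds the transfer matrices over one period q (98 = 2 * 7 ^ 2
   with 7 * A the bound on the coefficients minus the energy), and the solutions are
   controlled up to the length 2 ^ levels q, roughly exp (length_rate * beta * q). *)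
Definition growth_rate : R := Lambda + ln (98 * A ^+ 2).
Definition length_rate : R := Num.min delta 1 / 4.
(** The bound on the transform carries X^8, and two factors exp(q) pay for J and for constants: the
    rate is 8 [growth_rate] + 2. It is doubled because 2^-m is compared with exp(-m/2). *)
Definition continuity_constant : R := (16 * growth_rate + 4) / length_rate.

Definition levels (q : nat) : nat := Num.truncn (length_rate * beta * q%:R).

Hypotheses (L0 : 0 < Lambda) (A1 : 1 <= A) (delta0 : 0 < delta).
Hypotheses (betaC : continuity_constant < beta)
  (gamma01 : 0 < gamma < 1) (gammaC : gamma < 1 - continuity_constant / beta).

Lemma growth_rate_gt0 : 0 < growth_rate.
Proof.
apply: ltr_wpDr => //; apply: ln_ge0.
have : 1 <= A ^+ 2 by rewrite exprn_ege1.
by lra.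
Qed.

Lemma length_rate_gt0 : 0 < length_rate.
Proof. by rewrite divr_gt0// lt_min delta0 ltr01. Qed.

Lemma length_rate_le : length_rate <= 1 / 4 /\ 4 * length_rate <= delta.
Proof.
rewrite /length_rate; split.
  by rewrite ler_pM2r ?invr_gt0// ge_min lexx orbT.
by rewrite mulrC divfK// ge_min lexx.
Qed.

Lemma continuity_constant_gt0 : 0 < continuity_constant.
Proof.
have h := growth_rate_gt0.
by rewrite divr_gt0 ?length_rate_gt0//; lra.
Qed.

Lemma beta_gt0 : 0 < beta.
Proof. exact: lt_trans continuity_constant_gt0 betaC. Qed.

Lemma length_beta_gt : 16 * growth_rate + 4 < length_rate * beta.
Proof. by rewrite [ltRHS]mulrC -ltr_pdivrMr ?length_rate_gt0. Qed.

Lemma gamma_gap : 16 * growth_rate + 4 < (1 - gamma) * (length_rate * beta).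
Proof.
have h : continuity_constant / beta < 1 - gamma by have := gammaC; lra.
rewrite ltr_pdivrMr ?beta_gt0// in h.
by rewrite [ltRHS]mulrCA [ltRHS]mulrC -ltr_pdivrMr ?length_rate_gt0.
Qed.

Lemma natr_le_expR (n : nat) : n%:R <= expR n%:R :> R.
Proof. by apply: le_trans (expR_ge1Dx _); rewrite lerDr. Qed.

Lemma expR_decay (c : R) (n : nat) : c <= n%:R -> c * expR (- n%:R) <= 1.
Proof.
move=> cn; rewrite expRN ler_pdivrMr ?expR_gt0// mul1r.
exact: le_trans cn (natr_le_expR n).
Qed.

Lemma levels_itv q : (levels q)%:R <= length_rate * beta * q%:R < (levels q).+1%:R.
Proof.
have h1 := ltW length_rate_gt0; have h2 := ltW beta_gt0.
by apply: truncn_itv; rewrite mulr_ge0// mulr_ge0.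
Qed.

Lemma expr2_levels q : 2 ^+ levels q <= expR (length_rate * beta * q%:R).
Proof.
have /andP[h _] := levels_itv q.
have e2 : 2 <= expR 1 :> R by apply: le_trans (expR_ge1Dx _); lra.
apply: (@le_trans _ _ (expR 1 ^+ levels q)); first exact: ler_expr_base.
by rewrite -expRM_natl mulr1 ler_expR.
Qed.

Lemma levels_ge q : (q < 2 ^ levels q)%N.
Proof.
have /andP[_ h] := levels_itv q.
have h1 := length_beta_gt; have h2 := growth_rate_gt0.
have : q%:R < (levels q).+1%:R :> R.
  apply: le_lt_trans h; rewrite -[leLHS]mul1r ler_wpM2r//; lra.
by rewrite ltr_nat ltnS => h3; apply: leq_ltn_trans h3 _; exact: ltn_expl.
Qed.

End Exponents.

(** Since k is fixed first, each requirement compares a constant with a power of exp(-q), whose rate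
    is positive by the lower bound on beta or on (1 - gamma) beta. *)
Lemma exponent_bounds (R : realType) (Lambda A delta beta gamma : R) (k : nat) :
  0 < Lambda -> 1 <= A -> 0 < delta ->
  continuity_constant Lambda A delta < beta -> 0 < gamma < 1 ->
  gamma < 1 - continuity_constant Lambda A delta / beta -> exists Q : nat, forall q : nat, (Q <= q)%N ->
  let eta := (2 * k.+1%:R ^+ 2)^-1 in
  let J := (2 ^ levels delta beta q).+1 in
  let X := expR (growth_rate Lambda A * q%:R) in
  let d := J.+1%:R * expR (- (beta * q%:R)) in
  [/\ [/\ (k <= J)%N, d <= 1 & 2 * d * X * q%:R <= 1],
      480 * X ^+ 3 * q%:R * d * J%:R <= eta,
      24 * X ^+ 3 * q%:R * d * (k + 3)%:R ^+ k * (2 * (k.+2 * q) + 1)%:R <= 1 / 2,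
      (J.+2 * q)%:R <= expR (delta * beta * q%:R) &
      12 * (18 * A ^+ 2 * X ^+ 4 / eta) ^+ 2 * (levels delta beta q).+1%:R *
        (2^-1 ^+ levels delta beta q) `^ (1 - gamma) <= 1].
Proof.
move=> L0 A1 delta0 betaC gamma01 gammaC.
pose eta : R := (2 * k.+1%:R ^+ 2)^-1.
have eta0 : 0 < eta by rewrite invr_gt0 mulr_gt0// exprn_gt0.
have eta1 : eta <= 1.
  rewrite invf_le1 ?mulr_gt0 ?exprn_gt0//.
  have : 1 <= k.+1%:R ^+ 2 :> R by rewrite exprn_ege1// ler1n.
  by lra.
(* With J + 1 <= 3 Z and J <= 2 Z, 2880 = 480 . 3 . 2. In [c2], 144 = 24 . 3 . 2 with the 2 from the
   target 1/2; in [c3], 24 = 12 . 2 with the 2 bounding exp(1/2). *)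
pose c1 : R := 2880 / eta.
pose c2 : R := 144 * (k + 3)%:R ^+ k * (2 * k.+2 + 1)%:R.
pose c3 : R := 24 * (18 * A ^+ 2 / eta) ^+ 2 * (length_rate delta * beta + 1).
pose Q := (k + 4 + Num.truncn c1 + Num.truncn c2 + Num.truncn c3)%N.
exists Q.+1 => q hq eta_ J X d; rewrite -/eta in eta_ *.
have g0 := growth_rate_gt0 L0 A1; have lb := length_beta_gt delta0 betaC.
have b0 := beta_gt0 L0 A1 delta0 betaC.
have [l1 l4] := length_rate_le delta; have lr0 := length_rate_gt0 delta0.
have trq (c : R) : (Num.truncn c <= Q)%N -> c <= q%:R.
  move=> h; apply: ltW; apply: lt_le_trans (truncnS_gt c) _.
  by rewrite ler_nat; apply: leq_trans hq; rewrite ltnS.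
have kq : (k + 4 <= q)%N.
  by apply: leq_trans (ltnW hq); do 2 apply: leq_trans (leq_addr _ _); exact: leq_addr.
have q1 : (1 <= q)%N by apply: leq_trans kq; rewrite addn4.
have qR : 1 <= q%:R :> R by rewrite ler1n.
have hc1 : c1 * expR (- q%:R) <= 1.
  by apply: expR_decay; apply: trq; rewrite /Q; do 2 apply: leq_trans (leq_addr _ _); exact: leq_addl.
have hc2 : c2 * expR (- q%:R) <= 1.
  by apply: expR_decay; apply: trq; rewrite /Q; apply: leq_trans (leq_addr _ _); exact: leq_addl.
have hc3 : c3 * expR (- q%:R) <= 1.
  by apply: expR_decay; apply: trq; rewrite /Q; exact: leq_addl.
set y : R := q%:R in trq qR hc1 hc2 hc3 X d *.
have qe : y <= expR y by exact: natr_le_expR.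
pose Z := expR (length_rate delta * beta * y).
have hZ : 2 ^+ levels delta beta q <= Z by exact: (expr2_levels L0 A1 delta0 betaC).
have y0 : 0 <= y by exact: le_trans ler01 qR.
have lbn : 0 <= length_rate delta * beta by move: lb g0; clear; lra.
have Z1 : 1 <= Z.
  by rewrite -expR0 ler_expR mulr_ge0.
have J2 : J%:R <= 2 * Z by rewrite /J -natr1 natrX; move: hZ Z1; clear; lra.
have J3 : J.+1%:R <= 3 * Z by rewrite -natr1; move: J2 Z1; clear; lra.
pose theta := expR (- (beta * y)).
have t0 : 0 < theta by exact: expR_gt0.
have X1 : 1 <= X by rewrite -expR0 ler_expR mulr_ge0// ltW.
have d0 : 0 <= d by rewrite mulr_ge0// ltW.
have d3 : d <= 3 * Z * theta by rewrite ler_wpM2r// ltW.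
have X3 : X ^+ 3 = expR (3 * growth_rate Lambda A * y) by rewrite -expRM_natl; congr expR; ring.
have Zge0 : 0 <= Z by exact: le_trans ler01 Z1.
have Xge0 : 0 <= X ^+ 3 by rewrite exprn_ge0//; exact: le_trans ler01 X1.
have Xy0 : 0 <= X ^+ 3 * y by rewrite mulr_ge0// ltW.
have Xye : X ^+ 3 * y <= X ^+ 3 * expR y by rewrite ler_wpM2l.
have Zt0 : 0 <= Z * theta by rewrite mulr_ge0// ltW.
(* The length Z enters twice, through d and through J. As [length_rate] is at most 1/4, this uses at
   most half of beta, and the other half outweighs X^3 and the factors exp(y). *)
have rate : (3 * growth_rate Lambda A + 2 + 2 * (length_rate delta * beta) - beta) * y <= - 1 * y.
  rewrite ler_wpM2r//.
  have h1 : length_rate delta * beta <= 1 / 4 * beta by rewrite ler_wpM2r// ltW.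
  by move: h1 lb g0; clear; lra.
have XZ : X ^+ 3 * expR y * (Z * theta) * Z <= expR (- y).
  by rewrite X3 -!expRD ler_expR; move: rate y0; clear; lra.
have XZ2 : X ^+ 3 * expR y * (Z * theta) * expR y <= expR (- y).
  rewrite X3 -!expRD ler_expR.
  have h2 : 0 <= length_rate delta * beta * y by rewrite mulr_ge0.
  by move: rate h2; clear; lra.
have i1 : 480 * X ^+ 3 * y * d * J%:R <= eta.
  have h1 : X ^+ 3 * y * d <= X ^+ 3 * expR y * (3 * Z * theta).
    by apply: ler_pM.
  have h2 : X ^+ 3 * y * d * J%:R <= X ^+ 3 * expR y * (3 * Z * theta) * (2 * Z).
    by apply: ler_pM => //; rewrite mulr_ge0.
  have h3 : c1 * expR (- y) * eta <= 1 * eta by rewrite ler_wpM2r// ltW.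
  have e1 : c1 * expR (- y) * eta = 2880 * expR (- y).
    by rewrite /c1; field; rewrite gt_eqF.
  by rewrite e1 in h3; move: h2 h3 XZ; clear; lra.
have J1 : 1 <= J%:R :> R by rewrite ler1n.
have X13 : X <= X ^+ 3 by rewrite -[leLHS]expr1; apply: ler_weXn2l.
have i3 : 2 * d * X * y <= 1.
  have dy0 : 0 <= d * y by rewrite mulr_ge0.
  have h1 : d * y * X <= d * y * X ^+ 3 by rewrite ler_wpM2l.
  have h2 : d * y * X ^+ 3 * 1 <= d * y * X ^+ 3 * J%:R.
    by rewrite ler_wpM2l//; exact: mulr_ge0.
  have h3 : 0 <= d * y * X ^+ 3 * J%:R by rewrite mulr_ge0//; exact: mulr_ge0.
  by move: h1 h2 h3 i1 eta1; clear; lra.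
have i4 : d <= 1.
  have h1 : d * 1 <= d * (X * y) by rewrite ler_wpM2l// mulr_ege1.
  have h2 : 0 <= d * (X * y).
    by rewrite mulr_ge0// mulr_ge0//; exact: le_trans ler01 X1.
  by move: h1 h2 i3; clear; lra.
have qJ : (q < 2 ^ levels delta beta q)%N by exact: (levels_ge L0 A1 delta0 betaC).
have kJ : (k <= J)%N.
  apply: leqW; apply: leq_trans (ltnW qJ).
  by apply: leq_trans kq; rewrite leq_addr.
split.
- by split.
- exact: i1.
- have h1 : X ^+ 3 * y * d <= X ^+ 3 * expR y * (3 * Z * theta) by apply: ler_pM.
  have kk0 : 0 <= (k + 3)%:R ^+ k :> R by rewrite exprn_ge0.
  have h4 : (2 * (k.+2 * q) + 1)%:R <= (2 * k.+2 + 1)%:R * expR y.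
    apply: (@le_trans _ _ ((2 * k.+2 + 1)%:R * y)); last by rewrite ler_wpM2l.
    by rewrite /y -natrM ler_nat mulnDl mul1n mulnA leq_add2l.
  have h5 : X ^+ 3 * y * d * (2 * (k.+2 * q) + 1)%:R <=
     X ^+ 3 * expR y * (3 * Z * theta) * ((2 * k.+2 + 1)%:R * expR y).
    by apply: ler_pM => //; rewrite mulr_ge0.
  have h6 := ler_wpM2l kk0 h5.
  have kn0 : 0 <= (k + 3)%:R ^+ k * (2 * k.+2 + 1)%:R :> R by rewrite mulr_ge0.
  have h7 := ler_wpM2l kn0 XZ2.
  by rewrite /c2 in hc2; move: h6 h7 hc2; clear; lra.
- have h1 : 4 * (Z * y) <= expR (delta * beta * y).
    have h2 : Z * (4 * y) <= Z * (expR y * expR y).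
      rewrite ler_wpM2l//; apply: ler_pM => //.
      apply: le_trans qe; rewrite /y ler_nat; apply: leq_trans kq.
      by rewrite leq_addl.
    have h3 : Z * (expR y * expR y) <= expR (delta * beta * y).
      rewrite -!expRD ler_expR.
      have h4 : (4 * (length_rate delta * beta)) * y <= delta * beta * y.
        by rewrite ler_wpM2r// mulrA ler_wpM2r// ltW.
      have h5 : 4 * y <= length_rate delta * beta * y.
        by rewrite ler_wpM2r//; move: lb g0; clear; lra.
      by move: h4 h5 y0; clear; lra.
    by move: h2 h3; clear; lra.
  apply: le_trans h1; rewrite natrM -/y mulrA ler_wpM2r//.
  by rewrite -(natr1 J.+1); move: J3 Z1; clear; lra.
- set m := levels delta beta q.
  have g1 : 0 < 1 - gamma <= 1.
    by move: gamma01; clear => /andP[? ?]; apply/andP; split; lra.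
  have /andP[g1p g1l] := g1.
  have /andP[m1 m2] := levels_itv L0 A1 delta0 betaC q; rewrite -/m -/y in m1 m2.
  (* From 1 + x <= exp(x) at x = -1/2; this crude substitute for ln 2 is the source of the doubling
     in [continuity_constant]. *)
  have half : 2^-1 <= expR (- 2^-1 : R).
    by apply: le_trans (expR_ge1Dx _); clear; lra.
  have eps : 2^-1 ^+ m <= expR (- (m%:R / 2)) :> R.
    apply: (@le_trans _ _ (expR (- 2^-1) ^+ m)); first by apply: ler_expr_base.
    by rewrite -expRM_natl ler_expR; clear; lra.
  have peps : (2^-1 ^+ m) `^ (1 - gamma) <= expR (- (m%:R / 2) * (1 - gamma)).
    rewrite expRM; apply: (ge0_ler_powR (ltW g1p)) => //; rewrite nnegrE.
      by rewrite exprn_ge0// invr_ge0.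
    exact: ltW (expR_gt0 _).
  have gap := gamma_gap L0 A1 delta0 betaC gammaC.
  have hm : - (m%:R / 2) * (1 - gamma) <= 1 / 2 - (8 * growth_rate Lambda A + 2) * y.
    have k1 : (1 - gamma) * (length_rate delta * beta * y) <= (1 - gamma) * (m%:R + 1).
      by rewrite ler_wpM2l ?(ltW g1p)// natr1 ltW.
    have k2 : (16 * growth_rate Lambda A + 4) * y <= (1 - gamma) * (length_rate delta * beta) * y.
      by rewrite ler_wpM2r// ltW.
    by move: k1 k2 g1l; clear; lra.
  have half2 : expR (1 / 2 : R) <= 2.
    have -> : (1 / 2 : R) = - - 2^-1 by rewrite opprK mul1r.
    rewrite expRN -[leRHS]invrK lef_pV2 ?posrE ?expR_gt0 ?invr_gt0//.
  (* The first exponential cancels X^8; of the two copies of exp(-y), one pays for m + 1 and the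
     other for the constant [c3]. *)
  have p1 : (2^-1 ^+ m) `^ (1 - gamma) <=
      2 * (expR (- (8 * growth_rate Lambda A * y)) * (expR (- y) * expR (- y))).
    apply: le_trans peps _.
    apply: (@le_trans _ _ (expR (1 / 2 - (8 * growth_rate Lambda A + 2) * y))).
      by rewrite ler_expR.
    have -> : 1 / 2 - (8 * growth_rate Lambda A + 2) * y =
      1 / 2 + (- (8 * growth_rate Lambda A * y) + (- y + - y)) by ring.
    by rewrite !expRD ler_wpM2r// !mulr_ge0// ltW// expR_gt0.
  have m3 : m.+1%:R <= (length_rate delta * beta + 1) * expR y.
    apply: (@le_trans _ _ ((length_rate delta * beta + 1) * y)).
      by rewrite -natr1; move: m1 qR; clear; lra.
    by rewrite ler_wpM2l//; move: lbn; clear; lra.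
  have X8 : (X ^+ 4) ^+ 2 = expR (8 * growth_rate Lambda A * y).
    by rewrite -exprM -expRM_natl; congr expR; ring.
  have E : 12 * (18 * A ^+ 2 * X ^+ 4 / eta) ^+ 2 =
      12 * (18 * A ^+ 2 / eta) ^+ 2 * expR (8 * growth_rate Lambda A * y).
    by rewrite -X8; ring.
  rewrite E.
  set B := 12 * (18 * A ^+ 2 / eta) ^+ 2.
  have B0 : 0 <= B by rewrite mulr_ge0// sqr_ge0.
  have e8 : expR (8 * growth_rate Lambda A * y) * expR (- (8 * growth_rate Lambda A * y)) = 1.
    by rewrite -expRD addrN expR0.
  have e1 : expR y * expR (- y) = 1 by rewrite -expRD addrN expR0.
  apply: (@le_trans _ _ (B * expR (8 * growth_rate Lambda A * y) *
     ((length_rate delta * beta + 1) * expR y) *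
     (2 * (expR (- (8 * growth_rate Lambda A * y)) * (expR (- y) * expR (- y)))))).
    apply: ler_pM => //.
    - by apply: mulr_ge0 => //; apply: mulr_ge0 => //; exact: expR_ge0.
    - by apply: ler_wpM2l => //; apply: mulr_ge0 => //; exact: expR_ge0.
  have -> : B * expR (8 * growth_rate Lambda A * y) * ((length_rate delta * beta + 1) * expR y) *
      (2 * (expR (- (8 * growth_rate Lambda A * y)) * (expR (- y) * expR (- y)))) =
      2 * B * (length_rate delta * beta + 1) *
      (expR (8 * growth_rate Lambda A * y) * expR (- (8 * growth_rate Lambda A * y))) *
      (expR y * expR (- y)) * expR (- y) by ring.
  rewrite e8 e1 !mulr1; apply: le_trans hc3; rewrite /c3 /B.
  by rewrite le_eqVlt; apply/orP; left; apply/eqP; ring.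
Qed.

(** * Almost everywhere spectral continuity *)

Lemma limf_einf_lt_pinfty (R : realType) (f : R -> \bar R) (c : R) :
  (forall k : nat, exists x : R, [/\ 0 < x, x <= k.+1%:R^-1 & (f x <= c%:E)%E]) ->
  (limf_einf f (0 : R)^'+ < +oo)%E.
Proof.
move=> hf; rewrite limf_einfE; apply: (@le_lt_trans _ _ c%:E); last exact: ltry.
apply: ge_ereal_sup => _ [W W0 <-].
have [d /= d0 hd] := W0.
have [x [x0 xk fx]] := hf (Num.truncn d^-1).
apply: ge_ereal_inf; exists (f x) => //; exists x => //; apply: hd => //=.
rewrite sub0r normrN gtr0_norm//; apply: le_lt_trans xk _.
by rewrite -[ltRHS]invrK ltf_pV2 ?posrE ?invr_gt0// truncnS_gt.
Qed.

Lemma natr_inv_le (R : realType) (k n : nat) : (0 < k)%N -> (k <= n)%N ->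
  n%:R^-1 <= k%:R^-1 :> R.
Proof.
by move=> k0 kn; rewrite lef_pV2 ?posrE ?ltr0n ?ler_nat// (leq_trans k0).
Qed.

(* A point outside U_k for infinitely many k escapes the liminf of the U_k, which is
   null because mu U_k tends to 0. *)
Lemma ae_not_eventually (R : realType)
    (mu : {measure set (measurableTypeR R) -> \bar R})
    (U : nat -> set (measurableTypeR R)) (c : R) (Pr : measurableTypeR R -> Prop) :
  (forall k, measurable (U k)) -> (forall k, (mu (U k) <= (c / k.+1%:R)%:E)%E) ->
  (forall E, (forall K : nat, exists2 k, (K <= k)%N & ~ U k E) -> Pr E) ->
  {ae mu, forall E, Pr E}.
Proof.
move=> mU hU hP.
have neg : mu.-negligible (\bigcup_K \bigcap_(k in [set k | (K <= k)%N]) U k).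
  apply: negligible_bigcup => K; set B := (B in mu.-negligible B).
  have mB : measurable B by exact: bigcap_measurableType.
  suff : (mu B <= 0)%E.
    by move=> B0; apply/negligibleP => //; apply/eqP; rewrite eq_le measure_ge0 andbT.
  have hB k : (K <= k)%N -> (mu B <= (c / k.+1%:R)%:E)%E.
    move=> Kk; apply: le_trans (hU k); apply: le_measure; rewrite ?inE//.
    by move=> x; apply.
  have fin : mu B \is a fin_num.
    by rewrite ge0_fin_numE//; apply: le_lt_trans (hB K (leqnn K)) _; rewrite ltry.
  rewrite -(fineK fin); set x := fine _.
  suff : x <= 0 by rewrite -lee_fin.
  have {}hB k : (K <= k)%N -> x <= c / k.+1%:R.
    by move=> Kk; rewrite -lee_fin /x fineK// hB.
  apply/ler_addgt0Pr => eps eps0; rewrite add0r.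
  pose k := (K + Num.truncn (c / eps))%N.
  apply: le_trans (hB k (leq_addr _ _)) _.
  rewrite ler_pdivrMr// mulrC -ler_pdivrMr//.
  apply: ltW; apply: lt_le_trans (truncnS_gt _) _.
  by rewrite ler_nat ltnS leq_addl.
apply: negligibleS neg => E /= nP.
apply: contrapT => nU; apply: nP; apply: hP => K.
apply: contrapT => h; apply: nU; exists K => // k /= Kk.
by apply: contrapT => nUk; apply: h; exists k.
Qed.

Lemma block_next (q J : nat) (j : int) : (0 < q)%N -> `|j| <= J%:Z ->
  `|j * q%:Z + 1| <= (J.+1 * q)%N%:Z.
Proof. by nia. Qed.

Section Continuity.
Context {R : realType} {V : lmodType R} (ip : V -> V -> R).
Context (H : V -> V) (P : set (measurableTypeR R) -> V -> V).
Context (HP : resolution ip H P).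
Variables (a v : int -> R) (e : int -> V).
Hypothesis He : jacobi_basis ip H a v e.
Notation N := (ipn ip).
Variables (mu : {measure set (measurableTypeR R) -> \bar R}).
Hypothesis Hmu : forall B, measurable B ->
  mu B = (N (P B (e 0)) ^+ 2 + N (P B (e 1)) ^+ 2)%:E.
Variables (A Lambda beta delta gamma : R).
Hypothesis A1 : 1 <= A.
Hypothesis ha : forall n, 0 < a n <= A.
Hypothesis hv : forall n, `|v n| <= A.

Lemma blocks_ok (q J : nat) (l : R) (j : int) :
  (0 < q)%N -> 0 < Lambda ->
  (J.+2 * q)%:R <= expR (delta * beta * q%:R) ->
  almost_period q (expR (- (beta * q%:R))) (expR (delta * beta * q%:R)) a ->
  almost_period q (expR (- (beta * q%:R))) (expR (delta * beta * q%:R)) v ->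
  (forall m : int, `|m|%:~R <= expR (delta * beta * q%:R) ->
     expR (- (Lambda * q%:R)) < \prod_(i < q) a (m + i%:Z)) ->
  `|l| <= 6 * A -> `|j| <= J.+1%:Z ->
  block_ok q (7 * A) (expR (growth_rate Lambda A * q%:R)) l
    (J.+1%:R * expR (- (beta * q%:R))) a v (j * q%:Z).
Proof.
move=> q0 L0 hr pa pv hprod lA jJ.
have A_ge1 := A1.
have t0 : 0 <= expR (- (beta * q%:R)) by exact: expR_ge0.
split; last 2 first.
- by move=> k kq; exact: (almost_period_iter pa t0 hr jJ kq).
- by move=> k kq; exact: (almost_period_iter pv t0 hr jJ kq).
split.
- by lra.
- move=> n _; rewrite /shifted; have /andP[-> h] := ha (j * q%:Z + n%:Z) => /=.
  by lra.
- move=> n _; rewrite /shifted; apply: le_trans (ler_normB _ _) _.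
  by have := hv (j * q%:Z + n.+1%:Z); lra.
(* The product hypothesis is used one site later, at j q + 1, because the window multiplies the
   weights with indices 1 to q. This extra site and |j| <= J + 1 fit in the radius (J + 2) q. *)
have jr : `|j * q%:Z + 1|%:~R <= expR (delta * beta * q%:R).
  apply: le_trans hr; rewrite pmulrn ler_int.
  exact: block_next.
have := hprod _ jr.
have -> : \prod_(i < q) a (j * q%:Z + 1 + i%:Z) =
    \prod_(i < q) shifted a (j * q%:Z) i.+1.
  by apply: eq_bigr => i _; rewrite /shifted intS addrA.
set p := \prod_(i < q) _ => hp.
have A98 : 0 < 98 * A ^+ 2 by rewrite mulr_gt0// exprn_gt0//; lra.
have -> : 2 * (7 * A) ^+ 2 = 98 * A ^+ 2 by ring.
apply: (@le_trans _ _ (expR (growth_rate Lambda A * q%:R) * expR (- (Lambda * q%:R)))).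
  rewrite -expRD /growth_rate.
  have -> : (Lambda + ln (98 * A ^+ 2)) * q%:R - Lambda * q%:R =
     ln (98 * A ^+ 2) * q%:R by ring.
  by rewrite expRM_natr lnK// posrE.
by rewrite ler_wpM2l ?expR_ge0// ltW.
Qed.

(** For each k a single sufficiently long period is used. It yields an exceptional set of measure at
    most 40 / (k + 1) and one scale e <= 1 / (k + 1) at which the transform is controlled off that
    set. *)
Lemma ae_spectral_continuous (q : nat -> nat) :
  0 < Lambda -> 0 < delta -> continuity_constant Lambda A delta < beta ->
  0 < gamma < 1 -> gamma < 1 - continuity_constant Lambda A delta / beta ->
  (forall k, (0 < q k)%N) -> q @ \oo --> \oo ->
  (forall k, almost_period (q k) (expR (- (beta * (q k)%:R)))
      (expR (delta * beta * (q k)%:R)) a) ->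
  (forall k, almost_period (q k) (expR (- (beta * (q k)%:R)))
      (expR (delta * beta * (q k)%:R)) v) ->
  (forall k (m : int), `|m|%:~R <= expR (delta * beta * (q k)%:R) ->
     expR (- (Lambda * (q k)%:R)) < \prod_(i < q k) a (m + i%:Z)) ->
  spectral_continuous mu gamma.
Proof.
move=> L0 delta0 betaC gamma01 gammaC q0 qoo pa pv hprod.
have [r hr] := rs_window HP.
have step (k : nat) : exists Ue : set (measurableTypeR R) * R,
    [/\ measurable Ue.1, (mu Ue.1 <= (40 / k.+1%:R)%:E)%E, 0 < Ue.2 <= k.+1%:R^-1 &
    forall E, ~ Ue.1 E ->
      Ue.2 `^ (1 - gamma) * normc (borel_transform mu (E +i* Ue.2)) <= 1].
  (* The shift to k + 1 provides the positive Chebyshev degree that [one_scale] requires. *)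
  have [Q hQ] := exponent_bounds k.+1 L0 A1 delta0 betaC gamma01 gammaC.
  have /cvgnyPge/(_ (Q + k.+1)%N) [n _ hn] := qoo.
  have := hn n (leqnn n) => /=; set p := q n => pQ.
  have [[kJ d1 dXq] h480 h24 hrange hfin] :=
    hQ p (leq_trans (leq_addr _ _) pQ).
  have d0 : 0 < (2 ^ levels delta beta p).+2%:R * expR (- (beta * p%:R)) :> R.
    by rewrite mulr_gt0// expR_gt0.
  have ok l : `|l| <= 6 * A -> forall j : int, `|j| <= (2 ^ levels delta beta p).+2%:Z ->
      block_ok p (7 * A) (expR (growth_rate Lambda A * p%:R)) l
       ((2 ^ levels delta beta p).+2%:R * expR (- (beta * p%:R))) a v (j * p%:Z).
    move=> lA j jJ.
    exact: (blocks_ok (q0 n) L0 hrange (pa n) (pv n) (hprod n) lA jJ).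
  have [U [mU muU hU]] := one_scale HP He Hmu hr A1 ha hv (ltn0Sn k) (q0 n) kJ d0 d1
     ok dXq h480 h24.
  exists (U, 2^-1 ^+ levels delta beta p); split => //=.
  - apply: le_trans muU _; rewrite lee_fin ler_wpM2l//.
    by apply: natr_inv_le.
  - rewrite exprn_gt0 ?invr_gt0//= exprVn -natrX; apply: natr_inv_le => //.
    apply: leq_trans (ltnW (levels_ge L0 A1 delta0 betaC p)).
    by apply: leq_trans pQ; rewrite leq_addl.
  - move=> E nUE; rewrite mulrC; apply: le_trans hfin.
    by rewrite ler_wpM2r ?powR_ge0// hU.
have [f hf] := choice step.
apply: (@ae_not_eventually _ _ (fun k => (f k).1) 40).
- by move=> k; have [] := hf k.
- by move=> k; have [] := hf k.
move=> E hE; apply: (@limf_einf_lt_pinfty _ _ 1) => K.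
have [k Kk nU] := hE K.
have [_ _ /andP[e0 ek] h] := hf k.
exists (f k).2; split => //; last by rewrite lee_fin h.
by apply: le_trans ek _; exact: natr_inv_le.
Qed.

End Continuity.

(** * Square-summable sequences *)

Section IntSums.
Context {R : realType}.
Implicit Types (f g : int -> R).

Definition nnsum f : \bar R := \esum_(n in [set: int]) (f n)%:E.
Definition abs_summable f := (nnsum (fun n => `|f n|%R) < +oo)%E.

Lemma nnsum_ge0 f : (forall n, 0 <= f n) -> (0 <= nnsum f)%E.
Proof. by move=> f0; apply: esum_ge0 => n _; rewrite lee_fin. Qed.

Lemma le_nnsum f g : (forall n, f n <= g n) -> (nnsum f <= nnsum g)%E.
Proof. by move=> fg; apply: le_esum => n _; rewrite lee_fin. Qed.

Lemma nnsumD f g : (forall n, 0 <= f n) -> (forall n, 0 <= g n) ->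
  nnsum (fun n => f n + g n) = (nnsum f + nnsum g)%E.
Proof.
by move=> f0 g0; rewrite /nnsum -esumD// => n _; rewrite lee_fin.
Qed.

(** One inequality holds on finite partial sums; the other is the same inequality for the factor
    1/c. *)
Lemma nnsumZ c f : 0 <= c -> (forall n, 0 <= f n) ->
  nnsum (fun n => c * f n) = (c%:E * nnsum f)%E.
Proof.
move=> c0 f0.
have le k g : 0 <= k -> (forall n, 0 <= g n) ->
    (nnsum (fun n => k * g n)%R <= k%:E * nnsum g)%E.
  move=> k0 g0; apply: ge_ereal_sup => _ [F [Ff _] <-].
  under eq_fsbigr do rewrite EFinM.
  rewrite -ge0_mule_fsumr//.
  have k0' : (0 <= k%:E)%E by rewrite lee_fin.
  by apply: (lee_wpmul2l k0'); apply: ereal_sup_ubound; exists F.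
apply/eqP; rewrite eq_le le//=.
have [->|cn0] := eqVneq c 0.
  by rewrite mul0e nnsum_ge0// => n; rewrite mul0r.
have c1 : 0 < c by rewrite lt_neqAle eq_sym cn0.
have : (nnsum (fun n => c^-1 * (c * f n))%R <= c^-1%:E * nnsum (fun n => c * f n)%R)%E.
  by apply: le => [|n]; [rewrite invr_ge0|rewrite mulr_ge0].
have -> : (fun n => c^-1 * (c * f n)) = f by apply/funext => n; rewrite mulKf.
move=> h; have := @lee_wpmul2l _ c%:E _ _ _ h.
rewrite lee_fin => /(_ c0).
by rewrite muleA -EFinM divff// mul1e.
Qed.

Lemma abs_summable_le f g : abs_summable g -> (forall n, `|f n| <= `|g n|) -> abs_summable f.
Proof. by move=> hg fg; apply: le_lt_trans hg; apply: le_nnsum. Qed.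

Lemma abs_summableD f g : abs_summable f -> abs_summable g ->
  abs_summable (fun n => f n + g n).
Proof.
move=> hf hg; apply: (@le_lt_trans _ _ (nnsum (fun n => `|f n| + `|g n|)%R)).
  by apply: le_nnsum => n; exact: ler_normD.
by rewrite nnsumD// lte_add_pinfty.
Qed.

Lemma abs_summableZ c f : abs_summable f -> abs_summable (fun n => c * f n).
Proof.
move=> hf; rewrite /abs_summable.
under eq_fun do rewrite normrM.
by rewrite nnsumZ// lte_mul_pinfty// lee_fin.
Qed.

Lemma nnsum_fin f : (forall n, 0 <= f n) -> abs_summable f -> nnsum f \is a fin_num.
Proof.
move=> f0 hf; rewrite ge0_fin_numE ?nnsum_ge0//.
by apply: le_lt_trans hf; apply: le_nnsum => n; rewrite ger0_norm.
Qed.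

(** The value does not depend on which difference of summable nonnegative families represents f.
    Additivity and homogeneity follow, since positive parts themselves are not additive. *)
Lemma zsum_diff f g h : (forall n, 0 <= g n) -> (forall n, 0 <= h n) ->
  abs_summable g -> abs_summable h -> (forall n, f n = g n - h n) ->
  zsum f = fine (nnsum g) - fine (nnsum h).
Proof.
move=> g0 h0 sg sh fE.
pose fp n := Num.max (f n) 0; pose fm n := Num.max (- f n) 0.
have fp0 n : 0 <= fp n by rewrite le_max lexx orbT.
have fm0 n : 0 <= fm n by rewrite le_max lexx orbT.
have sfp : abs_summable fp.
  apply: abs_summable_le sg _ => n; rewrite !ger0_norm// /fp ge_max g0 andbT.
  by rewrite fE; have := h0 n; lra.
have sfm : abs_summable fm.
  apply: abs_summable_le sh _ => n; rewrite !ger0_norm// /fm ge_max h0 andbT.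
  by rewrite fE; have := g0 n; lra.
have e : (nnsum fp + nnsum h = nnsum fm + nnsum g)%E.
  rewrite -!nnsumD//; congr nnsum; apply/funext => n.
  by rewrite /fp /fm fE; case: (leP (g n - h n) 0); case: (leP (- (g n - h n)) 0); lra.
rewrite /zsum -/(nnsum fp) -/(nnsum fm).
have := congr1 fine e; rewrite !fineD ?nnsum_fin//.
by lra.
Qed.

Lemma abs_summable_pos f : abs_summable f -> abs_summable (fun n => Num.max (f n) 0).
Proof.
move=> hf; apply: abs_summable_le hf _ => n.
by case: (leP (f n) 0) => // h; rewrite normr0.
Qed.

Lemma abs_summable_neg f : abs_summable f -> abs_summable (fun n => Num.max (- f n) 0).
Proof.
move=> hf; apply: abs_summable_le hf _ => n.
by case: (leP (- f n) 0) => // h; rewrite ?normr0// normrN.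
Qed.

Let maxr_ge0 (x : R) : 0 <= Num.max x 0.
Proof. by rewrite le_max lexx orbT. Qed.

Let max_ge0 f n : 0 <= Num.max (f n) 0.
Proof. exact: maxr_ge0. Qed.

Let max_sub (x : R) : x = Num.max x 0 - Num.max (- x) 0.
Proof. by case: (leP x 0); case: (leP (- x) 0); lra. Qed.

Lemma zsumD f g : abs_summable f -> abs_summable g ->
  zsum (fun n => f n + g n) = zsum f + zsum g.
Proof.
move=> hf hg.
have sp := abs_summable_pos hf; have sm := abs_summable_neg hf.
have tp := abs_summable_pos hg; have tm := abs_summable_neg hg.
rewrite (@zsum_diff _ (fun n => Num.max (f n) 0 + Num.max (g n) 0)
  (fun n => Num.max (- f n) 0 + Num.max (- g n) 0)).
- rewrite (nnsumD (max_ge0 f) (max_ge0 g)).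
  rewrite (nnsumD (max_ge0 (fun n => - f n)) (max_ge0 (fun n => - g n))).
  have fin h : abs_summable (fun n => Num.max (h n) 0) ->
      nnsum (fun n => Num.max (h n) 0) \is a fin_num by exact: nnsum_fin (max_ge0 h).
  rewrite !fineD ?fin//; try exact: fin.
  by rewrite /zsum -!/(nnsum _) opprD addrACA.
- by move=> n; rewrite addr_ge0 ?maxr_ge0.
- by move=> n; rewrite addr_ge0 ?maxr_ge0.
- exact: abs_summableD.
- exact: abs_summableD.
- by move=> n; rewrite {1}(max_sub (f n)) {1}(max_sub (g n)); lra.
Qed.

Lemma zsumN f : zsum (fun n => - f n) = - zsum f.
Proof. by rewrite /zsum opprB; under [in X in _ - X]eq_fun do rewrite opprK. Qed.

Lemma zsum_nneg f : (forall n, 0 <= f n) -> zsum f = fine (nnsum f).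
Proof.
move=> f0; rewrite /zsum [X in _ - fine X]esum1 ?subr0.
  congr (fine _); apply: eq_esum => n _; congr (_%:E).
  by apply/max_idPl.
move=> n _; congr (_%:E); apply/max_idPr.
by rewrite oppr_le0.
Qed.

Lemma zsumZ c f : abs_summable f -> zsum (fun n => c * f n) = c * zsum f.
Proof.
wlog c0 : c f / 0 <= c.
  move=> h hf; have [c0|c0] := leP 0 c; first exact: h.
  have -> : (fun n => c * f n) = (fun n => - (- c * f n)).
    by apply/funext => n; rewrite mulNr opprK.
  by rewrite zsumN h ?oppr_ge0 ?(ltW c0)// mulNr opprK.
move=> hf.
have sp := abs_summable_pos hf; have sm := abs_summable_neg hf.
rewrite (@zsum_diff _ (fun n => c * Num.max (f n) 0) (fun n => c * Num.max (- f n) 0)).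
- rewrite (nnsumZ c0 (max_ge0 f)).
  rewrite (nnsumZ c0 (max_ge0 (fun n => - f n))).
  rewrite !fineM ?(nnsum_fin (max_ge0 f))//; last first.
    exact: (nnsum_fin (max_ge0 (fun n => - f n))).
  by rewrite /zsum -!/(nnsum _) mulrBr.
- by move=> n; rewrite mulr_ge0 ?maxr_ge0.
- by move=> n; rewrite mulr_ge0 ?maxr_ge0.
- exact: abs_summableZ.
- exact: abs_summableZ.
- by move=> n; rewrite {1}(max_sub (f n)) mulrBr.
Qed.

Lemma zsum_ge0 f : (forall n, 0 <= f n) -> 0 <= zsum f.
Proof. by move=> f0; rewrite zsum_nneg// fine_ge0// nnsum_ge0. Qed.

Lemma zsum_delta (m : int) : zsum (fun n => (n == m)%:R : R) = 1.
Proof.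
rewrite zsum_nneg// /nnsum (esumID [set m])//.
rewrite setTI esum_set1 ?eqxx ?lee_fin//.
rewrite [X in (_ + X)%E]esum1 ?adde0// => n [_ /eqP/negbTE nm].
by rewrite nm.
Qed.

End IntSums.

Section ComplexParts.
Context {R : realType}.
Implicit Types (z t : R[i]).

Lemma normc_sqr z : normc z ^+ 2 = complex.Re z ^+ 2 + complex.Im z ^+ 2.
Proof. by case: z => x y; rewrite /= sqr_sqrtr// addr_ge0 ?sqr_ge0. Qed.

Lemma normc_ge0 z : 0 <= normc z.
Proof. by case: z => x y; rewrite /= sqrtr_ge0. Qed.

Lemma Re_conjM z t : complex.Re (z^* * t) =
  complex.Re z * complex.Re t + complex.Im z * complex.Im t.
Proof. by case: z => x y; case: t => x' y' /=; rewrite mulNr opprK. Qed.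

Lemma Im_conjM z t : complex.Im (z^* * t) =
  complex.Re z * complex.Im t - complex.Im z * complex.Re t.
Proof. by case: z => x y; case: t => x' y' /=; rewrite mulNr. Qed.

Lemma ReD z t : complex.Re (z + t) = complex.Re z + complex.Re t.
Proof. by case: z; case: t. Qed.

Lemma ImD z t : complex.Im (z + t) = complex.Im z + complex.Im t.
Proof. by case: z; case: t. Qed.

Lemma ReZ (x : R) z : complex.Re (x%:C * z) = x * complex.Re z.
Proof. by case: z => p r /=; rewrite mul0r subr0. Qed.

Lemma ImZ (x : R) z : complex.Im (x%:C * z) = x * complex.Im z.
Proof. by case: z => p r /=; rewrite mul0r addr0. Qed.

Lemma real_complexM (x y : R) : (x * y)%:C = x%:C * y%:C.
Proof. by rewrite rmorphM. Qed.

Lemma real_complexD (x y : R) : (x + y)%:C = x%:C + y%:C.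
Proof. by rewrite rmorphD. Qed.

Lemma conjcM_normc z : z^* * z = (normc z ^+ 2)%:C.
Proof.
by apply/eqP; rewrite eq_complex Re_conjM Im_conjM normc_sqr /=; apply/andP; split;
  apply/eqP; ring.
Qed.

End ComplexParts.

Section Ell2Closure.
Context {R : realType}.
Implicit Types (u v : int -> R[i]).

Lemma sqnorm2E u : sqnorm2 u = nnsum (fun n => normc (u n) ^+ 2).
Proof. by []. Qed.

Lemma ell2_dom (c : R) u v : 0 <= c ->
  (forall n, normc (v n) ^+ 2 <= c * normc (u n) ^+ 2) -> ell2 u -> ell2 v.
Proof.
move=> c0 h hu; rewrite /ell2/= sqnorm2E.
apply: (@le_lt_trans _ _ (nnsum (fun n => c * normc (u n) ^+ 2))).
  exact: le_nnsum.
by rewrite nnsumZ// => [|n]; rewrite ?sqr_ge0// lte_mul_pinfty.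
Qed.

Lemma ell2D u v : ell2 u -> ell2 v -> ell2 (fun n => u n + v n).
Proof.
move=> hu hv; rewrite /ell2/= sqnorm2E.
apply: (@le_lt_trans _ _ (nnsum (fun n => 2 * normc (u n) ^+ 2 + 2 * normc (v n) ^+ 2))).
  apply: le_nnsum => n; rewrite !normc_sqr ReD ImD.
  set a := complex.Re (u n); set b := complex.Im (u n).
  set c := complex.Re (v n); set d := complex.Im (v n).
  have := sqr_ge0 (a - c); have := sqr_ge0 (b - d); rewrite !sqrrB !sqrrD; lra.
rewrite nnsumD; [|by move=> n; rewrite mulr_ge0 ?sqr_ge0..].
by rewrite !nnsumZ// ?lte_add_pinfty ?lte_mul_pinfty// => n; rewrite sqr_ge0.
Qed.

Lemma ell2M (w u : int -> R[i]) (c : R) : (forall n, normc (w n) <= c) -> ell2 u ->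
  ell2 (fun n => w n * u n).
Proof.
move=> hw; apply: (@ell2_dom (c ^+ 2)) => [|n]; first exact: sqr_ge0.
rewrite ComplexField.Normc.normcM exprMn ler_wpM2r ?sqr_ge0//.
by rewrite ler_expr_base ?normc_ge0.
Qed.

Lemma ell2Z (c : R[i]) u : ell2 u -> ell2 (fun n => c * u n).
Proof. exact: (@ell2M (fun=> c) u (normc c)). Qed.

Lemma ell2_shift (k : int) u : ell2 u -> ell2 (fun n => u (n + k)).
Proof.
rewrite /ell2/= /sqnorm2 => h; apply: le_lt_trans h.
rewrite [leRHS](@reindex_esum _ _ _ [set: int] [set: int] (fun n => n + k))//.
split=> //; first by move=> x y _ _ /addIr.
by move=> y _; exists (y - k) => //; rewrite subrK.
Qed.

Lemma ell2_0 : ell2 (fun=> 0 : R[i]).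
Proof.
rewrite /ell2/= /sqnorm2 esum1// => n _.
by rewrite ComplexField.Normc.normc0 expr0n.
Qed.

Lemma ell2_kron m : ell2 (kron m : int -> R[i]).
Proof.
rewrite /ell2/= /sqnorm2 (esumID [set m])// => [|n _]; last first.
  by rewrite lee_fin sqr_ge0.
rewrite setTI esum_set1 ?lee_fin ?sqr_ge0//.
rewrite [X in (_ + X)%E]esum1 ?adde0 ?ltry// => n [_ /eqP/negbTE nm].
by rewrite /kron nm ComplexField.Normc.normc0 expr0n.
Qed.

Lemma ell2_pair u v (f : int -> R) : ell2 u -> ell2 v ->
  (forall n, `|f n| <= normc (u n) ^+ 2 + normc (v n) ^+ 2) -> abs_summable f.
Proof.
move=> hu hv hf.
apply: (@le_lt_trans _ _ (nnsum (fun n => normc (u n) ^+ 2 + normc (v n) ^+ 2)%R)).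
  exact: le_nnsum.
by rewrite nnsumD ?lte_add_pinfty// => n; rewrite sqr_ge0.
Qed.

Lemma summable_Re u v : ell2 u -> ell2 v ->
  abs_summable (fun n => complex.Re ((u n)^* * v n)).
Proof.
move=> hu hv; apply: ell2_pair hu hv _ => n; rewrite Re_conjM !normc_sqr.
set a := complex.Re (u n); set b := complex.Im (u n).
set c := complex.Re (v n); set d := complex.Im (v n).
have := sqr_ge0 (a - c); have := sqr_ge0 (b - d).
have := sqr_ge0 (a + c); have := sqr_ge0 (b + d).
by rewrite !sqrrB !sqrrD ler_norml => *; apply/andP; split; lra.
Qed.

Lemma summable_Im u v : ell2 u -> ell2 v ->
  abs_summable (fun n => complex.Im ((u n)^* * v n)).
Proof.
move=> hu hv; apply: ell2_pair hu hv _ => n; rewrite Im_conjM !normc_sqr.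
set a := complex.Re (u n); set b := complex.Im (u n).
set c := complex.Re (v n); set d := complex.Im (v n).
have := sqr_ge0 (a - d); have := sqr_ge0 (b - c).
have := sqr_ge0 (a + d); have := sqr_ge0 (b + c).
by rewrite !sqrrB !sqrrD ler_norml => *; apply/andP; split; lra.
Qed.

End Ell2Closure.

Section Ell2Space.
Context {R : realType}.

(** Taken as a real vector space, with the real part of the complex inner product as its form [rip].
    Norms are unchanged, and no conjugate-linearity remains in the abstract estimates. *)
Record l2 := L2 { l2val :> int -> R[i]; l2P : ell2 l2val }.

Lemma l2_inj (u v : l2) : l2val u = l2val v -> u = v.
Proof.
case: u v => [u hu] [v hv] /= uv; subst v.
by congr L2; exact: Prop_irrelevance.
Qed.

HB.instance Definition _ := gen_eqMixin l2.
HB.instance Definition _ := gen_choiceMixin l2.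

Definition l2_zero : l2 := L2 ell2_0.
Definition l2_add (u v : l2) : l2 := L2 (ell2D (l2P u) (l2P v)).
Definition l2_scale (x : R) (u : l2) : l2 := L2 (ell2Z x%:C (l2P u)).
Definition l2_opp (u : l2) : l2 := L2 (ell2Z (-1) (l2P u)).

Lemma l2_addA : associative l2_add.
Proof. by move=> u v w; apply: l2_inj; apply/funext => n /=; rewrite addrA. Qed.
Lemma l2_addC : commutative l2_add.
Proof. by move=> u v; apply: l2_inj; apply/funext => n /=; rewrite addrC. Qed.
Lemma l2_add0 : left_id l2_zero l2_add.
Proof. by move=> u; apply: l2_inj; apply/funext => n /=; rewrite add0r. Qed.
Lemma l2_addN : left_inverse l2_zero l2_opp l2_add.
Proof. by move=> u; apply: l2_inj; apply/funext => n /=; rewrite mulN1r addNr. Qed.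

HB.instance Definition _ := GRing.isZmodule.Build l2 l2_addA l2_addC l2_add0 l2_addN.

Lemma l2_scaleA x y u : l2_scale x (l2_scale y u) = l2_scale (x * y) u.
Proof.
by apply: l2_inj; apply/funext => n /=; rewrite real_complexM mulrA.
Qed.
Lemma l2_scale1 : left_id 1 l2_scale.
Proof. by move=> u; apply: l2_inj; apply/funext => n /=; rewrite mul1r. Qed.
Lemma l2_scaleDr : right_distributive l2_scale +%R.
Proof. by move=> x u v; apply: l2_inj; apply/funext => n /=; rewrite mulrDr. Qed.
Lemma l2_scaleDl u : {morph l2_scale^~ u : x y / x + y}.
Proof.
by move=> x y; apply: l2_inj; apply/funext => n /=; rewrite real_complexD mulrDl.
Qed.

HB.instance Definition _ := GRing.Zmodule_isLmodule.Build R l2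
  l2_scaleA l2_scale1 l2_scaleDr l2_scaleDl.

Lemma l2valD (u v : l2) : l2val (u + v) = fun n => u n + v n.
Proof. by []. Qed.

Lemma l2valZ (x : R) (u : l2) : l2val (x *: u) = fun n => x%:C * u n.
Proof. by []. Qed.

Definition rip (u v : l2) : R := zsum (fun n => complex.Re ((u n)^* * v n)).

Lemma ripE (u v : l2) : rip u v = complex.Re (inner2 u v).
Proof. by []. Qed.

Lemma rip_inner_product : inner_product rip.
Proof.
split.
- move=> u v; rewrite /rip; congr zsum; apply/funext => n.
  by rewrite !Re_conjM; ring.
- move=> u v w; rewrite /rip -zsumD; [|exact: summable_Re (l2P _) (l2P _)..].
  by congr zsum; apply/funext => n; rewrite l2valD !Re_conjM ReD ImD; ring.
- move=> x u v; rewrite /rip -zsumZ; last exact: summable_Re (l2P _) (l2P _).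
  by congr zsum; apply/funext => n; rewrite l2valZ !Re_conjM ReZ ImZ; ring.
- move=> u; apply: zsum_ge0 => n; rewrite Re_conjM -!expr2.
  by rewrite addr_ge0 ?sqr_ge0.
Qed.

End Ell2Space.
Arguments l2 R : clear implicits.

(** * Gauge and resolution of a Jacobi operator *)

Section JacobiResolution.
Context {R : realType}.
Variables (w : int -> R[i]) (v : int -> R) (W W' : R).
Hypothesis hw : forall n, normc (w n) <= W.
Hypothesis hv : forall n, `|v n| <= W'.
Variable P : set (measurableTypeR R) -> (int -> R[i]) -> int -> R[i].
Hypothesis HP : spectral_resolution (jacobi w v) P.

Lemma normc_conj (z : R[i]) : normc z^* = normc z.
Proof. by case: z => x y /=; rewrite sqrrN. Qed.

Lemma normc_real (x : R) : normc x%:C = `|x|.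
Proof. by rewrite /= expr0n addr0 sqrtr_sqr. Qed.

Lemma jacobi_ell2 (u : int -> R[i]) : ell2 u -> ell2 (jacobi w v u).
Proof.
move=> hu; rewrite /jacobi; apply: ell2D; last first.
  by apply: (@ell2M _ (fun n => (v n)%:C) u W') => // n; rewrite normc_real.
apply: ell2D.
  by apply: (@ell2M _ w (fun n => u (n + 1)) W) => //; exact: ell2_shift.
apply: (@ell2M _ (fun n => (w (n - 1))^*) (fun n => u (n - 1)) W) => [n|].
  by rewrite normc_conj.
exact: ell2_shift.
Qed.

Definition l2_jacobi (u : l2 R) : l2 R := L2 (jacobi_ell2 (l2P u)).

(* The junk value 0 occurs only for non-measurable B. *)
Definition l2_proj (B : set (measurableTypeR R)) (u : l2 R) : l2 R :=
  if pselect (ell2 (P B u)) is left h then L2 h else 0.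

Lemma l2_projE B (u : l2 R) : measurable B -> l2val (l2_proj B u) = P B u.
Proof.
move=> mB; rewrite /l2_proj; case: pselect => //= h; exfalso; apply: h.
by have [[/(_ B mB) [h _ _ _] _ _ _ _] _] := HP; exact: h (l2P u).
Qed.

Lemma proj_linear B (c : R[i]) (u u' : int -> R[i]) : measurable B -> ell2 u -> ell2 u' ->
  P B (fun n => c * u n + u' n) = fun n => c * P B u n + P B u' n.
Proof.
by move=> mB hu hu'; have [[/(_ B mB) [_ h _ _] _ _ _ _] _] := HP; exact: h.
Qed.

Lemma proj_zero B : measurable B -> P B (fun=> 0) = fun=> 0.
Proof.
move=> mB; have := proj_linear (-1) mB (@ell2_0 R) (@ell2_0 R).
have -> : (fun n : int => -1 * 0 + 0 : R[i]) = fun=> 0.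
  by apply/funext => n; rewrite mulr0 addr0.
by move=> ->; apply/funext => n; rewrite mulN1r addNr.
Qed.

Lemma proj_scale B (c : R[i]) (u : int -> R[i]) : measurable B -> ell2 u ->
  P B (fun n => c * u n) = fun n => c * P B u n.
Proof.
move=> mB hu; have := proj_linear c mB hu (@ell2_0 R).
rewrite proj_zero//.
have -> : (fun n => c * u n + 0) = fun n => c * u n by apply/funext => n; rewrite addr0.
by move=> ->; apply/funext => n; rewrite addr0.
Qed.

Lemma jacobi_add (u u' : int -> R[i]) :
  jacobi w v (fun n => u n + u' n) = fun n => jacobi w v u n + jacobi w v u' n.
Proof. by apply/funext => n; rewrite /jacobi; ring. Qed.

Lemma jacobi_scale (c : R[i]) (u : int -> R[i]) :
  jacobi w v (fun n => c * u n) = fun n => c * jacobi w v u n.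
Proof. by apply/funext => n; rewrite /jacobi; ring. Qed.

(* The quadratic form of the operator is real; polarising with u' and i u' gives symmetry. *)
Lemma l2_jacobi_sym (u u' : l2 R) : rip u (l2_jacobi u') = rip (l2_jacobi u) u'.
Proof.
pose beta (f g : int -> R[i]) := zsum (fun n => complex.Im ((f n)^* * jacobi w v g n)).
have beta0 f : ell2 f -> beta f f = 0.
  move=> hf; have [_ /(_ f hf) [nu [_ _ e]]] := HP.
  by rewrite /beta -[LHS]/(complex.Im (inner2 f (jacobi w v f))) e.
have betaD f g : ell2 f -> ell2 g -> beta f g + beta g f = 0.
  move=> hf hg; have := beta0 _ (ell2D hf hg); rewrite /beta jacobi_add.
  have -> : (fun n => complex.Im ((f n + g n)^* * (jacobi w v f n + jacobi w v g n))) =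
     fun n => (complex.Im ((f n)^* * jacobi w v f n) + complex.Im ((g n)^* * jacobi w v g n)) +
      (complex.Im ((f n)^* * jacobi w v g n) + complex.Im ((g n)^* * jacobi w v f n)).
    by apply/funext => n; rewrite !Im_conjM !ReD !ImD; ring.
  have s f' g' : ell2 f' -> ell2 g' ->
      abs_summable (fun n => complex.Im ((f' n)^* * jacobi w v g' n)).
    by move=> hf' hg'; apply: summable_Im => //; exact: jacobi_ell2.
  rewrite (zsumD (abs_summableD (s _ _ hf hf) (s _ _ hg hg))
    (abs_summableD (s _ _ hf hg) (s _ _ hg hf))).
  rewrite (zsumD (s _ _ hf hf) (s _ _ hg hg)) (zsumD (s _ _ hf hg) (s _ _ hg hf)).
  by rewrite -/(beta f f) -/(beta g g) !beta0// !add0r.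
have hi : ell2 (fun n => 'i * u' n) by apply: ell2Z; exact: l2P.
have := betaD _ _ (l2P u) hi; rewrite /beta jacobi_scale.
have -> : (fun n => complex.Im ((u n)^* * ('i * jacobi w v u' n))) =
    fun n => complex.Re ((u n)^* * l2_jacobi u' n).
  apply/funext => n; rewrite Im_conjM Re_conjM /=.
  by case: (jacobi w v u' n) => x y /=; ring.
have -> : (fun n => complex.Im (('i * u' n)^* * jacobi w v u n)) =
    fun n => - complex.Re ((l2_jacobi u n)^* * u' n).
  apply/funext => n; rewrite Im_conjM Re_conjM /=.
  by case: (u' n) => x y /=; ring.
by rewrite zsumN => /eqP; rewrite subr_eq0 => /eqP.
Qed.

Lemma l2_resolution : resolution (@rip R) l2_jacobi l2_proj.
Proof.
have [pvm hnu] := HP.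
split.
- exact: rip_inner_product.
- by move=> f g; apply: l2_inj; rewrite /= jacobi_add.
- by move=> x f; apply: l2_inj; rewrite /= jacobi_scale.
- exact: l2_jacobi_sym.
- move=> B f g mB; apply: l2_inj; rewrite l2valD !l2_projE//.
  have := proj_linear 1 mB (l2P f) (l2P g).
  have -> : (fun n => 1 * f n + g n) = fun n => f n + g n.
    by apply/funext => n; rewrite mul1r.
  by move=> ->; apply/funext => n; rewrite mul1r.
- move=> B x f mB; apply: l2_inj; rewrite l2valZ !l2_projE//.
  exact: proj_scale (l2P f).
- move=> B f g mB; rewrite !ripE !l2_projE//.
  have [/(_ B mB) [_ _ _ h] _ _ _ _] := pvm.
  by rewrite h //; exact: l2P.
- move=> f; apply: l2_inj; rewrite l2_projE//.
  by have [_ h _ _ _] := pvm; rewrite h //; exact: l2P.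
- move=> B C f mB mC; apply: l2_inj.
  rewrite !l2_projE//; last exact: measurableI.
  by have [_ _ _ h _] := pvm; rewrite h //; exact: l2P.
- have [_ _ [x hx] _ _] := pvm; exists x => f; apply: l2_inj.
  rewrite l2_projE; last exact: measurable_itv.
  by apply: hx; exact: l2P.
- move=> f; have [nu [e int eH]] := hnu _ (l2P f).
  exists nu; split => //.
    by move=> B mB; rewrite e// ripE l2_projE.
  by rewrite ripE eH.
Qed.

Hypothesis w0 : forall n, w n != 0.

(* The diagonal unitary with entries gauge_phase n turns the off-diagonal entries w_n
   into |w_n| and leaves the spectral measures of the basis vectors unchanged. *)
Definition link_phase (n : int) : R[i] := (w n)^* / (normc (w n))%:C.

Definition gauge_phase (n : int) : R[i] :=
  match n with
  | Posz k => \prod_(i < k) link_phase i%:Z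
  | Negz k => \prod_(i < k.+1) (link_phase (Negz i))^-1
  end.

Lemma normc_w_gt0 n : 0 < normc (w n).
Proof.
rewrite lt_neqAle normc_ge0 andbT eq_sym; apply/eqP => h.
by move/eqP: (w0 n); apply; exact: ComplexField.Normc.eq0_normc.
Qed.

Lemma link_phase_norm n : normc (link_phase n) = 1.
Proof.
rewrite /link_phase ComplexField.Normc.normcM ComplexField.Normc.normcV normc_conj normc_real.
by rewrite ger0_norm ?normc_ge0// divff// gt_eqF ?normc_w_gt0.
Qed.

Lemma link_phase_neq0 n : link_phase n != 0.
Proof.
apply/eqP => h; have := link_phase_norm n; rewrite h ComplexField.Normc.normc0.
by move=> /eqP; rewrite eq_sym oner_eq0.
Qed.

Lemma gauge_phaseS n : gauge_phase (n + 1) = gauge_phase n * link_phase n.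
Proof.
case: n => k.
  by rewrite -PoszD addn1 /gauge_phase big_ord_recr.
case: k => [|k].
  have -> : Negz 0 + 1 = Posz 0 by [].
  by rewrite /gauge_phase big_ord0 big_ord1 mulVf ?link_phase_neq0.
have -> : Negz k.+1 + 1 = Negz k by rewrite !NegzE; lia.
by rewrite /gauge_phase [in RHS]big_ord_recr/= mulfVK ?link_phase_neq0.
Qed.

Lemma gauge_phase_norm n : normc (gauge_phase n) = 1.
Proof.
have prod1 (k : nat) (F : 'I_k -> R[i]) : (forall i, normc (F i) = 1) ->
    normc (\prod_(i < k) F i) = 1.
  move=> h; elim/big_ind: _ => //; first exact: ComplexField.Normc.normc1.
  by move=> x y hx hy; rewrite ComplexField.Normc.normcM hx hy mulr1.
case: n => k; rewrite /gauge_phase; apply: prod1 => i; first exact: link_phase_norm.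
by rewrite ComplexField.Normc.normcV link_phase_norm invr1.
Qed.

Definition gauge_basis (n : int) : l2 R := L2 (ell2Z (gauge_phase n) (ell2_kron n)).

Lemma link_out n : (w n)^* * gauge_phase n = (normc (w n))%:C * gauge_phase (n + 1).
Proof.
rewrite gauge_phaseS /link_phase.
have h : (normc (w n))%:C != 0 :> R[i].
  by rewrite eq_complex/= eqxx andbT gt_eqF ?normc_w_gt0.
by field.
Qed.

Lemma link_in n : w n * gauge_phase (n + 1) = (normc (w n))%:C * gauge_phase n.
Proof.
rewrite gauge_phaseS /link_phase.
have h : (normc (w n))%:C != 0 :> R[i].
  by rewrite eq_complex/= eqxx andbT gt_eqF ?normc_w_gt0.
have e : (w n)^* * w n = (normc (w n))%:C * (normc (w n))%:C.
  by rewrite conjcM_normc expr2 real_complexM.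
have -> : w n * (gauge_phase n * ((w n)^* / (normc (w n))%:C)) =
  ((w n)^* * w n) / (normc (w n))%:C * gauge_phase n by ring.
by rewrite e; field.
Qed.

Lemma gauge_jacobi_basis :
  jacobi_basis (@rip R) l2_jacobi (fun n => normc (w n)) v gauge_basis.
Proof.
split.
- move=> m n; rewrite /rip /=.
  have [->|mn] := eqVneq m n; last first.
    rewrite (_ : (fun _ => _) = fun n => 0 * 0); last first.
      apply/funext => k; rewrite [RHS]mulr0 /kron.
      have [->|km] := eqVneq k m; first by rewrite (negbTE mn) mulr0n !mulr0.
      by rewrite mulr0n !mulr0 Re_conjM /= !mul0r addr0.
    rewrite zsumZ ?mul0r//.
    by rewrite /abs_summable /nnsum esum1// => k _; rewrite normr0.
  rewrite (_ : (fun _ => _) = fun k => (k == n)%:R); first exact: zsum_delta.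
  apply/funext => k; rewrite conjcM_normc /= /kron.
  rewrite ComplexField.Normc.normcM gauge_phase_norm mul1r.
  case: (k == n); first by rewrite ComplexField.Normc.normc1 expr1n.
  by rewrite ComplexField.Normc.normc0 expr0n.
- move=> m; apply: l2_inj; apply/funext => n.
  rewrite /= /jacobi /kron.
  have t1 : w n * (gauge_phase m * (n + 1 == m)%:R) =
      (normc (w (m - 1)))%:C * (gauge_phase (m - 1) * (n == m - 1)%:R).
    have -> : (n + 1 == m) = (n == m - 1) by rewrite -(subr_eq n) opprK.
    have [->|nm] := eqVneq n (m - 1); last by rewrite !mulr0.
    by rewrite mulr1n !mulr1 -link_in subrK.
  have t2 : (w (n - 1))^* * (gauge_phase m * (n - 1 == m)%:R) =
      (normc (w m))%:C * (gauge_phase (m + 1) * (n == m + 1)%:R).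
    rewrite subr_eq.
    have [->|nm] := eqVneq n (m + 1); last by rewrite !mulr0.
    by rewrite addrK mulr1n !mulr1 -link_out.
  have t3 : (v n)%:C * (gauge_phase m * (n == m)%:R) =
      (v m)%:C * (gauge_phase m * (n == m)%:R).
    by have [->|nm] := eqVneq n m; rewrite ?mulr0.
  by rewrite t1 t2 t3 [X in X + _ = _]addrC.
Qed.

(** [P B] is complex linear, so the unimodular phase appears in both arguments of the inner product
    and cancels. *)
Lemma gauge_measure B n : measurable B ->
  complex.Re (inner2 (kron n) (P B (kron n))) =
  ipn (@rip R) (l2_proj B (gauge_basis n)) ^+ 2.
Proof.
move=> mB; rewrite (ipn_proj l2_resolution _ mB) ripE l2_projE// /=.
rewrite proj_scale//; last exact: ell2_kron.
congr zsum; apply/funext => k; rewrite !Re_conjM.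
have := gauge_phase_norm n; move=> /(congr1 (fun x => x ^+ 2)).
rewrite normc_sqr expr1n.
case: (gauge_phase n) => a b /= ab.
case: (kron n k) => x y; case: (P B (kron n) k) => x' y' /=.
rewrite -[LHS]mul1r -ab; ring.
Qed.

End JacobiResolution.

(** * From spectral continuity to the dimension, and assembly *)

Lemma normc_dist (R : realType) (x y : R[i]) : `|normc x - normc y| <= normc (x - y).
Proof. exact: (@ler_dist_dist R (Rcomplex R) x y). Qed.

(** The supremum is nonnegative even when no gamma is admissible, by the convention for the empty
    set; this settles s <= 0. If it were below s, the midpoint would be an admissible gamma above
    it. *)
Lemma dim_spe_ge (R : realType) (mu : {measure set (measurableTypeR R) -> \bar R})
    (s : R) : s < 1 ->
  (forall gamma, 0 < gamma < 1 -> gamma < s -> spectral_continuous mu gamma) ->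
  s <= dim_spe mu.
Proof.
move=> s1 h; rewrite /dim_spe; set S := [set gamma | _].
have ub : ubound S 1 by move=> g [/andP[_ /ltW]].
have hub : has_ubound S by exists 1.
have S0 : 0 <= sup S.
  have [[g Sg]|nS] := pselect (S !=set0); last first.
    rewrite (_ : S = set0) ?sup0//.
    by apply/seteqP; split => // g Sg; exfalso; apply: nS; exists g.
  have [/andP[g0 _] _] := Sg.
  by apply: le_trans (ltW g0) _; apply: ub_le_sup.
rewrite leNgt; apply/negP => hs.
have Sm : S ((sup S + s) / 2).
  have m : 0 < (sup S + s) / 2 < 1 by apply/andP; split; lra.
  by split => //; apply: h => //; lra.
by have := ub_le_sup hub Sm; lra.
Qed.

Theorem theorem2p1 (R : realType) :
  exists C : R -> R -> R -> R -> R,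
  forall (w : int -> R[i]) (v : int -> R)
         (mu : {measure set (measurableTypeR R) -> \bar R})
         (Lambda beta delta : R) (q : nat -> nat),
    let normw := sup (range (fun n : int => normc (w n))) in
    let normv := sup (range (fun n : int => `|v n|)) in
    let c := C delta Lambda normw normv in
    (forall n, w n != 0) ->
    has_ubound (range (fun n : int => normc (w n))) ->
    has_ubound (range (fun n : int => `|v n|)) ->
    is_spectral_measure (jacobi w v) mu ->
    0 < Lambda -> 0 < beta -> 0 < delta ->
    (forall k, (0 < q k)%N) ->
    q @ \oo --> \oo ->
    (forall (k : nat) (m : int),
       (`|m|)%:~R <= expR (delta * beta * (q k)%:R) ->
       [/\ normc (w m - w (m + (q k)%:Z)) <= expR (- (beta * (q k)%:R))
             /\ normc (w m - w (m - (q k)%:Z)) <= expR (- (beta * (q k)%:R)),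
           `|v m - v (m + (q k)%:Z)| <= expR (- (beta * (q k)%:R))
             /\ `|v m - v (m - (q k)%:Z)| <= expR (- (beta * (q k)%:R))
         & expR (- (Lambda * (q k)%:R))
             < \prod_(j < q k) normc (w (m + j%:Z))]) ->
    [/\ 0 < c,
        c < beta ->
          forall gamma : R, 0 < gamma < 1 -> gamma < 1 - c / beta ->
            spectral_continuous mu gamma
      & 1 - c / beta <= dim_spe mu].
Proof.
(* The sum W + W' + 1 is a common bound for weights and potential that is also at least 1. *)
exists (fun delta Lambda W W' => continuity_constant Lambda (W + W' + 1) delta).
move=> w v mu Lambda beta delta q W W' c w0 bw bv [P HP hmu] L0 b0 d0 q0 qoo hq.
have hw n : normc (w n) <= W by apply: ub_le_sup => //; exists n.
have hv n : `|v n| <= W' by apply: ub_le_sup => //; exists n.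
have W0 : 0 <= W by exact: le_trans (normc_ge0 _) (hw 0).
have W'0 : 0 <= W' by exact: le_trans (normr_ge0 _) (hv 0).
pose A := W + W' + 1.
have A1 : 1 <= A by rewrite /A; lra.
have c0 : 0 < c by exact: continuity_constant_gt0.
have cb0 : 0 < c / beta by rewrite divr_gt0.
have cont : c < beta -> forall gamma : R, 0 < gamma < 1 -> gamma < 1 - c / beta ->
    spectral_continuous mu gamma.
  move=> cb gamma g01 gc.
  apply: (@ae_spectral_continuous R (l2 R) (@rip R) (l2_jacobi hw hv) (l2_proj P)
    (l2_resolution hw hv HP) (fun n => normc (w n)) v (gauge_basis w)
    (gauge_jacobi_basis hw hv w0) mu _ A Lambda beta delta gamma A1 _ _ q) => //.
  - move=> B mB; rewrite hmu//.
    by rewrite !(gauge_measure hw hv HP w0).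
  - move=> n; rewrite normc_w_gt0//=; apply: le_trans (hw n) _.
    by rewrite /A; lra.
  - by move=> n; apply: le_trans (hv n) _; rewrite /A; lra.
  - move=> k m /(hq k)[[h1 h2] _ _]; split;
      [exact: le_trans (normc_dist _ _) h1|exact: le_trans (normc_dist _ _) h2].
  - by move=> k m /(hq k)[_ h _].
  - by move=> k m /(hq k)[_ _ h].
split=> //.
apply: dim_spe_ge; first by lra.
move=> gamma g01 gc; apply: cont => //.
(* The dimension bound is claimed without assuming c < beta: a positive gamma below 1 - c / beta
   already forces it. *)
rewrite -[ltRHS]mul1r -ltr_pdivrMr//.
by move: g01 => /andP[g0 _]; lra.
Qed.
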